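(* Let $n\ge 2$ and $m\ge 0$. If $(n,m)\ne(2,3)$, then $H^1(\mathcal{T}_{\mathbb{P}^{n|m}})=0$, i.e. $\mathbb{P}^{n|m}$ has no first order deformations. If $(n,m)=(2,3)$, then $h^1(\mathcal{T}_{\mathbb{P}^{2|3}})=0|1$, i.e. $\mathbb{P}^{2|3}$ has a single, odd, first order deformation.
   Context: The complex projective superspace $\mathbb{P}^{n|m}$ is the quotient of $(\mathbb{C}^{n+1|m})^\times$ (the restriction of $\mathbb{C}^{n+1|m}$ to $\mathbb{C}^{n+1}\setminus\{0\}$) by the $\mathbb{C}^*$-action scaling all even and odd coordinates by $\lambda$. $\mathcal{T}_{\mathbb{P}^{n|m}}$ is its tangent sheaf (sheaf of superderivations of the structure sheaf); first order deformations are classified by $H^1(\mathcal{T}_{\mathbb{P}^{n|m}})$. Writing $h^1=a|b$ means that $H^1$ has even dimension $a$ and odd dimension $b$. *)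

(* Defs.v *)
From mathcomp Require Import all_boot all_algebra.
From mathcomp Require Import complex.
From mathcomp Require Import boolp classical_sets functions reals.
From mathcomp Require mpoly.

Set Implicit Arguments.
Unset Strict Implicit.
Unset Printing Implicit Defensive.

Import GRing.Theory.
Local Open Scope classical_set_scope.
Local Open Scope ring_scope.

(* First Cech cohomology H^1(M, F), the direct limit over all open covers of M,
   of a sheaf F of K-modules on a topological space M.  The sections F U over
   all open sets U are realised as subsets of one K-module E; res U restricts
   to U.  In degree 1 this limit is the usual sheaf cohomology, for every sheaf
   on every topological space. *)
Section Cech.
Variables (K : pzRingType) (X : Type) (opn : set (set X)) (M : set X).
Variables (E : lmodType K) (F : set X -> set E) (res : set X -> E -> E).

Record open_cover := OpenCover {
  idx : Type;
  piece :> idx -> set X;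
  piece_open : forall i, opn (piece i);
  piece_cover : \bigcup_i piece i = M
}.

Definition cocycle1 (U : open_cover) (z : idx U -> idx U -> E) : Prop :=
  (forall i j, F (U i `&` U j) (z i j)) /\
  (forall i j k, let V := U i `&` U j `&` U k in
     res V (z i j) + res V (z j k) = res V (z i k)).

Definition coboundary1 (U : open_cover) (z : idx U -> idx U -> E) : Prop :=
  exists s : idx U -> E, (forall i, F (U i) (s i)) /\
    (forall i j, z i j = res (U i `&` U j) (s j) - res (U i `&` U j) (s i)).

Definition refines (W U : open_cover) (tau : idx W -> idx U) : Prop :=
  forall i, W i `<=` U (tau i).

Definition pull1 (W U : open_cover) (tau : idx W -> idx U)
    (z : idx U -> idx U -> E) : idx W -> idx W -> E :=
  fun i j => res (W i `&` W j) (z (tau i) (tau j)).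

(* Every element of the direct limit is represented by a cocycle on a cover. *)
Record H1_class := H1Class {
  cls_cover : open_cover;
  cls_cochain : idx cls_cover -> idx cls_cover -> E;
  cls_cocycle : cocycle1 cls_cochain
}.

(* [z] = \sum_k c_k [e_k] in the direct limit: the relation holds up to a
   coboundary on some common refinement of the covers involved. *)
Definition H1_lincomb (d : nat) (e : 'I_d -> H1_class) (c : 'rV[K]_d)
    (z : H1_class) : Prop :=
  exists (W : open_cover) (tau : idx W -> idx (cls_cover z))
         (sigma : forall k : 'I_d, idx W -> idx (cls_cover (e k))),
    [/\ refines tau, (forall k, refines (sigma k)) &
        coboundary1 (fun i j => pull1 tau (@cls_cochain z) i j
          - \sum_(k < d) c 0 k *: pull1 (sigma k) (@cls_cochain (e k)) i j)].

(* H^1(M, F) has a basis with d elements; for d = 0 this is H^1(M, F) = 0. *)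
Definition H1_dim (d : nat) : Prop :=
  exists e : 'I_d -> H1_class,
    forall z : H1_class, exists! c : 'rV[K]_d, H1_lincomb e c z.

End Cech.

(* The exterior algebra C[theta_1, ..., theta_m]: f J is the coefficient of
   theta_J, the product of the theta_j with j in J in increasing order. *)
Section Grassmann.
Variables (C : comNzRingType) (m : nat).

Definition grassmann := {ffun {set 'I_m} -> C}.

Definition wedge_sign (J K : {set 'I_m}) : C :=
  (-1) ^+
    #|[pred jk : 'I_m * 'I_m | [&& jk.1 \in J, jk.2 \in K & (jk.2 < jk.1)%N]]|.

Definition wedge (f g : grassmann) : grassmann :=
  [ffun L : {set 'I_m} => \sum_(J : {set 'I_m} | J \subset L)
     wedge_sign J (L :\: J)%SET * f J * g (L :\: J)%SET].

End Grassmann.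

Section ProjectiveSuperspace.
Variables (R : realType) (n m : nat).

Local Notation C := R[i].
Local Notation pt := 'rV[C]_n.+1.
Local Notation Lam := (grassmann C m).
Local Notation poly := (mpoly.mpoly n.+1 C).

Definition evalp (p : poly) (x : pt) : C := mpoly.meval (fun i => x ord0 i) p.

Definition zariski_open (U : set pt) : Prop :=
  exists S : set poly, U = [set x | exists2 p, S p & evalp p x != 0].

Definition cone : set pt := [set x | x != 0].

(* The open sets of P^n = cone / C^* for the quotient of the Zariski topology,
   each encoded as its preimage in the cone. *)
Definition proj_open (U : set pt) : Prop :=
  [/\ zariski_open U, U `<=` cone &
      forall (l : C) x, l != 0 -> U x -> U (l *: x)].

Definition regular_on (U : set pt) (f : pt -> C) : Prop :=
  forall x, U x -> exists V : set pt, exists p q : poly,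
    [/\ zariski_open V, V x, V `<=` U &
        forall y, V y -> evalp q y != 0 /\ f y = evalp p y / evalp q y].

(* The action of l on functions on C^{n+1|m}: x_i |-> l x_i and
   theta_j |-> l theta_j. *)
Definition scale_pull (l : C) (f : pt -> Lam) : pt -> Lam :=
  fun x => [ffun J : {set 'I_m} => l ^+ #|J| * f (l *: x) J].

(* Sections over U of the structure sheaf of P^{n|m}: the C^*-invariant
   functions on the restriction of C^{n+1|m} to U.  A function on U is
   represented by its extension by 0 to all of C^{n+1}, so that equality of
   sections is Leibniz equality. *)
Definition struct_sheaf (U : set pt) : set (pt -> Lam) :=
  [set f : pt -> Lam | [/\ forall J : {set 'I_m}, regular_on U (fun x => f x J),
               forall l : C, l != 0 -> scale_pull l f = f &
               forall x, ~ U x -> f x = 0]].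

Definition res_struct (U : set pt) (f : pt -> Lam) : pt -> Lam := patch 0 U f.

(* Parities are booleans: false is even, true is odd. *)
Definition has_parity (a : bool) (f : pt -> Lam) : Prop :=
  forall x (J : {set 'I_m}), f x J != 0 -> odd #|J| = a.

Definition mul_section (f g : pt -> Lam) : pt -> Lam :=
  fun x => wedge (f x) (g x).

Definition sheaf_op := set pt -> (pt -> Lam) -> (pt -> Lam).

(* Sections over U of the parity a part of the tangent sheaf: the C-linear
   superderivations D of parity a of the structure sheaf restricted to U.
   D V is meaningful only on sections over the open sets V contained in U; the
   last clause makes it 0 elsewhere, so that equality of sections is again
   Leibniz equality. *)
Definition tangent_sheaf (a : bool) (U : set pt) : set sheaf_op :=
  [set D : sheaf_op |
    (forall V, proj_open V -> V `<=` U ->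
       [/\ forall f, struct_sheaf V f -> struct_sheaf V (D V f),
           forall (c : C) f g, struct_sheaf V f -> struct_sheaf V g ->
             D V (c *: f + g) = c *: D V f + D V g,
           forall b f, struct_sheaf V f -> has_parity b f ->
             has_parity (a (+) b) (D V f),
           forall b f g, struct_sheaf V f -> struct_sheaf V g ->
             has_parity b f ->
             D V (mul_section f g) =
               mul_section (D V f) g
               + (-1) ^+ (a && b) *: mul_section f (D V g) &
           forall W f, proj_open W -> W `<=` V -> struct_sheaf V f ->
             D W (res_struct W f) = res_struct W (D V f)])
    /\ (forall V f, ~ [/\ proj_open V, V `<=` U & struct_sheaf V f] ->
          D V f = 0)].

Definition res_tangent (W : set pt) (D : sheaf_op) : sheaf_op :=
  patch 0 [set V | V `<=` W] D.

End ProjectiveSuperspace.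

(* h^1 of the tangent sheaf of P^{n|m} over C is a|b. *)
Definition h1_tangent (R : realType) (n m a b : nat) : Prop :=
  H1_dim (@proj_open R n) (@cone R n)
    (@tangent_sheaf R n m false) (@res_tangent R n m) a /\
  H1_dim (@proj_open R n) (@cone R n)
    (@tangent_sheaf R n m true) (@res_tangent R n m) b.

(* Main.v *)
Require Import Defs.
From mathcomp Require Import all_boot all_order all_algebra.
From mathcomp Require Import complex.
From mathcomp Require Import boolp classical_sets functions reals.
From mathcomp Require mpoly.
From mathcomp Require Import ring lra zify.

(** Let K be the complex numbers, and write E for Euler's field
    \sum_l x_l d/dx_l + \sum_k theta_k d/dtheta_k. Over an open subset of a
    chart x_i <> 0, a derivation of the structure sheaf is the action on
    functions of degree 0 of a vector field \sum_v T_v d/dv whose coefficients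
    T_v have degree 1 (the theta_k count as coordinates of degree 1), and this
    field is unique modulo the multiples of E: a section is locally a polynomial
    in the theta_k / x_i whose coefficients are quotients of polynomials in the
    x_l / x_i, so the derivation is known from its values on these coordinates
    (cval, tangent_repr). The tangent sheaf is thus the quotient of the fields
    with coefficients of degree 1 by the line spanned by E.

    Let z be a cocycle for an arbitrary open cover. On each chart its
    coefficients are cocycles of homogeneous functions, and these are
    coboundaries (affine_acyclic): the Nullstellensatz, which the uncountability
    of K makes elementary, provides a homogeneous partition of unity that
    absorbs the denominators. Two such trivialisations of z, on the charts i and
    j, differ on their intersection by a field Y_ij, and the Y_ij form a cocycle
    modulo E on the standard cover (cocycle_normal_form). So only the standard
    cover remains to be understood.

    There Y_ij + Y_jk - Y_ik = G_ijk E, where G is a Cech 2-cocycle of functions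
    of degree 0. All these functions are Laurent polynomials in x with
    coefficients in the exterior algebra, and the Cech complex splits into its
    monomials. A monomial without pole along some coordinate x_k contributes
    nothing, by the homotopy that selects the index k (cech_H1, cech_H2). For
    n >= 2 a function on the intersection of two charts has such a coordinate,
    hence Y is a coboundary modulo E as soon as G is a coboundary
    (unobstructed). The obstruction is a monomial of G with a pole along every
    coordinate. It becomes a monomial of Y when multiplied by any coordinate, so
    every x_l must cancel one of its poles and every theta_k must annihilate it:
    it is theta_1 ... theta_m / (x_0 x_1 x_2) with n = 2, and m = 3 because it
    has degree 0 (obstruction).

    In this case a cocycle exc with this obstruction exists. Its parity is odd,
    it is not a coboundary, and subtracting a multiple of it from Y removes the
    obstruction (std_cover, exc_nontrivial). Hence every class is a multiple of
    the class of exc, and the multiple is unique since two normal forms of one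
    class with different multiples would trivialise exc (normal_form_unique). *)

Set Implicit Arguments.
Unset Strict Implicit.
Unset Printing Implicit Defensive.

Import Order.TTheory GRing.Theory Num.Theory.
Local Open Scope classical_set_scope.
Local Open Scope ring_scope.

(** * Polynomials as functions on affine space *)

Section PolynomialFunctions.
Import mpoly.
Variables (R : realType) (n : nat).
Local Notation K := R[i].
Local Notation pt := 'rV[K]_n.+1.
Local Notation poly := {mpoly K[n.+1]}.
Implicit Types (p q : poly) (x v : pt).

Lemma evalpD p q x : evalp (p + q) x = evalp p x + evalp q x.
Proof. exact: mevalD. Qed.
Lemma evalpB p q x : evalp (p - q) x = evalp p x - evalp q x.
Proof. exact: mevalB. Qed.
Lemma evalpM p q x : evalp (p * q) x = evalp p x * evalp q x.
Proof. exact: mevalM. Qed.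
Lemma evalpZ c p x : evalp (c *: p) x = c * evalp p x.
Proof. exact: mevalZ. Qed.
Lemma evalp0 x : evalp (0 : poly) x = 0.
Proof. exact: meval0. Qed.
Lemma evalp1 x : evalp (1 : poly) x = 1.
Proof. exact: meval1. Qed.
Lemma evalpC c x : evalp (c%:MP : poly) x = c.
Proof. exact: mevalC. Qed.
Lemma evalpXU i x : evalp ('X_i : poly) x = x 0 i.
Proof. exact: mevalXU. Qed.
Lemma evalpX m x : evalp ('X_[m] : poly) x = \prod_i x 0 i ^+ m i.
Proof. exact: mevalX. Qed.
Lemma evalpXn p k x : evalp (p ^+ k) x = evalp p x ^+ k.
Proof. exact: rmorphXn. Qed.
Lemma evalp_sum (I : Type) (r : seq I) (P : pred I) (F : I -> poly) x :
  evalp (\sum_(i <- r | P i) F i) x = \sum_(i <- r | P i) evalp (F i) x.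
Proof. exact: raddf_sum. Qed.
(** The restriction of p to the polynomial curve t |-> (h_0(t), ..., h_n(t)). *)
Definition curve (h : 'I_n.+1 -> {poly K}) p : {poly K} := mmap (@polyC K) h p.

Lemma curve_horner h p t x : (forall i, (h i).[t] = x 0 i) ->
  (curve h p).[t] = evalp p x.
Proof.
move=> hx; rewrite /curve /mmap horner_sum /evalp mevalE.
apply: eq_bigr => m _; rewrite hornerM hornerC; congr (_ * _).
by rewrite /mmap1 horner_prod; apply: eq_bigr => i _; rewrite horner_exp hx.
Qed.

Lemma mpoly_alg_ind (Q : poly -> Prop) : (forall c, Q c%:MP) ->
  (forall i, Q 'X_i) -> (forall p q, Q p -> Q q -> Q (p + q)) ->
  (forall p q, Q p -> Q q -> Q (p * q)) -> forall p, Q p.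
Proof.
move=> QC QX QD QM; move=> p; elim/mpolyind: p => [|c m p _ _ IH].
  by rewrite -(mpolyC0 n.+1).
apply: QD IH; rewrite -mul_mpolyC; apply: (QM _ _ (QC c)).
rewrite mpolyXE_id; elim/big_rec: _ => [|i q _ Qq].
  by rewrite -(mpolyC1 n.+1).
apply: (QM _ _ _ Qq); elim: (m i) => [|k IH]; first by rewrite expr0 -(mpolyC1 n.+1).
by rewrite exprS; apply: QM.
Qed.

Lemma mderivXU (i j : 'I_n.+1) : ('X_j : poly)^`M(i) = (j == i)%:R%:MP.
Proof.
rewrite mderivX mnm1E; case: eqP => [->|_].
  rewrite scale1r mpolyC1 -(mpolyX0 n.+1 K); congr mpolyX.
  by apply/mnmP => k; rewrite mnmBE subnn mnm0E.
by rewrite scale0r mpolyC0.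
Qed.

Lemma curve_deriv h p :
  (curve h p)^`() = \sum_i curve h p^`M(i) * (h i)^`().
Proof.
elim/mpoly_alg_ind: p => [c|j|p q IHp IHq|p q IHp IHq].
- rewrite /curve mmapC derivC big1 // => i _.
  by rewrite mderivC mmap0 mul0r.
- rewrite /curve mmapX mmap1U (bigD1 j) //= big1 => [|i ij].
    by rewrite mderivXU mmapC eqxx mul1r addr0.
  by rewrite mderivXU mmapC eq_sym (negPf ij) mul0r.
- rewrite /curve mmapD derivD IHp IHq -big_split; apply: eq_bigr => i _.
  by rewrite mderivD mmapD mulrDl.
- rewrite /curve rmorphM derivM IHp IHq mulr_suml mulr_sumr -big_split.
  apply: eq_bigr => i _; rewrite mderivM mmapD !rmorphM /=.
  by rewrite mulrDl mulrAC -!mulrA.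
Qed.

(** q r vanishes everywhere, hence has more roots than its degree allows. *)
Lemma poly_cofinite_eq0 (q r : {poly K}) : r != 0 ->
  (forall t, r.[t] != 0 -> q.[t] = 0) -> q = 0.
Proof.
move=> r0 qr; apply/eqP; have : q * r == 0; last first.
  by rewrite mulf_eq0 (negPf r0) orbF.
apply/negPn/negP => qr0.
pose rs : seq K := map (fun k => k%:R) (iota 0 (size (q * r))).
suff /(max_poly_roots qr0) : all (root (q * r)) rs.
  rewrite /rs size_map size_iota ltnn => /(_ _)/negP; apply => //.
  rewrite map_inj_in_uniq ?iota_uniq // => i j _ _ /eqP.
  by rewrite eqr_nat => /eqP.
apply/allP => _ /mapP[k _ ->]; rewrite rootE hornerM.
by have [->|/qr ->] := eqVneq r.[k%:R] 0; rewrite ?mulr0 ?mul0r.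
Qed.

(** By restriction to lines, the derivatives of p vanish everywhere as p does;
    their values at 0 are multiples of the coefficients of p. *)
Lemma mpoly_eq0 p : (forall x, evalp p x = 0) -> p = 0.
Proof.
have D q l : (forall x, evalp q x = 0) -> forall x, evalp q^`M(l) x = 0.
  move=> q0 x; pose h i := (x 0 i)%:P + (i == l)%:R *: ('X : {poly K}).
  have hq : curve h q = 0.
    apply: (@poly_cofinite_eq0 _ 1) => [|t _]; first exact: oner_neq0.
    rewrite (@curve_horner _ _ _ (\row_i (h i).[t])) ?q0 // => i.
    by rewrite mxE.
  have := congr1 (fun r : {poly K} => r^`().[0]) hq.
  rewrite /= curve_deriv (bigD1 l) //= big1 => [|i il]; last first.
    by rewrite /h (negPf il) scale0r addr0 derivC mulr0.
  rewrite addr0 deriv0 horner0 /h eqxx scale1r derivD derivC derivX add0r mulr1.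
  rewrite (@curve_horner _ _ _ x) // => i.
  by rewrite /h !hornerE; case: (i == l).
move=> p0; apply/mpolyP => m; rewrite mcoeff0.
have /(_ 0) : forall x, evalp p^`M[m] x = 0.
  rewrite /mderivm; elim: (enum _) => //= i s IH.
  by elim: (m i) => //= k; apply: D.
have -> : evalp p^`M[m] 0 = (p^`M[m])@_0.
  rewrite [p^`M[m] in LHS]mpolyE evalp_sum.
  have E m' : evalp ('X_[m'] : poly) 0 = (m' == 0%MM)%:R.
    rewrite evalpX; have [->|/eqP mz] := eqVneq m' 0%MM.
      by rewrite big1 // => i _; rewrite mnm0E expr0.
    have [i mi] : exists i, m' i != 0%N.
      apply/existsP; apply: contra_notT mz => /existsPn mi.
      by apply/mnmP => i; rewrite mnm0E; apply/eqP/negPn/mi.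
    by rewrite (bigD1 i) //= mxE expr0n (negPf mi) mul0r.
  under eq_bigr => m' _ do rewrite evalpZ E.
  rewrite [in RHS](mpolyE p^`M[m]) raddf_sum /=.
  by apply: eq_bigr => m' _; rewrite mcoeffZ mcoeffX.
rewrite mcoeff_mderivm addm0 => /eqP; rewrite mulrn_eq0 => /orP[|/eqP //].
rewrite -leqn0 leqNgt prodn_gt0 // => i.
by rewrite ffactnn fact_gt0.
Qed.

Local Notation comp := (pihomog mdeg).

(** The restriction of p to the line through 0 and x, whose coefficients are
    the values of the homogeneous components of p. *)
Definition ray p x : {poly K} := \poly_(d < msize p) evalp (comp d p) x.

Lemma comp_scale p d l x : evalp (comp d p) (l *: x) = l ^+ d * evalp (comp d p) x.
Proof.
rewrite pihomogE !evalp_sum mulr_sumr; apply: eq_bigr => m /eqP md.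
rewrite !evalpZ mulrCA; congr (_ * _); rewrite !evalpX.
rewrite -(md : mdeg m = d) mdegE -prodrXr -big_split; apply: eq_bigr => i _.
by rewrite mxE exprMn.
Qed.

Lemma ray_horner p x l : (ray p x).[l] = evalp p (l *: x).
Proof.
rewrite /ray horner_poly [in RHS](pihomog_partitionE (leqnn (msize p))).
by rewrite evalp_sum; apply: eq_bigr => d _; rewrite comp_scale mulrC.
Qed.

Lemma rayE p x d : (ray p x)`_d = evalp (comp d p) x.
Proof.
rewrite coef_poly; case: ltnP => // dp.
rewrite pihomogE big_seq_cond big_pred0 ?evalp0 // => m.
apply/negP => /andP[/msize_mdeg_lt mp /eqP md].
by move: dp; rewrite -md leqNgt mp.
Qed.

Lemma ray_deriv p x : (ray p x)^`().[1] = \sum_i x 0 i * evalp p^`M(i) x.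
Proof.
have -> : ray p x = curve (fun i => x 0 i *: 'X) p.
  apply/subr0_eq/(@poly_cofinite_eq0 _ 1) => [|t _]; first exact: oner_neq0.
  rewrite hornerD hornerN ray_horner (@curve_horner _ _ _ (t *: x)) ?subrr //.
  by move=> i; rewrite !hornerE mxE mulrC.
rewrite curve_deriv horner_sum; apply: eq_bigr => i _.
rewrite hornerM derivZ derivX hornerZ hornerC mulr1 mulrC.
by rewrite (@curve_horner _ _ _ x) // => j; rewrite !hornerE.
Qed.

End PolynomialFunctions.

(** * The Nullstellensatz over the complex numbers *)

Section Uncountable.
Variable R : realType.

Lemma interval_avoiding (s : seq R) (a b : R) : a < b ->
  exists a' b', [/\ a <= a', a' < b', b' <= b &
    forall x, x \in s -> ~~ (a' <= x <= b')].
Proof.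
elim: s => [|x s IH] in a b *; first by move=> ab; exists a, b; split.
move=> ab; have [am mb] := midf_lt ab; set m := (a + b) / 2 in am mb.
have [xm|mx] := leP x m.
  have [mc cb] := midf_lt mb; set c := (m + b) / 2 in mc cb.
  have [a' [b' [ca' a'b' b'b av]]] := IH _ _ cb; exists a', b'; split => //.
    by rewrite (le_trans _ ca') // ltW // (lt_trans am).
  move=> y; rewrite inE => /orP[/eqP ->|/av //].
  by rewrite negb_and -ltNge (le_lt_trans xm) // (lt_le_trans mc).
have [a' [b' [aa' a'b' b'm av]]] := IH _ _ am; exists a', b'; split => //.
  by rewrite (le_trans b'm) // ltW.
move=> y; rewrite inE => /orP[/eqP ->|/av //].
by rewrite negb_and orbC -ltNge (le_lt_trans b'm).
Qed.

Lemma bounded_set_enum (T : eqType) (F : set T) (d : nat) :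
  (forall s : seq T, uniq s -> (forall x, x \in s -> F x) -> size s <> d) ->
  exists s : seq T, forall x, F x -> x \in s.
Proof.
elim: d => [/(_ [::] isT)|d IH H]; first by case.
have [|/existsNP[s]] := EM (forall s : seq T, uniq s ->
  (forall x, x \in s -> F x) -> size s <> d); first exact: IH.
move=> /not_implyP[us] /not_implyP[sF] /contrapT sd.
exists s => x Fx; apply: contrapT => /negP xs.
apply: (H (x :: s)) => /=; rewrite ?xs ?us ?sd // => y.
by rewrite inE => /orP[/eqP ->|/sF].
Qed.

(** Cantor: otherwise every fibre is finite, and a decreasing sequence of
    intervals that avoids one fibre after the other has a point in common. *)
Lemma uncountable_fiber (f : R -> nat) : exists k, forall d, exists s : seq R,
  [/\ uniq s, size s = d & forall x, x \in s -> f x = k].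
Proof.
apply: contrapT => H.
have {H} fin k : exists s : seq R, forall x, f x = k -> x \in s.
  have [d Hd] : exists d, forall s : seq R, uniq s ->
      (forall x, x \in s -> f x = k) -> size s <> d.
    apply: contrapT => Hk; apply: H; exists k => d; apply: contrapT => Hd.
    by apply: Hk; exists d => s us sk sd; apply: Hd; exists s.
  exact: (bounded_set_enum Hd).
pose ok (u v : nat * (R * R)) := v.1 = u.1.+1 /\
  (u.2.1 < u.2.2 -> [/\ u.2.1 <= v.2.1, v.2.1 < v.2.2, v.2.2 <= u.2.2 &
    forall x, f x = u.1 -> ~~ (v.2.1 <= x <= v.2.2)]).
have step u : {v | ok u v}.
  apply: cid; case: u => k [a b] /=; have [s sk] := fin k.
  have [ab|ab] := boolP (a < b); last by exists (k.+1, (a, b)); split => //= /(negP ab).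
  have [a' [b' [? ? ? av]]] := interval_avoiding s ab.
  by exists (k.+1, (a', b')); split => //= _; split => // x /sk /av.
have [g [g0 gok]] := dependent_choice step (0%N, (0, 1)).
have gk k : (g k).1 = k.
  by elim: k => [|k IH]; rewrite ?g0 // (gok k).1 IH.
have glt k : (g k).2.1 < (g k).2.2.
  by elim: k => [|k IH]; [rewrite g0 ltr01|have [] := (gok k).2 IH].
have mono k i : (g k).2.1 <= (g (k + i)%N).2.1 /\ (g (k + i)%N).2.2 <= (g k).2.2.
  elim: i => [|i [IH1 IH2]]; first by rewrite addn0.
  have [] := (gok (k + i)%N).2 (glt _); rewrite addnS => h1 _ h2 _.
  by rewrite (le_trans IH1 h1) (le_trans h2 IH2).
have cross k l : (g k).2.1 <= (g l).2.2.
  case/orP: (leq_total k l) => /subnKC <-.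
    by apply: (le_trans (mono k _).1); exact/ltW/glt.
  by apply: (le_trans _ (mono l _).2); exact/ltW/glt.
pose E : set R := range (fun k => (g k).2.1).
have ubE l : ubound E (g l).2.2 by move=> _ [k _ <-].
pose x := sup E.
have [_ _ _] := (gok (f x)).2 (glt _); rewrite gk => /(_ x erefl)/negP; apply.
apply/andP; split; last by apply: ge_sup; [exists (g 0%N).2.1, 0%N|exact: ubE].
apply: ub_le_sup; last by exists (f x).+1.
by exists (g 0%N).2.2; apply: ubE.
Qed.
End Uncountable.

Section Nullstellensatz.
Import mpoly.
Variables (R : realType) (n : nat).
Local Notation K := R[i].
Local Notation pt := 'rV[K]_n.+1.
Local Notation poly := {mpoly K[n.+1]}.

Definition mideal (I : set poly) := [/\ I 0,
  forall p q, I p -> I q -> I (p + q) & forall r p, I p -> I (r * p)].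

Lemma mideal_sum I (T : Type) (r : seq T) (F : T -> poly) : mideal I ->
  (forall i, I (F i)) -> I (\sum_(i <- r) F i).
Proof.
by case=> I0 ID _ IF; elim/big_ind: _ => // i _; exact: IF.
Qed.

Lemma midealN I p : mideal I -> I p -> I (- p).
Proof. by case=> _ _ IM Ip; rewrite -mulN1r; apply: IM. Qed.

Lemma midealB I p q : mideal I -> I p -> I q -> I (p - q).
Proof. by move=> II Ip Iq; case: (II) => _ ID _; exact: ID Ip (midealN II Iq). Qed.

(** By Zorn's lemma, J is maximal among the ideals without power of f; the ideal
    generated by J and an element outside of J contains such a power. *)
Lemma maximal_avoiding I f : mideal I -> (forall N, ~ I (f ^+ N)) ->
  exists J, [/\ mideal J, I `<=` J, forall N, ~ J (f ^+ N) &
    forall a, ~ J a -> exists g N, J (g * a - f ^+ N)].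
Proof.
move=> II If.
pose good (J : set poly) := [/\ mideal J, I `<=` J & forall N, ~ J (f ^+ N)].
have [] := @Zorn_bigcup _ [set J | J = set0 \/ good J].
  move=> F FP tot; have [[X FX gX]|nX] := EM (exists2 X, F X & good X); last first.
    left; apply/seteqP; split => // p [X FX Xp].
    case: (FP X FX) => [X0|gX]; first by rewrite X0 in Xp.
    by apply: nX; exists X.
  right; have Fg Y p : F Y -> Y p -> good Y.
    by move=> FY Yp; case: (FP Y FY) => // Y0; rewrite Y0 in Yp.
  case: (gX) => -[X0 _ _] IX _; split.
  - split; first by exists X.
    + move=> p q [Y FY Yp] [Z FZ Zq].
      case: (tot Y Z FY FZ) => [YZ|ZY].
        by exists Z => //; have [[_ ZD _] _ _] := Fg _ _ FZ Zq; apply/ZD/Zq/YZ.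
      by exists Y => //; have [[_ YD _] _ _] := Fg _ _ FY Yp; apply: YD => //; apply: ZY.
    + move=> r p [Y FY Yp]; exists Y => //.
      by have [[_ _ YM] _ _] := Fg _ _ FY Yp; apply: YM.
  - by move=> p Ip; exists X => //; apply: IX.
  - by move=> N [Y FY YN]; have [_ _ /(_ N)] := Fg _ _ FY YN.
move=> J [[J0|gJ] Jmax].
  exfalso; apply: (Jmax I); last by right; split.
  by rewrite J0; split => // /(_ 0); case: II => I0 _ _ /(_ I0).
exists J; case: (gJ) => JI IJ Jf; split => // a Ja.
case: (JI) => J0 JD JM.
pose J' := [set p | exists2 g, True & J (p - g * a)] : set poly.
have aJ' : J' a by exists 1; rewrite // mul1r subrr.
have JJ' : J `<=` J' by move=> p Jp; exists 0; rewrite // mul0r subr0.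
have J'I : mideal J'.
  split; first exact: JJ'.
  - move=> p q [g _ Jg] [h _ Jh]; exists (g + h) => //.
    by rewrite mulrDl opprD addrACA; apply: JD.
  - move=> r p [g _ Jg]; exists (r * g) => //.
    by rewrite -mulrA -mulrBr; apply: JM.
have [N [g _ Jg]] : exists N, J' (f ^+ N).
  apply: contrapT => J'f; apply: (Jmax J').
    by split => // /(_ a aJ').
  right; split => //; first exact: subset_trans JJ'.
  by move=> N J'N; apply: J'f; exists N.
by exists g, N; rewrite -opprB; apply: midealN.
Qed.

Lemma dependent_polys (D : nat) (g : 'I_D -> poly) (B : nat) :
  (forall i, msize (g i) <= B)%N -> (#|{: 'X_{1..n.+1 < B}}| < D)%N ->
  exists l : 'I_D -> K, (exists i, l i != 0) /\ \sum_i l i *: g i = 0.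
Proof.
move=> gB BD; pose M := \matrix_(i < D, j < #|{: 'X_{1..n.+1 < B}}|)
  (g i)@_(enum_val j : 'X_{1..n.+1 < B}).
have /rowV0Pn[v vM v0] : kermx M != 0.
  rewrite kermx_eq0 /row_free neq_ltn.
  by rewrite (leq_ltn_trans (rank_leq_col M) BD).
exists (fun i => v 0 i); split.
  by have [i [j]] := matrix0Pn _ v0; rewrite ord1; exists j.
apply/mpolyP => m; rewrite mcoeff0 raddf_sum /=.
have [mB|mB] := ltnP (mdeg m) B; last first.
  apply: big1 => i _; rewrite mcoeffZ memN_msupp_eq0 ?mulr0 //.
  by apply: msize_mdeg_ge; rewrite (leq_trans (gB i)).
move/sub_kermxP/matrixP: vM => /(_ 0 (enum_rank (BMultinom mB))).
rewrite !mxE => E; rewrite -[RHS]E; apply: eq_bigr => i _.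
by rewrite mcoeffZ mxE enum_rankK.
Qed.

(** A point of the locus is found coordinate by coordinate: if no X_l - c lay
    in the maximal ideal J, the elements X_l - c would be invertible modulo J
    up to a power of f; as C is uncountable while polynomials of bounded degree
    form a finite-dimensional space, their inverses would satisfy a linear
    relation, hence X_l a nonzero univariate equation modulo J. *)
Theorem nullstellensatz (I : set poly) (f : poly) : mideal I ->
  (forall x, evalp f x != 0 -> exists2 p, I p & evalp p x != 0) ->
  exists N, I (f ^+ N).
Proof.
move=> II If; apply: contrapT => nI.
have [|J [JI IJ Jf Jinv]] := @maximal_avoiding I f II.
  by move=> N IN; apply: nI; exists N.
case: (JI) => J0 JD JM.
have Jprime a b : J (a * b) -> J a \/ J b.
  move=> Jab; have [|nJa] := EM (J a); [by left|right; apply: contrapT => nJb].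
  have [g [N Jg]] := Jinv _ nJa; have [h [M Jh]] := Jinv _ nJb.
  apply: (Jf (M + N)%N); rewrite exprD.
  have -> : f ^+ M * f ^+ N = (g * h) * (a * b) -
     (g * a * (h * b - f ^+ M) + f ^+ M * (g * a - f ^+ N)) by ring.
  by apply: midealB (JM _ _ Jab) _ => //; apply: JD; apply: JM.
have J1 : ~ J 1 by have := Jf 0%N; rewrite expr0.
have coord l : exists c, J ('X_l - c%:MP).
  apply: contrapT => nJ.
  have /choice[u Ju] c : exists u : poly * nat,
      J (u.1 * ('X_l - c%:MP) - f ^+ u.2).
    have [|g [N Jg]] := Jinv ('X_l - c%:MP); last by exists (g, N).
    by move=> Jc; apply: nJ; exists c.
  pose code (r : R) := pickle (msize (u r%:C%C).1, (u r%:C%C).2).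
  have [k /(_ _) fib] := uncountable_fiber code.
  pose B := (odflt (0, 0)%N (unpickle k : option (nat * nat))).1.
  pose N := (odflt (0, 0)%N (unpickle k : option (nat * nat))).2.
  have [s [us ss sk]] := fib #|{: 'X_{1..n.+1 < B}}|.+1.
  set D := #|{: 'X_{1..n.+1 < B}}|.+1 in ss.
  pose c (i : 'I_D) : K := (s`_i)%:C%C.
  have cinj : injective c.
    move=> i j /(congr1 (@complex.Re _)) /= /eqP.
    by rewrite nth_uniq ?ss // => /eqP /val_inj.
  have cs i : msize (u (c i)).1 = B /\ (u (c i)).2 = N.
    have : s`_i \in s by rewrite mem_nth ?ss.
    by move=> /sk; rewrite /B /N => <-; rewrite /code pickleK.
  have [|//|lam [[i0 lam0] lamg]] := @dependent_polys D (fun i => (u (c i)).1) B.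
    by move=> i; rewrite (cs i).1.
  pose q : {poly K} := \sum_i lam i *: \prod_(j | j != i) ('X - (c j)%:P).
  have q0 : q != 0.
    apply/eqP => /(congr1 (horner^~ (c i0))) /eqP.
    rewrite horner0 horner_sum (bigD1 i0) //= [X in _ + X]big1 => [|i ii0]; last first.
      rewrite hornerZ horner_prod (bigD1 i0) 1?eq_sym //=.
      by rewrite hornerXsubC subrr mul0r mulr0.
    rewrite addr0 hornerZ mulf_eq0 (negPf lam0) horner_prod /=.
    rewrite prodf_seq_eq0 => /hasP[j _ /andP[ji0]].
    rewrite hornerXsubC subr_eq0 => /eqP /cinj ij.
    by rewrite ij eqxx in ji0.
  pose phi := horner_alg ('X_l : poly).
  have phiX b : phi ('X - b%:P) = 'X_l - b%:MP.
    by rewrite /phi rmorphB /= horner_algX horner_algC alg_mpolyC.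
  have Jfq : J (f ^+ N * phi q).
    have E : \sum_i (lam i *: \prod_(j | j != i) ('X_l - (c j)%:MP)) *
        ((u (c i)).1 * ('X_l - (c i)%:MP) - f ^+ N) = - (f ^+ N * phi q).
      have -> : phi q = \sum_i lam i *: \prod_(j | j != i) ('X_l - (c j)%:MP).
        rewrite /phi /q rmorph_sum; apply: eq_bigr => i _.
        rewrite -mul_polyC rmorphM /= horner_algC mulr_algl rmorph_prod; congr (_ *: _).
        by apply: eq_bigr => j _; rewrite -phiX.
      rewrite mulr_sumr -sumrN.
      transitivity (\sum_i ((lam i *: (u (c i)).1) * \prod_j ('X_l - (c j)%:MP) -
         f ^+ N * (lam i *: \prod_(j | j != i) ('X_l - (c j)%:MP)))).
        apply: eq_bigr => i _; rewrite [in RHS](bigD1 i) //=.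
        rewrite mulrBr [X in _ - X]mulrC; congr (_ - _).
        by rewrite -!scalerAl; congr (_ *: _); ring.
      by rewrite sumrB -mulr_suml lamg mul0r sub0r sumrN.
    rewrite -[_ * _]opprK -E; apply: midealN => //.
    apply: mideal_sum => // i; apply: JM.
    by have := Ju (c i); rewrite (cs i).2.
  have [|Jq] := Jprime _ _ Jfq; first exact: Jf.
  have [rs qE] := closed_field_poly_normal q.
  move: Jq; rewrite qE -mul_polyC /phi rmorphM /= horner_algC alg_mpolyC => /Jprime [Jl|].
    apply: J1; have := JM ((lead_coef q)^-1)%:MP _ Jl.
    by rewrite -mpolyCM mulVf ?lead_coef_eq0 // mpolyC1.
  elim: rs {qE} => [|z rs IH]; first by rewrite big_nil rmorph1.
  rewrite big_cons rmorphM /= => /Jprime[|//].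
  by rewrite -/phi phiX => Jz; apply: nJ; exists z.
have /choice[c Jc] := coord.
pose x : pt := \row_l c l.
have Jx p : J (p - (evalp p x)%:MP).
  elim/mpoly_alg_ind: p => [a|l|p q Jp Jq|p q Jp Jq].
  - by rewrite evalpC subrr.
  - by rewrite evalpXU mxE.
  - by rewrite evalpD mpolyCD opprD addrACA; apply: JD.
  - rewrite evalpM mpolyCM.
    have -> : p * q - (evalp p x)%:MP * (evalp q x)%:MP =
      p * (q - (evalp q x)%:MP) + (evalp q x)%:MP * (p - (evalp p x)%:MP) by ring.
    by apply: JD; apply: JM.
have JxE p : J p -> evalp p x = 0.
  move=> Jp; apply/eqP/negPn/negP => px; apply: J1.
  have := midealB JI Jp (Jx p); rewrite opprB addrC subrK => Jpx.
  have := JM ((evalp p x)^-1)%:MP _ Jpx.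
  by rewrite -mpolyCM mulVf // mpolyC1.
have fx : evalp f x != 0.
  by apply/eqP => fx; apply: (Jf 1%N); have := Jx f; rewrite fx mpolyC0 subr0 expr1.
have [p Ip /eqP] := If _ fx; apply; exact/JxE/IJ.
Qed.
End Nullstellensatz.

(** * Regular functions and their partial derivatives *)

Section RegularFunctions.
Import mpoly.
Variables (R : realType) (n : nat).
Local Notation K := R[i].
Local Notation pt := 'rV[K]_n.+1.
Local Notation poly := {mpoly K[n.+1]}.
Implicit Types (p q h : poly) (x y : pt) (U V W : set pt) (f g : pt -> K).

Definition basic p : set pt := [set x | evalp p x != 0].

Lemma zopen_basic p : zariski_open (basic p).
Proof.
exists [set p]; apply/seteqP; split => x /=; first by exists p.
by case=> _ ->.
Qed.

Lemma zopen_basis U x : zariski_open U -> U x -> exists h, basic h x /\ basic h `<=` U.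
Proof. by case=> S -> [h Sh hx]; exists h; split => // y hy; exists h. Qed.

Lemma zopenI U V : zariski_open U -> zariski_open V -> zariski_open (U `&` V).
Proof.
case=> S -> [T ->]; exists [set r | exists2 p, S p & exists2 q, T q & r = p * q].
apply/seteqP; split => x /=.
  move=> [[p Sp px] [q Tq qx]]; exists (p * q); first by exists p => //; exists q.
  by rewrite evalpM mulf_neq0.
case=> _ [p Sp [q Tq ->]]; rewrite evalpM mulf_eq0 negb_or => /andP[px qx].
by split; [exists p|exists q].
Qed.

Lemma basicM p q : basic (p * q) = basic p `&` basic q.
Proof.
apply/seteqP; split => x; rewrite /basic /= evalpM mulf_eq0 negb_or.
  by move/andP.
by case=> -> ->.
Qed.

Lemma mpoly_eq_on h p q : h != 0 -> (forall x, basic h x -> evalp p x = evalp q x) ->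
  p = q.
Proof.
move=> h0 pq; apply/eqP; rewrite -subr_eq0; apply/eqP.
have /eqP : h * (p - q) = 0.
  apply: mpoly_eq0 => x; rewrite evalpM evalpB.
  have [->|hx] := eqVneq (evalp h x) 0; first by rewrite mul0r.
  by rewrite pq // subrr mulr0.
by rewrite mulf_eq0 (negPf h0) => /eqP.
Qed.

Lemma basic_neq0 h x : basic h x -> h != 0.
Proof. by move=> hx; apply/eqP => h0; move: hx; rewrite /basic /= h0 evalp0 eqxx. Qed.

Definition frac_at f x V p q := [/\ zariski_open V, V x &
  forall y, V y -> evalp q y != 0 /\ f y = evalp p y / evalp q y].

Lemma reg_frac U f x : regular_on U f -> U x -> exists V p q, frac_at f x V p q /\ V `<=` U.
Proof. by move=> fU /fU[V [p [q [zV Vx VU H]]]]; exists V, p, q; split. Qed.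

Lemma reg_intro U f : (forall x, U x -> exists V p q, frac_at f x V p q /\ V `<=` U) ->
  regular_on U f.
Proof. by move=> H x /H[V [p [q [[zV Vx E] VU]]]]; exists V, p, q; split. Qed.

Lemma frac_sub f g x V W p q : zariski_open W -> W x -> (forall y, W y -> f y = g y) ->
  frac_at f x V p q -> frac_at g x (V `&` W) p q.
Proof.
move=> zW Wx fg [zV Vx H]; split => //; first exact: zopenI.
by move=> y [/H[q0 fy] Wy]; rewrite -fg.
Qed.

Lemma reg_local U f : (forall x, U x -> exists V g,
    [/\ zariski_open V, V x, V `<=` U, regular_on V g & forall y, V y -> f y = g y]) ->
  regular_on U f.
Proof.
move=> H; apply: reg_intro => x /H[V [g [zV Vx VU gV fg]]].
have [W [p [q [F WV]]]] := reg_frac gV Vx.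
exists (W `&` V), p, q; split; last by move=> y [_ /VU].
by apply: frac_sub F => // y Vy; rewrite fg.
Qed.

Lemma reg_sub U V f : zariski_open V -> V `<=` U -> regular_on U f -> regular_on V f.
Proof.
move=> zV VU fU; apply: reg_intro => x Vx; have [W [p [q [F WU]]]] := reg_frac fU (VU _ Vx).
exists (W `&` V), p, q; split; last by move=> y [].
exact: frac_sub F.
Qed.

Lemma reg_eq U f g : (forall x, U x -> f x = g x) -> regular_on U f -> regular_on U g.
Proof.
move=> fg fU; apply: reg_intro => x Ux; have [W [p [q [[zW Wx H] WU]]]] := reg_frac fU Ux.
by exists W, p, q; split => //; split => // y Wy; rewrite -fg; [exact: H|exact: WU].
Qed.

Section Ops.
Variables (U : set pt) (zU : zariski_open U).

Lemma reg_poly p : regular_on U (evalp p).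
Proof.
apply: reg_intro => x Ux; exists U, p, 1; split => //; split => // y _.
by rewrite evalp1 divr1; split => //; exact: oner_neq0.
Qed.

Lemma reg_cst c : regular_on U (fun=> c).
Proof. by apply: reg_eq (reg_poly c%:MP) => x _; rewrite evalpC. Qed.

Lemma reg_coord i : regular_on U (fun x => x 0 i).
Proof. by apply: reg_eq (reg_poly 'X_i) => x _; rewrite evalpXU. Qed.

Lemma reg_inv q : (forall x, U x -> evalp q x != 0) -> regular_on U (fun x => (evalp q x)^-1).
Proof.
move=> q0; apply: reg_intro => x Ux; exists U, 1, q; split => //; split => // y Uy.
by rewrite evalp1 div1r; split => //; exact: q0.
Qed.

Lemma frac_op f g x : regular_on U f -> regular_on U g -> U x ->
  exists V p q r, frac_at f x V p r /\ frac_at g x V q r /\ V `<=` U.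
Proof.
move=> fU gU Ux; have [V [p [q [[zV Vx E] VU]]]] := reg_frac fU Ux.
have [W [r [s [[zW Wx F] WU]]]] := reg_frac gU Ux.
have zVW := zopenI zV zW.
exists (V `&` W), (p * s), (r * q), (q * s); split; last split.
- split => // y [/E[q0 ->] /F[s0 _]]; rewrite !evalpM mulf_neq0 //; split => //.
  by field; rewrite q0 s0.
- split => // y [/E[q0 _] /F[s0 ->]]; rewrite !evalpM mulf_neq0 //; split => //.
  by field; rewrite q0 s0.
- by move=> y [/VU].
Qed.

Lemma regD f g : regular_on U f -> regular_on U g -> regular_on U (fun x => f x + g x).
Proof.
move=> fU gU; apply: reg_intro => x Ux.
have [V [p [q [r [[zV Vx E] [[_ _ F] VU]]]]]] := frac_op fU gU Ux.
exists V, (p + q), r; split => //; split => // y Vy.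
by have [r0 ->] := E y Vy; have [_ ->] := F y Vy; rewrite evalpD mulrDl.
Qed.

Lemma regM f g : regular_on U f -> regular_on U g -> regular_on U (fun x => f x * g x).
Proof.
move=> fU gU; apply: reg_intro => x Ux.
have [V [p [q [r [[zV Vx E] [[_ _ F] VU]]]]]] := frac_op fU gU Ux.
exists V, (p * q), (r * r); split => //; split => // y Vy.
have [r0 ->] := E y Vy; have [_ ->] := F y Vy; rewrite !evalpM mulf_neq0 //.
by split => //; field.
Qed.

Lemma regZ c f : regular_on U f -> regular_on U (fun x => c * f x).
Proof. by move=> fU; apply: regM => //; exact: reg_cst. Qed.

Lemma regN f : regular_on U f -> regular_on U (fun x => - f x).
Proof. by move=> fU; apply: reg_eq (regZ (-1) fU) => x _; rewrite mulN1r. Qed.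

Lemma regB f g : regular_on U f -> regular_on U g -> regular_on U (fun x => f x - g x).
Proof. by move=> fU gU; apply: regD => //; exact: regN. Qed.

Lemma reg_sum (I : Type) (r : seq I) (P : pred I) (F : I -> pt -> K) :
  (forall i, P i -> regular_on U (F i)) ->
  regular_on U (fun x => \sum_(i <- r | P i) F i x).
Proof.
move=> FU; elim: r => [|i r IH].
  by apply: reg_eq (reg_cst 0) => x _; rewrite big_nil.
have [Pi|Pi] := boolP (P i).
  by apply: reg_eq (regD (FU _ Pi) IH) => x _; rewrite big_cons Pi.
by apply: reg_eq IH => x _; rewrite big_cons (negPf Pi).
Qed.
End Ops.

(** The denominators of f form an ideal: from f = p / q on the basic open set
    of k one gets k q f = k p, which also holds where k vanishes. By the
    Nullstellensatz this ideal contains a power of h. *)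
Lemma regular_basic h f : regular_on (basic h) f ->
  exists N p, forall x, basic h x -> evalp h x ^+ N * f x = evalp p x.
Proof.
move=> fh.
pose I := [set q | exists p, forall x, basic h x -> evalp q x * f x = evalp p x] : set poly.
have II : mideal I.
  split.
  - by exists 0 => x _; rewrite !evalp0 mul0r.
  - move=> p q [r Hr] [s Hs]; exists (r + s) => x hx.
    by rewrite !evalpD mulrDl Hr // Hs.
  - by move=> r p [s Hs]; exists (r * s) => x hx; rewrite !evalpM -mulrA Hs.
have [|N [p Hp]] := @nullstellensatz _ _ I h II; last first.
  by exists N, p => x /Hp <-; rewrite evalpXn.
move=> x hx; have [V [p [q [[zV Vx E] VU]]]] := reg_frac fh hx.
have [k [kx kV]] := zopen_basis zV Vx.
exists (k * q); last by rewrite evalpM mulf_neq0 // (E x Vx).1.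
exists (k * p) => y hy; rewrite !evalpM.
have [->|ky] := eqVneq (evalp k y) 0; first by rewrite !mul0r.
have [q0 ->] := E y (kV _ ky); rewrite -mulrA; congr (_ * _).
by rewrite mulrC divfK.
Qed.

(** Where f = p / q and g = r / s, the polynomial identity p s = r q follows
    from its restriction to a nonempty basic open set. *)
Lemma regular_dense U h f g : h != 0 -> regular_on U f -> regular_on U g ->
  (forall x, U x -> basic h x -> f x = g x) -> forall x, U x -> f x = g x.
Proof.
move=> h0 fU gU fg x Ux.
have [V [p [q [[zV Vx E] VU]]]] := reg_frac fU Ux.
have [W [r [s [[zW Wx F] WU]]]] := reg_frac gU Ux.
have [k [kx kVW]] := zopen_basis (zopenI zV zW) (conj Vx Wx).
have pqrs : p * s = r * q.
  apply: (@mpoly_eq_on (h * k)); first by rewrite mulf_neq0 // (basic_neq0 kx).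
  move=> y; rewrite basicM => -[hy /kVW[Vy Wy]]; have := fg y (VU _ Vy) hy.
  have [q0 ->] := E y Vy; have [s0 ->] := F y Wy.
  by move/eqP; rewrite eqr_div // => /eqP; rewrite !evalpM.
have [q0 ->] := E x Vx; have [s0 ->] := F x Wx.
by apply/eqP; rewrite eqr_div // -!evalpM pqrs.
Qed.

(** Partial derivatives of a regular function, computed from a fraction that
    represents it near the point. *)
Definition pd_frac l p q x :=
  (evalp p^`M(l) x * evalp q x - evalp p x * evalp q^`M(l) x) / evalp q x ^+ 2.

Definition pd l f x : K :=
  let pq := xget (0, 1) [set pq : poly * poly | exists V, frac_at f x V pq.1 pq.2] in
  pd_frac l pq.1 pq.2 x.

(** The quotient rule gives the same value for equal fractions. *)
Lemma pdE l f x V p q : frac_at f x V p q -> pd l f x = pd_frac l p q x.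
Proof.
move=> fr; rewrite /pd; case: xgetP => [[r s] _ [W /= [zW Wx F]]|/(_ (p, q))[]]; last by exists V.
case: fr => zV Vx E /=.
have [k [kx kVW]] := zopen_basis (zopenI zV zW) (conj Vx Wx).
have pqrs : p * s = r * q.
  apply: (@mpoly_eq_on k); first by rewrite (basic_neq0 kx).
  move=> y /kVW[/E[q0 fy] /F[s0]]; rewrite fy !evalpM.
  by move/eqP; rewrite eqr_div // => /eqP.
have := congr1 (fun a => evalp a^`M(l) x) pqrs.
have := congr1 (fun a => evalp a x) pqrs.
rewrite /= !mderivM !evalpD !evalpM /pd_frac.
have [q0 _] := E x Vx; have [s0 _] := F x Wx.
move: (evalp p x) (evalp q x) (evalp r x) (evalp s x) q0 s0 => P Q A B Q0 B0.
move: (evalp p^`M(l) x) (evalp q^`M(l) x) (evalp r^`M(l) x) (evalp s^`M(l) x) => P' Q' A' B'.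
move=> H H'.
have -> : P = A * Q / B by rewrite -H mulfK.
have -> : P' = (A' * Q + A * Q' - (A * Q / B) * B') / B.
  apply: (mulIf B0); rewrite divfK // -H' -H mulfK //; ring.
by field; rewrite Q0 B0.
Qed.

Lemma pd_local l U V f g x : regular_on U f -> U x -> zariski_open V -> V x ->
  (forall y, V y -> f y = g y) -> pd l f x = pd l g x.
Proof.
move=> fU Ux zV Vx fg; have [W [p [q [F WU]]]] := reg_frac fU Ux.
by rewrite (pdE l F) (pdE l (frac_sub zV Vx fg F)).
Qed.

Lemma pd_regular l U f : regular_on U f -> regular_on U (pd l f).
Proof.
move=> fU; apply: reg_intro => x Ux; have [V [p [q [[zV Vx E] VU]]]] := reg_frac fU Ux.
exists V, (p^`M(l) * q - p * q^`M(l)), (q ^+ 2); split => //; split => // y Vy.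
rewrite evalpXn expf_neq0 ?(E y Vy).1 //; split => //.
have F : frac_at f y V p q by [].
by rewrite (pdE l F) evalpB !evalpM.
Qed.

Lemma pdD l U f g x : regular_on U f -> regular_on U g -> U x ->
  pd l (fun y => f y + g y) x = pd l f x + pd l g x.
Proof.
move=> fU gU Ux; have [V [p [q [r [F [G VU]]]]]] := frac_op fU gU Ux.
have FG : frac_at (fun y => f y + g y) x V (p + q) r.
  case: F G => zV Vx E [_ _ G]; split => // y Vy.
  by have [r0 ->] := E y Vy; have [_ ->] := G y Vy; rewrite evalpD mulrDl.
rewrite (pdE l F) (pdE l G) (pdE l FG) /pd_frac mderivD !evalpD.
case: F => _ Vx /(_ x Vx)[r0 _]; move: r0.
move: (evalp p^`M(l) x) (evalp q^`M(l) x) (evalp r^`M(l) x) => P' Q' C'.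
by move: (evalp p x) (evalp q x) (evalp r x) => P Q C r0; field.
Qed.

Lemma pdM l U f g x : regular_on U f -> regular_on U g -> U x ->
  pd l (fun y => f y * g y) x = pd l f x * g x + f x * pd l g x.
Proof.
move=> fU gU Ux; have [V [p [q [r [F [G VU]]]]]] := frac_op fU gU Ux.
have FG : frac_at (fun y => f y * g y) x V (p * q) (r * r).
  case: F G => zV Vx E [_ _ G]; split => // y Vy.
  have [r0 ->] := E y Vy; have [_ ->] := G y Vy; rewrite !evalpM mulf_neq0 //.
  by split => //; field.
rewrite (pdE l F) (pdE l G) (pdE l FG) /pd_frac !mderivM !evalpD !evalpM.
case: F G => _ Vx /(_ x Vx)[r0 ->] [_ _ /(_ x Vx)[_ ->]]; move: r0.
move: (evalp p^`M(l) x) (evalp q^`M(l) x) (evalp r^`M(l) x) => P' Q' C'.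
by move: (evalp p x) (evalp q x) (evalp r x) => P Q C r0; field.
Qed.

Lemma pd_cst l c x : pd l (fun=> c) x = 0.
Proof.
have F : frac_at (fun=> c) x setT c%:MP 1.
  split => //; last by move=> y _; rewrite evalp1 evalpC divr1 oner_neq0.
  exists [set 1]; apply/seteqP; split => // y _; exists 1 => //.
  by rewrite evalp1 oner_neq0.
by rewrite (pdE l F) /pd_frac mderivC -mpolyC1 mderivC evalp0 mulr0 mul0r subrr mul0r.
Qed.

Lemma pdZ l U c f x : zariski_open U -> regular_on U f -> U x ->
  pd l (fun y => c * f y) x = c * pd l f x.
Proof.
move=> zU fU Ux; rewrite (pdM l (reg_cst zU c) fU Ux).
by rewrite pd_cst mul0r add0r.
Qed.

Lemma pd_sum l U (I : Type) (r : seq I) (P : pred I) (F : I -> pt -> K) x :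
  zariski_open U -> (forall i, P i -> regular_on U (F i)) -> U x ->
  pd l (fun y => \sum_(i <- r | P i) F i y) x = \sum_(i <- r | P i) pd l (F i) x.
Proof.
move=> zU FU Ux; elim: r => [|i r IH].
  rewrite big_nil -[RHS](pd_cst l 0 x); congr (pd l _ x).
  by apply/funext => y; rewrite big_nil.
rewrite big_cons; have [Pi|Pi] := boolP (P i); last first.
  by rewrite -IH; congr (pd l _ x); apply/funext => y; rewrite big_cons (negPf Pi).
rewrite -IH -(pdD l (FU _ Pi) (reg_sum zU r FU) Ux).
by congr (pd l _ x); apply/funext => y; rewrite big_cons Pi.
Qed.

Lemma pd_coord l i x : pd l (fun y => y 0 i) x = (i == l)%:R.
Proof.
have F : frac_at (fun y => y 0 i) x setT 'X_i 1.
  split => //; last by move=> y _; rewrite evalpXU evalp1 divr1 oner_neq0.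
  exists [set 1]; apply/seteqP; split => // y _; exists 1 => //.
  by rewrite evalp1 oner_neq0.
rewrite (pdE l F) /pd_frac mderivXU -mpolyC1 mderivC evalp0 !evalpC.
by rewrite mulr0 subr0 mulr1 expr1n divr1.
Qed.

(** Substituting l X for X commutes with differentiation up to the factor l. *)
Lemma mpoly_scale (l : K) p : exists s : poly,
  (forall y, evalp s y = evalp p (l *: y)) /\
  forall k y, evalp s^`M(k) y = l * evalp p^`M(k) (l *: y).
Proof.
elim/mpoly_alg_ind: p => [c|i|p q [s [Es Ds]] [t [Et Dt]]|p q [s [Es Ds]] [t [Et Dt]]].
- exists c%:MP; split => [y|k y]; first by rewrite !evalpC.
  by rewrite mderivC !evalp0 mulr0.
- exists (l *: 'X_i); split => [y|k y]; first by rewrite evalpZ !evalpXU mxE.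
  by rewrite mderivZ !mderivXU evalpZ !evalpC.
- exists (s + t); split => [y|k y]; first by rewrite !evalpD Es Et.
  by rewrite !mderivD !evalpD Ds Dt mulrDr.
- exists (s * t); split => [y|k y]; first by rewrite !evalpM Es Et.
  rewrite !mderivM !evalpD !evalpM Ds Dt Es Et.
  move: (evalp p^`M(k) _) (evalp q^`M(k) _) => P' Q'.
  by move: (evalp p _) (evalp q _) => P Q; ring.
Qed.

Lemma zopen_scale (l : K) U : zariski_open U -> zariski_open [set x | U (l *: x)].
Proof.
case=> S ->; exists [set s | exists2 p, S p & forall y, evalp s y = evalp p (l *: y)].
apply/seteqP; split => x /=.
  move=> [p Sp px]; have [s [Es _]] := mpoly_scale l p.
  by exists s; [exists p|rewrite Es].
by case=> s [p Sp E] sx; exists p; rewrite // -E.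
Qed.

Definition invariant U := forall (l : K) x, l != 0 -> U x -> U (l *: x).

Lemma pd_homog i U f k (l : K) x : invariant U -> regular_on U f ->
  (forall y, U y -> l ^+ k * f (l *: y) = f y) -> l != 0 -> U x ->
  l ^+ k.+1 * pd i f (l *: x) = pd i f x.
Proof.
move=> inv fU fh l0 Ux; have [V [p [q [F VU]]]] := reg_frac fU (inv _ _ l0 Ux).
have [s [Es Ds]] := mpoly_scale l p; have [t [Et Dt]] := mpoly_scale l q.
have G : frac_at f x ([set y | V (l *: y)]) (l ^+ k *: s) t.
  case: F => zV Vx E; split => //; first exact: zopen_scale.
  move=> y Vy; have [q0 fE] := E _ Vy; rewrite Et q0; split => //.
  have Uy : U y by have := inv _ _ (invr_neq0 l0) (VU _ Vy); rewrite scalerK.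
  by rewrite -(fh y Uy) fE evalpZ Es mulrA.
rewrite (pdE i F) (pdE i G) /pd_frac mderivZ !evalpZ Ds Dt Es Et exprS.
case: F => _ Vx /(_ _ Vx)[q0 _]; move: q0.
move: (evalp p^`M(i) _) (evalp q^`M(i) _) => P' Q'.
by move: (evalp p _) (evalp q _) => P Q q0; field.
Qed.

(** Euler's identity for functions homogeneous of degree - k. *)
Lemma pd_euler U f k x : invariant U -> regular_on U f ->
  (forall (l : K) y, l != 0 -> U y -> l ^+ k * f (l *: y) = f y) -> U x ->
  \sum_i x 0 i * pd i f x = - (k%:R * f x).
Proof.
move=> inv fU fh Ux; have [V [p [q [F VU]]]] := reg_frac fU Ux.
case: (F) => zV Vx E; have [h [hx hV]] := zopen_basis zV Vx.
have [q0 fE] := E x Vx.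
have pq : 'X^k * ray p x = f x *: ray q x.
  apply/subr0_eq/(@poly_cofinite_eq0 _ _ ('X * ray h x)).
    apply/eqP => /(congr1 (horner^~ 1)); rewrite hornerM hornerX horner0 mul1r.
    by rewrite ray_horner scale1r; exact/eqP.
  move=> t; rewrite hornerM hornerX ray_horner mulf_eq0 negb_or => /andP[t0 htx].
  have [qt ft] := E _ (hV _ htx).
  rewrite hornerD hornerN hornerM hornerXn hornerZ !ray_horner.
  by rewrite -(fh t x t0 Ux) ft -mulrA divfK // subrr.
have := congr1 (fun a : {poly K} => a^`().[1]) pq.
rewrite /= derivM derivZ hornerD !hornerM hornerZ !ray_deriv derivXn hornerMn.
rewrite !hornerXn !expr1n !mul1r ray_horner scale1r => H.
under eq_bigr => i _ do rewrite (pdE i F) /pd_frac mulrA mulrBr mulrA (mulrCA (x 0 i)).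
rewrite -mulr_suml sumrB -mulr_suml -mulr_sumr.
have -> : \sum_i x 0 i * evalp p^`M(i) x =
  f x * (\sum_i x 0 i * evalp q^`M(i) x) - k%:R * evalp p x by rewrite -H addrC addKr.
have -> : evalp p x = f x * evalp q x by rewrite fE divfK.
by field.
Qed.

End RegularFunctions.

(** * Affine charts are acyclic *)

Section Charts.
Import mpoly.
Variables (R : realType) (n : nat).
Local Notation K := R[i].
Local Notation pt := 'rV[K]_n.+1.
Local Notation poly := {mpoly K[n.+1]}.
Implicit Types (p q h : poly) (x y : pt) (U V W : set pt) (f g : pt -> K).

Definition chart (i : 'I_n.+1) : set pt := [set x | x 0 i != 0].

Lemma chartE i : chart i = basic ('X_i : poly).
Proof. by apply/seteqP; split => x; rewrite /chart /basic /= evalpXU. Qed.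

Lemma zopen_chart i : zariski_open (chart i).
Proof. by rewrite chartE; exact: zopen_basic. Qed.

Lemma cone_chart x : cone x <-> exists i, chart i x.
Proof.
split=> [x0|[j]]; last by apply: contra_neq => ->; rewrite mxE.
have [i [j]] := matrix0Pn _ x0.
by rewrite ord1; exists j.
Qed.

Lemma proj_open_chart i : proj_open (chart i).
Proof.
split; first exact: zopen_chart.
  by move=> x ix; apply/cone_chart; exists i.
by move=> l x l0 ix; rewrite /chart /= mxE mulf_neq0.
Qed.

Lemma proj_openI U V : proj_open U -> proj_open V -> proj_open (U `&` V).
Proof.
case=> zU Uc Ui [zV Vc Vi]; split; first exact: zopenI.
  by move=> x [/Uc].
by move=> l x l0 [Ux Vx]; split; [apply: Ui|apply: Vi].
Qed.

Definition is_form (d : nat) p := forall (l : K) x, evalp p (l *: x) = l ^+ d * evalp p x.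

(** A homogeneous component of h that does not vanish at x will do: on the line
    through a point where it does not vanish, h is a nonzero polynomial, so this
    line meets U away from 0, and U is stable under scaling. *)
Lemma popen_basis U x : proj_open U -> U x ->
  exists d h, [/\ basic h x, basic h `<=` U & is_form d h].
Proof.
move=> [zU Uc Ui] Ux; have [h [hx hU]] := zopen_basis zU Ux.
have ray0 y d : evalp (pihomog mdeg d h) y != 0 -> ray h y != 0.
  by apply: contra_neq => r0; rewrite -rayE r0 coef0.
have [d dx] : exists d, evalp (pihomog mdeg d h) x != 0.
  apply: contrapT => nd; move/eqP: hx; apply.
  rewrite -[x]scale1r -ray_horner.
  have -> : ray h x = 0; last by rewrite horner0.
  apply/polyP => d; rewrite coef0 rayE; apply/eqP/negPn/negP => dx.
  by apply: nd; exists d.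
exists d, (pihomog mdeg d h); split => //; last by move=> l y; exact: comp_scale.
move=> y /ray0 ry.
have [l [l0 hl]] : exists l, l != 0 /\ evalp h (l *: y) != 0.
  apply: contrapT => nl; move/eqP: ry; apply.
  apply: (@poly_cofinite_eq0 _ _ 'X); first by rewrite polyX_eq0.
  move=> l; rewrite hornerX ray_horner => l0.
  by apply/eqP/negPn/negP => hl; apply: nl; exists l.
by rewrite -[y](scalerK l0); apply: Ui; [exact: invr_neq0|exact: hU].
Qed.

(** A power of x_i lies in the ideal generated by G, and only finitely many
    members of G are used to express it. *)
Lemma finite_subcover i (G : set poly) :
  (forall x, chart i x -> exists2 h, G h & basic h x) ->
  exists r (h : 'I_r -> poly), (forall k, G (h k)) /\
    forall x, chart i x -> exists k, basic (h k) x.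
Proof.
move=> GI.
pose I := [set p | exists s : seq (poly * poly),
  (forall k, (k < size s)%N -> G (nth (0, 0) s k).2) /\
  p = \sum_(u <- s) u.1 * u.2] : set poly.
have II : mideal I.
  split; first by exists [::]; rewrite big_nil.
    move=> p q [s [sG ->]] [t [tG ->]]; exists (s ++ t); rewrite big_cat; split => //.
    move=> k; rewrite size_cat nth_cat; case: (ltnP k (size s)) => [ks _|sk kst].
      exact: sG.
    by apply: tG; rewrite ltn_subLR.
  move=> r p [s [sG ->]]; exists [seq (r * u.1, u.2) | u <- s]; split.
    move=> k; rewrite size_map => ks.
    by rewrite (nth_map (0, 0)) //=; apply: sG.
  by rewrite big_map mulr_sumr; apply: eq_bigr => u _; rewrite mulrA.
have [x ix|N [s [sG sE]]] := @nullstellensatz _ _ I 'X_i II.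
  have [|h Gh hx] := GI x; first by rewrite chartE.
  exists h => //; exists [:: (1, h)]; rewrite big_seq1 mul1r; split => //.
  by case.
exists (size s), (fun k => (nth (0, 0) s k).2); split => [k|x]; first exact: sG.
rewrite chartE => ix; apply: contrapT => nk.
have : evalp ('X_i ^+ N) x != 0 by rewrite evalpXn expf_neq0.
rewrite sE evalp_sum (big_nth (0, 0)) big_mkord => /eqP; apply.
apply: big1 => k _; rewrite evalpM; have [->|hk] := eqVneq (evalp (nth (0, 0) s k).2 x) 0.
  by rewrite mulr0.
by case: nk; exists k.
Qed.

(** The Nullstellensatz writes a power of x_i as a combination of the h_k; the
    components of the right degree of its coefficients make it homogeneous. *)
Lemma homog_partition i r (h : 'I_r -> poly) (d : 'I_r -> nat) :
  (forall k, is_form (d k) (h k)) ->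
  (forall x, chart i x -> exists k, basic (h k) x) ->
  exists M (u : 'I_r -> poly), (forall k, is_form M (u k * h k)) /\
    forall x, \sum_k evalp (u k) x * evalp (h k) x = x 0 i ^+ M.
Proof.
move=> hd hI; pose I := [set p | exists g : 'I_r -> poly, p = \sum_k g k * h k] : set poly.
have II : mideal I.
  split.
  - by exists (fun=> 0); rewrite big1 // => k _; rewrite mul0r.
  - move=> p q [g ->] [g' ->]; exists (fun k => g k + g' k).
    by rewrite -big_split; apply: eq_bigr => k _; rewrite mulrDl.
  - move=> q p [g ->]; exists (fun k => q * g k).
    by rewrite mulr_sumr; apply: eq_bigr => k _; rewrite mulrA.
have [x ix|M [g gE]] := @nullstellensatz _ _ I 'X_i II.
  have [|k hk] := hI x; first by rewrite chartE.
  exists (h k) => //; exists (fun j => (j == k)%:R).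
  by rewrite (bigD1 k) //= eqxx mul1r big1 ?addr0 // => j /negPf ->; rewrite mul0r.
exists M, (fun k => if (M < d k)%N then 0 else pihomog mdeg (M - d k) (g k)).
split=> [k l x|x].
  rewrite !evalpM hd; case: ltnP => Md; first by rewrite !evalp0 !mul0r mulr0.
  have -> : l ^+ M = l ^+ (M - d k) * l ^+ d k by rewrite -exprD subnK.
  by rewrite comp_scale; ring.
have E : (x 0 i ^+ M) *: 'X^M = \sum_k (ray (g k) x * 'X^(d k)) * (evalp (h k) x)%:P.
  apply: subr0_eq; apply: (@poly_cofinite_eq0 _ _ 1) => [|t _]; first exact: oner_neq0.
  have := congr1 (fun p => evalp p (t *: x)) gE.
  rewrite /= evalpXn evalpXU mxE exprMn evalp_sum => gEt.
  rewrite hornerD hornerN hornerZ hornerXn horner_sum mulrC gEt.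
  apply/eqP; rewrite subr_eq0; apply/eqP/eq_bigr => k _.
  by rewrite !hornerM hornerXn hornerC ray_horner evalpM hd mulrA.
have := congr1 (fun a : {poly K} => a`_M) E.
rewrite /= coefZ coefXn eqxx mulr1 coef_sum => ->.
apply: eq_bigr => k _; rewrite coefMC coefMXn; congr (_ * _).
by case: ltnP => _; rewrite ?evalp0 // rayE.
Qed.

(** An affine chart is acyclic: with a partition of unity
    x_i^M = \sum_k u_k h_k^(N+1), where each D(h_k) lies in a member V_{a_k} of
    the cover, the functions \sum_k u_k h_k^(N+1) phi_{a_k a} / x_i^M trivialise
    phi; N is a common bound for the poles of phi along the h_k. *)
Lemma affine_acyclic i (A : Type) (V : A -> set pt) (e e' : nat)
    (phi : A -> A -> pt -> K) :
  (forall a, proj_open (V a)) -> (forall a, V a `<=` chart i) ->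
  (forall x, chart i x -> exists a, V a x) ->
  (forall a b, regular_on (V a `&` V b) (phi a b)) ->
  (forall a b (l : K) x, l != 0 -> V a x -> V b x ->
     l ^+ e * phi a b (l *: x) = l ^+ e' * phi a b x) ->
  (forall a b c x, V a x -> V b x -> V c x -> phi a b x + phi b c x = phi a c x) ->
  exists psi : A -> pt -> K, [/\ forall a, regular_on (V a) (psi a),
    forall a (l : K) x, l != 0 -> V a x ->
      l ^+ e * psi a (l *: x) = l ^+ e' * psi a x &
    forall a b x, V a x -> V b x -> phi a b x = psi b x - psi a x].
Proof.
move=> pV Vi iV phireg phihom phico.
have zV a : zariski_open (V a) by case: (pV a).
pose G := [set h | exists a d, basic h `<=` V a /\ is_form d h].
have [x ix|r [h [hG hcov]]] := @finite_subcover i G.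
  have [a Vx] := iV x ix; have [d [h [hx hV hd]]] := popen_basis (pV a) Vx.
  by exists h => //; exists a, d.
have /choice[a /choice[d had]] := hG.
have hV k : basic (h k) `<=` V (a k) by case: (had k).
have hd k : is_form (d k) (h k) by case: (had k).
have /choice[Nk Nkl] k : exists N, forall l, exists p, forall x,
    basic (h k) x -> basic (h l) x ->
    (evalp (h k * h l) x) ^+ N * phi (a k) (a l) x = evalp p x.
  have /choice[N HN] l : exists N, exists p, forall x,
      basic (h k) x -> basic (h l) x ->
      (evalp (h k * h l) x) ^+ N * phi (a k) (a l) x = evalp p x.
    have : regular_on (basic (h k * h l)) (phi (a k) (a l)).
      rewrite basicM; apply: reg_sub (phireg _ _).
        by apply: zopenI; apply: zopen_basic.
      by move=> x [/hV ? /hV ?].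
    move=> /regular_basic [N [p Hp]]; exists N, p => x hk hl.
    by apply: Hp; rewrite basicM.
  exists (\max_l N l)%N => l; have [p Hp] := HN l.
  exists ((h k * h l) ^+ (\max_l N l - N l) * p) => x hk hl.
  rewrite [RHS]evalpM -Hp // mulrA evalpXn -exprD subnK //.
  exact: (@leq_bigmax _ N).
pose N := (\max_k Nk k)%N.
have {Nkl} Nkl k l : exists p, forall x, basic (h k) x -> basic (h l) x ->
    (evalp (h k) x) ^+ N * phi (a k) (a l) x = evalp p x / evalp (h l) x ^+ N.
  have [p Hp] := Nkl k l.
  exists ((h k * h l) ^+ (N - Nk k) * p) => x hk hl.
  apply: (mulIf (expf_neq0 N hl)); rewrite divfK ?expf_neq0 // mulrAC -exprMn.
  rewrite -evalpM [RHS]evalpM -Hp // mulrA evalpXn -exprD subnK //.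
  exact: (@leq_bigmax _ Nk).
have hN k : is_form (d k * N.+1) (h k ^+ N.+1).
  by move=> l x; rewrite !evalpXn hd exprMn exprM.
have [|M [u [uhom usum]]] := homog_partition hN (i := i).
  move=> x /hcov[k hk]; exists k.
  by rewrite /basic /= evalpXn expf_neq0.
(* each summand vanishes where h_k does, whatever phi (a k) is there *)
pose psi b x := \sum_k (if evalp (h k) x != 0 then
    evalp (u k * h k ^+ N.+1) x * phi (a k) b x else 0) / (x 0 i ^+ M).
have chireg k l : regular_on (basic (h l)) (fun x => if evalp (h k) x != 0 then
    evalp (u k * h k ^+ N.+1) x * phi (a k) (a l) x else 0).
  have [p Hp] := Nkl k l; have zl := zopen_basic (h l).
  have hlN x : basic (h l) x -> evalp (h l ^+ N) x != 0.
    by move=> hl; rewrite evalpXn expf_neq0.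
  apply: reg_eq (regM (reg_poly zl (u k * h k * p)) (reg_inv zl hlN)) => x hl.
  have [hk0|hk] := eqVneq (evalp (h k) x) 0.
    by rewrite !evalpM hk0 mulr0 !mul0r.
  rewrite !evalpM !evalpXn exprS -!mulrA; congr (_ * (_ * _)).
  by rewrite -Hp.
have psireg l : regular_on (basic (h l) `&` chart i) (psi (a l)).
  have z : zariski_open (basic (h l) `&` chart i).
    by apply: zopenI (zopen_basic _) (zopen_chart _).
  have iM x : (basic (h l) `&` chart i) x -> evalp ('X_i ^+ M) x != 0.
    by case=> _ ix; rewrite evalpXn evalpXU expf_neq0.
  apply: reg_sum => // k _.
  have ck := reg_sub z (@subIsetl _ _ _) (chireg k l).
  apply: reg_eq (regM ck (reg_inv z iM)) => x _.
  by rewrite evalpXn evalpXU.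
have psiD l b x : basic (h l) x -> V b x -> chart i x ->
    psi (a l) x + phi (a l) b x = psi b x.
  move=> hl Vb ix; have iM : x 0 i ^+ M != 0 by rewrite expf_neq0.
  have -> : phi (a l) b x = \sum_k (evalp (u k * h k ^+ N.+1) x / x 0 i ^+ M) * phi (a l) b x.
    rewrite -mulr_suml -mulr_suml; under eq_bigr => k _ do rewrite evalpM.
    by rewrite usum divff // mul1r.
  rewrite -big_split; apply: eq_bigr => k _ /=.
  have [hk0|hk] := eqVneq (evalp (h k) x) 0.
    by rewrite !evalpM evalpXn hk0 expr0n /= mulr0 !mul0r addr0.
  rewrite -(phico (a k) (a l) b x) //; try exact: hV.
  by rewrite mulrDr mulrDl; congr (_ + _); rewrite mulrAC.
exists psi; split=> [b|b l x l0 Vb|b c x Vb Vc].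
- apply: reg_local => x Vx; have ix := Vi _ _ Vx; have [l hl] := hcov x ix.
  exists (V b `&` (basic (h l) `&` chart i)), (fun x => psi (a l) x + phi (a l) b x).
  have zl : zariski_open (basic (h l) `&` chart i).
    by apply: zopenI (zopen_basic _) (zopen_chart _).
  have z := zopenI (zV b) zl; have Wx : (V b `&` (basic (h l) `&` chart i)) x by [].
  split=> //.
    apply: regD; first exact: reg_sub (psireg l).
    by apply: reg_sub (phireg (a l) b) => // y [Vy [/hV]].
  by move=> y [Vy [hy iy]]; rewrite psiD.
- rewrite /psi !mulr_sumr; apply: eq_bigr => k _.
  rewrite hd mxE mulf_eq0 expf_eq0 (negPf l0) andbF /=.
  case: ifP => hk; last by rewrite !mul0r !mulr0.
  rewrite uhom exprMn.
  have := phihom (a k) b l x l0 (hV _ _ hk) Vb => E.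
  have iM : x 0 i ^+ M != 0 by rewrite expf_neq0 //; exact: (Vi _ _ Vb).
  have lM : l ^+ M != 0 by rewrite expf_neq0.
  transitivity (evalp (u k * h k ^+ N.+1) x * (l ^+ e * phi (a k) b (l *: x)) / x 0 i ^+ M).
    by field; rewrite iM lM.
  by rewrite E; field.
- have ix := Vi _ _ Vb; have [l hl] := hcov x ix.
  rewrite -(psiD l b x) // -(psiD l c x) // -(phico (a l) b c x) //; first by ring.
  exact: hV.
Qed.

End Charts.

(** * The exterior algebra *)

Section GrassmannAlgebra.
Variables (R : realType) (m : nat).
Local Notation C := R[i].
Local Notation Lam := (grassmann C m).
Local Notation sgn := (@wedge_sign C m).
Implicit Types (c : C) (J L M : {set 'I_m}) (f g h : Lam).
Import boot.finset.
Local Close Scope classical_set_scope.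
Local Open Scope set_scope.

Lemma lamZE c f J : (c *: f) J = c * f J.
Proof. by rewrite ffunE. Qed.
Lemma lamDE f g J : (f + g) J = f J + g J.
Proof. by rewrite ffunE. Qed.
Lemma lamZ0 c : c *: (0 : Lam) = (0 : Lam).
Proof. exact: scaler0. Qed.
Local Notation ffE := (lamZE, ffunE).

Lemma wedgeP c f f' g : wedge (c *: f + f') g = c *: wedge f g + wedge f' g.
Proof.
apply/ffunP => L; rewrite !ffE mulr_sumr -big_split /=; apply: eq_bigr => J _.
by rewrite !ffE; ring.
Qed.

Lemma wedgePr c f g g' : wedge f (c *: g + g') = c *: wedge f g + wedge f g'.
Proof.
apply/ffunP => L; rewrite !ffE mulr_sumr -big_split /=; apply: eq_bigr => J _.
by rewrite !ffE; ring.
Qed.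

Lemma wedgeDl f f' g : wedge (f + f') g = wedge f g + wedge f' g.
Proof. by have := wedgeP 1 f f' g; rewrite !scale1r. Qed.
Lemma wedgeDr f g g' : wedge f (g + g') = wedge f g + wedge f g'.
Proof. by have := wedgePr 1 f g g'; rewrite !scale1r. Qed.
Lemma wedge0l g : wedge 0 g = 0.
Proof. by apply/ffunP => L; rewrite !ffE big1 // => J _; rewrite ffunE mulr0 mul0r. Qed.
Lemma wedge0r f : wedge f 0 = 0.
Proof. by apply/ffunP => L; rewrite !ffE big1 // => J _; rewrite ffunE mulr0. Qed.
Lemma wedgeZl c f g : wedge (c *: f) g = c *: wedge f g.
Proof. by have := wedgeP c f 0 g; rewrite wedge0l !addr0. Qed.
Lemma wedgeZr c f g : wedge f (c *: g) = c *: wedge f g.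
Proof. by have := wedgePr c f g 0; rewrite wedge0r !addr0. Qed.
Lemma wedgeNl f g : wedge (- f) g = - wedge f g.
Proof. by rewrite -scaleN1r wedgeZl scaleN1r. Qed.
Lemma wedgeBl f f' g : wedge (f - f') g = wedge f g - wedge f' g.
Proof. by rewrite wedgeDl wedgeNl. Qed.
Lemma wedge_suml (I : Type) (r : seq I) (P : pred I) (F : I -> Lam) g :
  wedge (\sum_(i <- r | P i) F i) g = \sum_(i <- r | P i) wedge (F i) g.
Proof. exact: (big_morph (fun f => wedge f g) (fun a b => wedgeDl a b g) (wedge0l g)). Qed.
Lemma wedge_sumr (I : Type) (r : seq I) (P : pred I) (F : I -> Lam) g :
  wedge g (\sum_(i <- r | P i) F i) = \sum_(i <- r | P i) wedge g (F i).
Proof. exact: (big_morph (wedge g) (wedgeDr g) (wedge0r g)). Qed.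

(** The monomial theta_J. *)
Definition mono J : Lam := [ffun L => (L == J)%:R].

Lemma lam_sum f : f = \sum_J f J *: mono J.
Proof.
apply/ffunP => L; rewrite sum_ffunE (bigD1 L) //= big1 => [|J JL].
  by rewrite !ffE eqxx addr0 mulr1.
by rewrite !ffE eq_sym (negPf JL) mulr0.
Qed.

Definition par (b : bool) f := forall J, f J != 0 -> odd #|J| = b.

Lemma lam_ind_par (b : bool) (P : Lam -> Prop) : P 0 ->
  (forall c f g, P f -> P g -> P (c *: f + g)) ->
  (forall J, odd #|J| = b -> P (mono J)) -> forall f, par b f -> P f.
Proof.
move=> P0 PZ Pm f bf; rewrite (lam_sum f).
elim/big_rec: _ => // J g _ Pg.
have [->|fJ] := eqVneq (f J) 0; first by rewrite scale0r add0r.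
by apply: PZ => //; apply/Pm/bf.
Qed.

Lemma lam_ind (P : Lam -> Prop) : P 0 ->
  (forall c f g, P f -> P g -> P (c *: f + g)) ->
  (forall J, P (mono J)) -> forall f, P f.
Proof.
move=> P0 PZ Pm f; rewrite (lam_sum f).
by elim/big_rec: _ => // J g _ Pg; apply: PZ.
Qed.

Definition inversions J L : nat := \sum_(j in J) \sum_(l in L) (l < j)%N.

Lemma sgnE J L : sgn J L = (-1) ^+ inversions J L.
Proof.
rewrite /wedge_sign; congr (_ ^+ _).
rewrite /inversions pair_big_dep /= -sum1_card.
rewrite big_mkcond [RHS]big_mkcond; apply: eq_bigr => -[j l] _ /=.
by rewrite unfold_in /=; case: (j \in J); case: (l \in L) => //=; case: ltnP.
Qed.

Lemma sgnUl J L M : [disjoint J & L] -> sgn (J :|: L) M = sgn J M * sgn L M.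
Proof.
move=> dJL; rewrite !sgnE -exprD; congr (_ ^+ _).
rewrite /inversions -bigU //=; apply: eq_bigl => j.
by rewrite !inE.
Qed.

Lemma sgnUr J L M : [disjoint L & M] -> sgn J (L :|: M) = sgn J L * sgn J M.
Proof.
move=> dLM; rewrite !sgnE -exprD; congr (_ ^+ _).
rewrite /inversions -big_split /=; apply: eq_bigr => j _.
by rewrite -bigU //=; apply: eq_bigl => l; rewrite !inE.
Qed.

Lemma sgn0l L : sgn set0 L = 1.
Proof. by rewrite sgnE /inversions big_set0. Qed.
Lemma sgn0r L : sgn L set0 = 1.
Proof. by rewrite sgnE /inversions big1 // => j _; rewrite big_set0. Qed.

Lemma sgnC J L : [disjoint J & L] -> sgn J L * sgn L J = (-1) ^+ (odd #|J| && odd #|L|).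
Proof.
move=> dJL; rewrite -oddM signr_odd !sgnE -exprD; congr (_ ^+ _).
rewrite /inversions [X in (_ + X)%N]exchange_big /= -big_split /=.
rewrite -sum_nat_const; apply: eq_bigr => j jJ.
rewrite -big_split /= -sum1_card; apply: eq_bigr => l lL.
have: j != l by apply: contraTneq jJ => ->; rewrite (disjointFl dJL).
by rewrite -val_eqE /=; case: ltngtP.
Qed.

Lemma sgnK J L : sgn J L * sgn J L = 1.
Proof. by rewrite sgnE -exprD addnn -mul2n exprM sqrrN expr1n expr1n. Qed.

Lemma wedge_mono J L : wedge (mono J) (mono L) =
  if [disjoint J & L] then sgn J L *: mono (J :|: L) else 0.
Proof.
apply/ffunP => M; rewrite !ffE.
have E : (J \subset M) && (M :\: J == L) = [disjoint J & L] && (M == J :|: L).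
  apply/andP/andP => -[].
    move=> JM /eqP <-; rewrite setDE setUIr setUCr setIT.
    rewrite (setUidPr JM); split => //.
    by rewrite -setI_eq0 setICA setICr setI0.
  move=> dJL /eqP ->; rewrite subsetUl; split => //.
  rewrite setDUl setDv set0U; apply/eqP/setDidPl.
  by rewrite disjoint_sym.
rewrite (eq_bigr (fun J' => (J' == J)%:R * (sgn J' (M :\: J') * (M :\: J' == L)%:R))); last first.
  by move=> J' _; rewrite !ffE; ring.
rewrite big_mkcond (bigD1 J) //= eqxx big1 => [|J' /negPf ->]; last first.
  by rewrite mul0r if_same.
rewrite addr0 mul1r.
transitivity (if (J \subset M) && (M :\: J == L) then sgn J L else 0).
  case: (J \subset M) => //=; case: eqP => [->|_]; first by rewrite mulr1.
  by rewrite mulr0.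
rewrite E; case: [disjoint J & L] => /=; last by rewrite ffunE.
by rewrite !ffE; case: eqP => _; rewrite ?mulr1 ?mulr0.
Qed.

Lemma wedge1l f : wedge (mono set0) f = f.
Proof.
elim/lam_ind: f => [|c f g Hf Hg|J]; first by rewrite wedge0r.
  by rewrite wedgePr Hf Hg.
by rewrite wedge_mono -setI_eq0 set0I eqxx sgn0l scale1r set0U.
Qed.

Lemma wedge1r f : wedge f (mono set0) = f.
Proof.
elim/lam_ind: f => [|c f g Hf Hg|J]; first by rewrite wedge0l.
  by rewrite wedgeP Hf Hg.
by rewrite wedge_mono -setI_eq0 setI0 eqxx sgn0r scale1r setU0.
Qed.

Lemma wedgeA f g h : wedge f (wedge g h) = wedge (wedge f g) h.
Proof.
elim/lam_ind: f => [|c f f' Hf Hf'|J]; first by rewrite !wedge0l.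
  by rewrite !wedgeP Hf Hf'.
elim/lam_ind: g => [|c g g' Hg Hg'|L]; first by rewrite !(wedge0l, wedge0r).
  by rewrite !(wedgeP, wedgePr) Hg Hg'.
elim/lam_ind: h => [|c h h' Hh Hh'|M]; first by rewrite !wedge0r.
  by rewrite !wedgePr Hh Hh'.
rewrite !wedge_mono.
have D (A B : Lam) (b : bool) : wedge (if b then A else 0) B = if b then wedge A B else 0.
  by case: b; rewrite ?wedge0l.
have D' (A B : Lam) (b : bool) : wedge B (if b then A else 0) = if b then wedge B A else 0.
  by case: b; rewrite ?wedge0r.
rewrite D D' wedgeZl wedgeZr !wedge_mono -!setI_eq0 setIUr setIUl !setU_eq0.
case LM : (L :&: M == set0); case JL : (J :&: L == set0);
  case JM : (J :&: M == set0); cbn [andb]; rewrite ?lamZ0; [|reflexivity..].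
have dJL : [disjoint J & L] by rewrite -setI_eq0 JL.
have dLM : [disjoint L & M] by rewrite -setI_eq0 LM.
by rewrite !scalerA setUA (sgnUl _ dJL) (sgnUr _ dLM); congr (_ *: _); ring.
Qed.

(** Supercommutativity. *)
Lemma wedgeC a b f g : par a f -> par b g ->
  wedge f g = (-1) ^+ (a && b) *: wedge g f.
Proof.
move=> pf pg; move: f pf; apply: lam_ind_par => [|c f f' Hf Hf'|J Ja].
- by rewrite wedge0l wedge0r lamZ0.
- by rewrite wedgeP wedgePr Hf Hf' scalerDr !scalerA mulrC.
move: g pg; apply: lam_ind_par => [|c g g' Hg Hg'|L Lb].
- by rewrite wedge0l wedge0r lamZ0.
- by rewrite wedgeP wedgePr Hg Hg' scalerDr !scalerA mulrC.
rewrite !wedge_mono disjoint_sym; case d : [disjoint L & J]; last by rewrite lamZ0.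
by rewrite setUC scalerA -Ja -Lb andbC -sgnC // mulrAC sgnK mul1r.
Qed.

(** The left derivative with respect to theta_k. *)
Definition dth (k : 'I_m) f : Lam :=
  [ffun J : {set 'I_m} => if k \in J then 0 else sgn [set k] J * f (k |: J)].

Lemma dthP k c f g : dth k (c *: f + g) = c *: dth k f + dth k g.
Proof. by apply/ffunP => J; rewrite !ffE; case: ifP => _; ring. Qed.
Lemma dth0 k : dth k 0 = 0.
Proof. by apply/ffunP => J; rewrite !ffE mulr0 if_same. Qed.
Lemma dthZ k c f : dth k (c *: f) = c *: dth k f.
Proof. by have := dthP k c f 0; rewrite dth0 !addr0. Qed.

Lemma dth_mono k J : dth k (mono J) =
  if k \in J then sgn [set k] (J :\ k) *: mono (J :\ k) else 0.
Proof.
apply/ffunP => L; rewrite !ffE.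
case kJ : (k \in J); last first.
  rewrite !ffE; case: ifP => // kL; case: eqP => [E|_]; last by rewrite mulr0.
  by move: kJ; rewrite -E setU11.
rewrite !ffE; case kL : (k \in L).
  case: eqP => [E|_]; last by rewrite mulr0.
  by move: kL; rewrite E setD11.
have -> : (k |: L == J) = (L == J :\ k).
  apply/eqP/eqP => [<-|->]; last by rewrite setD1K.
  by rewrite setU1K // kL.
by case: eqP => [->|_] //; rewrite !mulr0.
Qed.

Lemma dth_mono1 k J : k \notin J -> dth k (mono (k |: J)) = sgn [set k] J *: mono J.
Proof. by move=> kJ; rewrite dth_mono setU11 setU1K. Qed.

Lemma dth_mono0 k J : k \notin J -> dth k (mono J) = 0.
Proof. by move=> kJ; rewrite dth_mono (negPf kJ). Qed.

Lemma disjointU1l k J L : [disjoint k |: J & L] = (k \notin L) && [disjoint J & L].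
Proof. by rewrite -!setI_eq0 setIUl setU_eq0 [X in X && _]setI_eq0 disjoints1. Qed.

Lemma disjointU1r k J L : [disjoint J & k |: L] = (k \notin J) && [disjoint J & L].
Proof. by rewrite disjoint_sym disjointU1l disjoint_sym. Qed.

Lemma dth_wedge_mono k J L : dth k (wedge (mono J) (mono L)) =
  wedge (dth k (mono J)) (mono L) +
  (-1) ^+ (odd #|J|) *: wedge (mono J) (dth k (mono L)).
Proof.
have eqm (c c' : C) (A : {set 'I_m}) : c = c' -> c *: mono A = c' *: mono A by move=> ->.
have s1 (A : {set 'I_m}) : k \notin A -> sgn [set k] A * sgn A [set k] = (-1) ^+ odd #|A|.
  by move=> kA; rewrite sgnC ?disjoints1 // cards1.
have d1 (A : {set 'I_m}) : k \notin A -> [disjoint [set k] & A] by move=> kA; rewrite disjoints1.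
have d1' (A : {set 'I_m}) : k \notin A -> [disjoint A & [set k]] by rewrite disjoint_sym; exact: d1.
have [kJ|kJ] := boolP (k \in J); have [kL|kL] := boolP (k \in L).
- (* the two terms on the right cancel *)
  rewrite -(setD1K kJ) -(setD1K kL).
  move: (J :\ k) (L :\ k) (setD11 k J) (setD11 k L) => A B /negbT kA /negbT kB.
  rewrite !dth_mono1 // wedgeZl wedgeZr !wedge_mono.
  rewrite !(disjointU1l, disjointU1r) setU11 kA kB; cbn [andb negb].
  rewrite dth0; case d : [disjoint A & B]; last by rewrite !lamZ0 addr0.
  rewrite !scalerA setUCA setUA -scalerDl -[LHS](scale0r (mono (k |: A :|: B))).
  apply: eqm; rewrite sgnUr ?d1 // sgnUl ?d1 // cardsU1 kA oddD /= signrN -s1 //.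
  have := sgnK [set k] A; have := sgnK [set k] B.
  move: (sgn _ B) (sgn _ A) => y x.
  by move: (sgn A _) (sgn A _) => u v yy xx; ring: xx yy.
- rewrite -(setD1K kJ); move: (J :\ k) (setD11 k J) => A /negbT kA.
  rewrite (dth_mono0 kL) wedge0r lamZ0 addr0 dth_mono1 // wedgeZl !wedge_mono.
  rewrite disjointU1l kL; cbn [andb]; case d : [disjoint A & L]; last by rewrite dth0 lamZ0.
  have kAL : k \notin A :|: L by rewrite in_setU negb_or kA.
  rewrite dthZ -setUA (dth_mono1 kAL) !scalerA; apply: eqm.
  rewrite sgnUl ?d1 // sgnUr //; have := sgnK [set k] L.
  move: (sgn _ L) (sgn _ A) (sgn A L) => x y z xx; rewrite [RHS]mulrC.
  by rewrite -[RHS]mulr1 -xx; ring.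
- rewrite -(setD1K kL); move: (L :\ k) (setD11 k L) => B /negbT kB.
  rewrite (dth_mono0 kJ) wedge0l add0r dth_mono1 // wedgeZr !wedge_mono.
  rewrite disjointU1r kJ; cbn [andb]; case d : [disjoint J & B]; last by rewrite dth0 !lamZ0.
  have kJB : k \notin J :|: B by rewrite in_setU negb_or kJ.
  rewrite dthZ setUCA (dth_mono1 kJB) !scalerA; apply: eqm.
  by rewrite sgnUr ?d1 // sgnUr ?d1 // -s1 //; ring.
- rewrite !dth_mono0 // wedge0l wedge0r lamZ0 addr0 wedge_mono (fun_if (dth k)) dth0 dthZ.
  by rewrite dth_mono0 ?lamZ0 ?if_same // in_setU negb_or kJ.
Qed.

(** The graded Leibniz rule. *)
Lemma dth_wedge k b f g : par b f ->
  dth k (wedge f g) = wedge (dth k f) g + (-1) ^+ b *: wedge f (dth k g).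
Proof.
move=> pf; move: f pf; apply: lam_ind_par => [|c f f' Hf Hf'|J <-].
- by rewrite !(wedge0l, dth0) lamZ0 addr0.
- rewrite !(wedgeP, dthP) Hf Hf' !scalerDr !scalerA addrACA.
  by rewrite [_ * c]mulrC.
elim/lam_ind: g => [|c g g' Hg Hg'|L]; last exact: dth_wedge_mono.
  by rewrite !(wedge0r, dth0) lamZ0 addr0.
rewrite !(wedgePr, dthP) Hg Hg' !(wedgePr, scalerDr) !scalerA addrACA.
by rewrite [_ * c]mulrC.
Qed.

Lemma wedge_theta_mono k J : k \notin J ->
  wedge (mono [set k]) (mono J) = sgn [set k] J *: mono (k |: J).
Proof. by move=> kJ; rewrite wedge_mono disjoints1 kJ. Qed.

Lemma theta_euler f : \sum_k wedge (mono [set k]) (dth k f) = [ffun J : {set 'I_m} => #|J|%:R * f J].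
Proof.
elim/lam_ind: f => [|c f g Hf Hg|J].
- rewrite big1 => [|k _]; last by rewrite dth0 wedge0r.
  by apply/ffunP => J; rewrite !ffE mulr0.
- under eq_bigr => k _ do rewrite dthP wedgePr.
  rewrite big_split -scaler_sumr Hf Hg.
  by apply/ffunP => J; rewrite !ffE; ring.
transitivity (\sum_(k in J) mono J).
  rewrite [RHS]big_mkcond; apply: eq_bigr => k _.
  rewrite dth_mono; case kJ : (k \in J); last by rewrite wedge0r.
  rewrite wedgeZr wedge_theta_mono ?setD11 // scalerA sgnK scale1r setD1K //.
rewrite sumr_const; apply/ffunP => L; rewrite ffunMnE !ffE.
by case: eqP => [->|_]; rewrite ?mulr1 // mulr0 mul0rn.
Qed.

Lemma wedge_thetaE f k J : wedge f (mono [set k]) J =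
  if k \in J then sgn (J :\ k) [set k] * f (J :\ k) else 0.
Proof.
elim/lam_ind: f => [|c f g Hf Hg|L].
- by rewrite wedge0l !ffunE mulr0 if_same.
- by rewrite wedgeP [LHS]ffunE lamZE Hf Hg !ffE; case: ifP => _; ring.
rewrite wedge_mono disjoint_sym disjoints1.
have [kJ|kJ] := boolP (k \in J); have [kL|kL] := boolP (k \in L); rewrite ?ffE //.
- case: eqP => [E|_]; last by rewrite mulr0.
  by move: kL; rewrite -E setD11.
- have -> : (J == L :|: [set k]) = (J :\ k == L).
    apply/eqP/eqP => [->|<-]; last by rewrite setUC setD1K.
    by rewrite setUC setU1K.
  by case: eqP => [->|_]; rewrite ?mulr0.
- case: eqP => [E|_]; last by rewrite mulr0.
  by move: kJ; rewrite E in_setU set11 orbT.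
Qed.

Lemma par0 b : par b 0.
Proof. by move=> J; rewrite ffunE eqxx. Qed.
Lemma parP b c f g : par b f -> par b g -> par b (c *: f + g).
Proof.
move=> bf bg J; rewrite !ffE; have [->|/bf //] := eqVneq (f J) 0.
by rewrite mulr0 add0r => /bg.
Qed.
Lemma parZ b c f : par b f -> par b (c *: f).
Proof. by move=> bf; rewrite -[_ *: _]addr0; apply: parP (par0 b). Qed.
Lemma parD b f g : par b f -> par b g -> par b (f + g).
Proof. by move=> bf bg; rewrite -[f]scale1r; apply: parP. Qed.
Lemma par_sum b (I : Type) (r : seq I) (P : pred I) (F : I -> Lam) :
  (forall i, P i -> par b (F i)) -> par b (\sum_(i <- r | P i) F i).
Proof. by move=> bF; elim/big_ind: _ => //; [exact: par0|exact: parD]. Qed.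
Lemma par_mono J : par (odd #|J|) (mono J).
Proof. by move=> L; rewrite ffunE; case: (L =P J) => [->//|_]; rewrite eqxx. Qed.

Lemma cardsU_disj J L : [disjoint J & L] -> #|J :|: L| = (#|J| + #|L|)%N.
Proof. by rewrite -setI_eq0 cardsU => /eqP ->; rewrite cards0 subn0. Qed.

Lemma par_wedge a b f g : par a f -> par b g -> par (a (+) b) (wedge f g).
Proof.
move=> pf pg; move: f pf; apply: lam_ind_par => [|c f f' Hf Hf'|J <-].
- by rewrite wedge0l; exact: par0.
- by rewrite wedgeP; exact: parP.
move: g pg; apply: lam_ind_par => [|c g g' Hg Hg'|L <-].
- by rewrite wedge0r; exact: par0.
- by rewrite wedgePr; exact: parP.
rewrite wedge_mono; case d : [disjoint J & L]; last exact: par0.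
rewrite -oddD -cardsU_disj //.
by apply: parZ; exact: par_mono.
Qed.

Lemma par_dth b k f : par b f -> par (~~ b) (dth k f).
Proof.
move=> bf J; rewrite ffunE; case: ifP => kJ; first by rewrite eqxx.
rewrite mulf_eq0 negb_or => /andP[_ /bf]; rewrite cardsU1 kJ /=.
by case: b bf; case: (odd _).
Qed.

(** The action of the scalar l on the exterior algebra. *)
Definition sc (l : C) f : Lam := [ffun J : {set 'I_m} => l ^+ #|J| * f J].

Lemma scP l c f g : sc l (c *: f + g) = c *: sc l f + sc l g.
Proof. by apply/ffunP => J; rewrite !ffE; ring. Qed.
Lemma sc0 l : sc l 0 = 0.
Proof. by apply/ffunP => J; rewrite !ffE mulr0. Qed.
Lemma scD l f g : sc l (f + g) = sc l f + sc l g.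
Proof. by apply/ffunP => J; rewrite !ffE; ring. Qed.
Lemma scZ l c f : sc l (c *: f) = c *: sc l f.
Proof. by apply/ffunP => J; rewrite !ffE; ring. Qed.
Lemma sc_sum l (I : Type) (r : seq I) (P : pred I) (F : I -> Lam) :
  sc l (\sum_(i <- r | P i) F i) = \sum_(i <- r | P i) sc l (F i).
Proof. exact: (big_morph (sc l) (scD l) (sc0 l)). Qed.
Lemma sc_mono l J : sc l (mono J) = l ^+ #|J| *: mono J.
Proof. by apply/ffunP => L; rewrite !ffE; case: eqP => [->|_]; rewrite ?mulr0. Qed.

Lemma sc_wedge l f g : sc l (wedge f g) = wedge (sc l f) (sc l g).
Proof.
elim/lam_ind: f => [|c f f' Hf Hf'|J]; first by rewrite !(wedge0l, sc0).
  by rewrite !(wedgeP, scP) Hf Hf'.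
elim/lam_ind: g => [|c g g' Hg Hg'|L]; first by rewrite !(wedge0r, sc0).
  by rewrite !(wedgePr, scP) Hg Hg'.
rewrite !sc_mono wedgeZl wedgeZr !wedge_mono (fun_if (sc l)) sc0 scZ sc_mono.
case d : [disjoint J & L]; last by rewrite !lamZ0.
by rewrite !scalerA cardsU_disj // exprD; congr (_ *: _); ring.
Qed.

Lemma sc_dth l k f : l *: sc l (dth k f) = dth k (sc l f).
Proof.
apply/ffunP => J; rewrite !ffE; case: ifP => kJ; first by rewrite !mulr0.
by rewrite cardsU1 kJ exprS; ring.
Qed.
End GrassmannAlgebra.

(** * Vector fields acting on functions with odd variables *)

Section VectorFields.
Variables (R : realType) (n m : nat).
Local Notation K := R[i].
Local Notation pt := 'rV[K]_n.+1.
Local Notation Lam := (grassmann K m).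
Local Notation var := ('I_n.+1 + 'I_m)%type.
Implicit Types (x y : pt) (U V W : set pt) (f g : pt -> Lam) (T : var -> Lam) (a b : bool).
Local Notation one := (mono R (@finset.set0 'I_m)).
Local Notation theta k := (mono R (@finset.set1 'I_m k)).

Local Notation ffE := (lamZE, ffunE).

Definition odd_var (v : var) : bool := if v is inr _ then true else false.

Definition regL U f := forall J, regular_on U (fun x => f x J).

Definition pdL l f x : Lam := [ffun J => pd l (fun y => f y J) x].

(** The value at x of \sum_v T_v d_v f, for a tangent vector T. *)
Definition app T f x : Lam :=
  \sum_l wedge (T (inl l)) (pdL l f x) + \sum_k wedge (T (inr k)) (dth k (f x)).

(** Euler's field \sum_l x_l d/dx_l + \sum_k theta_k d/dtheta_k. *)
Definition eul x : var -> Lam := fun v =>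
  match v with inl l => x 0 l *: one | inr k => theta k end.

Lemma zproj U : proj_open U -> zariski_open U. Proof. by case. Qed.
Lemma pinv U : proj_open U -> invariant U. Proof. by case. Qed.
Hint Resolve zproj pinv : core.

Lemma regL_sub U V f : zariski_open V -> V `<=` U -> regL U f -> regL V f.
Proof. by move=> zV VU fU J; apply: reg_sub (fU J). Qed.

Lemma regL_eq U f g : (forall x, U x -> f x = g x) -> regL U f -> regL U g.
Proof. by move=> fg fU J; apply: reg_eq (fU J) => x /fg ->. Qed.

Lemma regL_wedge U f g : zariski_open U -> regL U f -> regL U g ->
  regL U (fun x => wedge (f x) (g x)).
Proof.
move=> zU fU gU L; apply: (@reg_eq _ _ _ (fun x => \sum_(J : {set 'I_m} | J \subset L)
  (wedge_sign K J (L :\: J) * f x J) * g x (L :\: J)%SET)).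
  by move=> x _; rewrite ffunE.
by apply: reg_sum => // J _; apply: regM => //; apply: regZ.
Qed.

Lemma regL_P U c f g : zariski_open U -> regL U f -> regL U g ->
  regL U (fun x => c *: f x + g x).
Proof.
move=> zU fU gU J; apply: (@reg_eq _ _ _ (fun x => c * f x J + g x J)).
  by move=> x _; rewrite !ffE.
by apply: regD => //; apply: regZ.
Qed.

Lemma regL_sum U (I : finType) (F : I -> pt -> Lam) : zariski_open U ->
  (forall i, regL U (F i)) -> regL U (fun x => \sum_i F i x).
Proof.
move=> zU FU J; apply: (@reg_eq _ _ _ (fun x => \sum_i F i x J)).
  by move=> x _; rewrite sum_ffunE.
by apply: reg_sum => // i _; apply: FU.
Qed.

Lemma regL_dth U k f : zariski_open U -> regL U f -> regL U (fun x => dth k (f x)).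
Proof.
move=> zU fU J.
apply: (@reg_eq _ _ _ (fun x => (if k \in J then 0 else wedge_sign K [set k]%SET J) *
   f x (k |: J)%SET)); last exact: regZ.
by move=> x _; rewrite ffunE; case: ifP => // _; rewrite mul0r.
Qed.

Lemma regL_pdL U l f : regL U f -> regL U (pdL l f).
Proof.
move=> fU J; apply: reg_eq (pd_regular l (fU J)) => x _.
by rewrite ffunE.
Qed.

Lemma regL_D U f g : regL U f -> regL U g -> regL U (fun x => f x + g x).
Proof.
move=> fU gU J; apply: (@reg_eq _ _ _ (fun x => f x J + g x J)); last exact: regD.
by move=> x _; rewrite ffunE.
Qed.

Lemma regL_app U (Th : var -> pt -> Lam) f : zariski_open U ->
  (forall v, regL U (Th v)) -> regL U f -> regL U (fun x => app (Th^~ x) f x).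
Proof.
move=> zU TU fU; apply: regL_D; apply: regL_sum => // i; apply: regL_wedge => //.
  exact: regL_pdL.
exact: regL_dth.
Qed.

Lemma pdL_P U l c f g x : zariski_open U -> regL U f -> regL U g -> U x ->
  pdL l (fun y => c *: f y + g y) x = c *: pdL l f x + pdL l g x.
Proof.
move=> zU fU gU Ux; apply/ffunP => J; rewrite !ffE.
rewrite -(pdZ l c zU (fU J) Ux) -(pdD l _ (gU J) Ux); last exact: regZ.
by congr (pd l _ x); apply/funext => y; rewrite !ffE.
Qed.

Lemma pdL_wedge U l f g x : zariski_open U -> regL U f -> regL U g -> U x ->
  pdL l (fun y => wedge (f y) (g y)) x = wedge (pdL l f x) (g x) + wedge (f x) (pdL l g x).
Proof.
move=> zU fU gU Ux; apply/ffunP => L; rewrite !ffunE.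
have -> : (fun y => wedge (f y) (g y) L) = (fun y => \sum_(J : {set 'I_m} | J \subset L)
  (wedge_sign K J (L :\: J) * (f y J * g y (L :\: J)%SET))).
  by apply/funext => y; rewrite ffunE; apply: eq_bigr => J _; rewrite mulrA.
rewrite (pd_sum l _ zU) //; last by move=> J _; apply: regZ => //; apply: regM.
rewrite -big_split; apply: eq_bigr => J _ /=.
rewrite (pdZ l _ zU) //; last exact: regM.
by rewrite (pdM l (fU _) (gU _) Ux) !ffunE mulrDr !mulrA.
Qed.

Lemma pdL_local l U V f g x : regL U f -> U x -> zariski_open V -> V x ->
  (forall y, V y -> f y = g y) -> pdL l f x = pdL l g x.
Proof.
move=> fU Ux zV Vx fg; apply/ffunP => J; rewrite !ffunE.
by apply: (pd_local l (fU J) Ux zV Vx) => y /fg ->.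
Qed.

Lemma app_local U V T f g x : regL U f -> U x -> zariski_open V -> V x ->
  (forall y, V y -> f y = g y) -> app T f x = app T g x.
Proof.
move=> fU Ux zV Vx fg; rewrite /app (fg _ Vx).
by under eq_bigr => l _ do rewrite (pdL_local l fU Ux zV Vx fg).
Qed.

Lemma app_P U T c f g x : zariski_open U -> regL U f -> regL U g -> U x ->
  app T (fun y => c *: f y + g y) x = c *: app T f x + app T g x.
Proof.
move=> zU fU gU Ux; rewrite /app scalerDr addrACA !scaler_sumr -!big_split.
congr (_ + _); apply: eq_bigr => l _ /=.
  by rewrite (pdL_P l c zU fU gU Ux) wedgePr.
by rewrite dthP wedgePr.
Qed.

Lemma appP c T T' f x : app (fun v => c *: T v + T' v) f x = c *: app T f x + app T' f x.
Proof.
rewrite /app scalerDr addrACA !scaler_sumr -!big_split.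
by congr (_ + _); apply: eq_bigr => l _ /=; rewrite wedgeP.
Qed.

Lemma app_wedge h T f x : app (fun v => wedge h (T v)) f x = wedge h (app T f x).
Proof.
rewrite /app wedgeDr !wedge_sumr.
by congr (_ + _); apply: eq_bigr => l _ /=; rewrite wedgeA.
Qed.

Lemma app_leibniz a b U T f g x : zariski_open U -> regL U f -> regL U g -> U x ->
  (forall v, par (a (+) odd_var v) (T v)) -> par b (f x) ->
  app T (fun y => wedge (f y) (g y)) x =
    wedge (app T f x) (g x) + (-1) ^+ (a && b) *: wedge (f x) (app T g x).
Proof.
move=> zU fU gU Ux Tp fp.
rewrite /app wedgeDl !wedge_suml wedgeDr !wedge_sumr scalerDr addrACA !scaler_sumr.
rewrite -!big_split; congr (_ + _); apply: eq_bigr => l _ /=.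
  rewrite (pdL_wedge l zU fU gU Ux) wedgeDr !wedgeA; congr (_ + _).
  have := Tp (inl l); rewrite addbF => Tl.
  by rewrite -wedgeZl -(wedgeC Tl fp).
rewrite (dth_wedge _ _ fp) wedgeDr wedgeZr !wedgeA; congr (_ + _).
have := Tp (inr l); rewrite addbT => Tl.
have E : (-1) ^+ b * (-1) ^+ (~~ a && b) = (-1) ^+ (a && b) :> K.
  by case: a {Tp Tl}; case: b {fp}; rewrite ?mul1r ?mulr1 // mulrNN mulr1.
by rewrite -[in RHS]wedgeZl -[in LHS]wedgeZl (wedgeC Tl fp) scalerA E.
Qed.

(** Euler's field kills the homogeneous functions of degree 0. *)
Lemma app_eul U f x : invariant U -> regL U f ->
  (forall l y, l != 0 -> U y -> sc l (f (l *: y)) = f y) -> U x -> app (eul x) f x = 0.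
Proof.
move=> inv fU fh Ux; rewrite /app /eul theta_euler; apply/ffunP => J.
rewrite !ffunE sum_ffunE.
rewrite (eq_bigr (fun i => x 0 i * pd i (fun y => f y J) x)); last first.
  by move=> i _; rewrite wedgeZl wedge1l !ffE.
rewrite (pd_euler (k := #|J|) inv (fU J)) ?addNr // => l y l0 Uy.
by rewrite -[in RHS](fh l y l0 Uy) ffunE.
Qed.

Lemma sc_pdL U i f l x : invariant U -> regL U f ->
  (forall y, U y -> sc l (f (l *: y)) = f y) -> l != 0 -> U x ->
  l *: sc l (pdL i f (l *: x)) = pdL i f x.
Proof.
move=> inv fU fh l0 Ux; apply/ffunP => J; rewrite !ffE.
rewrite -[RHS](pd_homog i (k := #|J|) inv (fU J) _ l0 Ux) => [|y Uy].
  by rewrite exprS mulrA.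
by rewrite -[in RHS](fh y Uy) ffunE.
Qed.

Lemma sc_app U (Th : var -> pt -> Lam) f l x : invariant U -> regL U f ->
  (forall y, U y -> sc l (f (l *: y)) = f y) -> l != 0 -> U x ->
  (forall v, sc l (Th v (l *: x)) = l *: Th v x) ->
  sc l (app (Th^~ (l *: x)) f (l *: x)) = app (Th^~ x) f x.
Proof.
move=> inv fU fh l0 Ux Th_h; rewrite /app scD !sc_sum.
congr (_ + _); apply: eq_bigr => k _; rewrite sc_wedge Th_h wedgeZl -wedgeZr.
  by rewrite (sc_pdL k inv fU fh l0 Ux).
by rewrite sc_dth fh.
Qed.

Lemma par_pdL b l f x : has_parity b f -> par b (pdL l f x).
Proof.
move=> bf J; rewrite ffunE; apply: contra_neq_eq => Jb.
rewrite -[RHS](pd_cst l 0 x); congr (pd l _ x); apply/funext => y.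
by apply/eqP/negPn/negP => /bf /eqP; rewrite (negPf Jb).
Qed.

Lemma par_app a b T f x : (forall v, par (a (+) odd_var v) (T v)) ->
  has_parity b f -> par (a (+) b) (app T f x).
Proof.
move=> Tp bf; apply: parD; apply: par_sum => k _.
  by have := Tp (inl k); rewrite addbF => Tk; apply: par_wedge => //; apply: par_pdL.
have := Tp (inr k) => /= Tk.
have : par (~~ b) (dth k (f x)) by apply: par_dth; apply: bf.
by move/(par_wedge Tk); case: (a) {Tk Tp}; case: (b).
Qed.

End VectorFields.

(** * Derivations given by vector fields *)

Section Derivations.
Variables (R : realType) (n m : nat).
Local Notation K := R[i].
Local Notation pt := 'rV[K]_n.+1.
Local Notation Lam := (grassmann K m).
Local Notation var := ('I_n.+1 + 'I_m)%type.
Local Notation vf := (var -> pt -> Lam).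
Implicit Types (x y : pt) (U V W : set pt) (f g : pt -> Lam) (T : var -> Lam) (a b : bool).
Implicit Types (Th : vf) (D : sheaf_op R n m).
Local Notation one := (mono R (@finset.set0 'I_m)).
Local Notation theta k := (mono R (@finset.set1 'I_m k)).
Local Notation ffE := (lamZE, ffunE).
Hint Resolve zproj pinv : core.

(** Vector fields of parity a over U: their coefficients are homogeneous of
    degree 1, where theta_k counts as a coordinate. *)
Definition vf_on a U Th := forall v, [/\ regL U (Th v),
  forall (l : K) x, l != 0 -> U x -> sc l (Th v (l *: x)) = l *: Th v x &
  forall x, U x -> par (a (+) odd_var v) (Th v x)].

Lemma struct_reg U f : struct_sheaf U f -> regL U f. Proof. by case. Qed.
Lemma struct_out U f x : struct_sheaf U f -> ~ U x -> f x = 0. Proof. by case=> _ _; apply. Qed.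
Lemma struct_sc U f l x : struct_sheaf U f -> l != 0 -> sc l (f (l *: x)) = f x.
Proof. by case=> _ H _ l0; rewrite -[in RHS](H l l0). Qed.

Lemma structI U f : invariant U -> regL U f ->
  (forall (l : K) x, l != 0 -> U x -> sc l (f (l *: x)) = f x) ->
  (forall x, ~ U x -> f x = 0) -> struct_sheaf U f.
Proof.
move=> inv fU fh f0; split => // l l0; apply/funext => x.
have [Ux|nUx] := EM (U x); first exact: fh.
rewrite /scale_pull !f0 //; first by apply/ffunP => J; rewrite !ffunE mulr0.
by move=> /(inv _ _ (invr_neq0 l0)); rewrite scalerK.
Qed.

Lemma struct_P U c f g : proj_open U -> struct_sheaf U f -> struct_sheaf U g ->
  struct_sheaf U (c *: f + g).
Proof.
move=> pU fU gU; apply: structI; first exact: pinv.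
- apply: (regL_eq (f := fun x => c *: f x + g x)) => //.
  by apply: regL_P; [exact: zproj|exact: struct_reg|exact: struct_reg].
- by move=> l x l0 Ux; rewrite [LHS]scP !(struct_sc _ fU, struct_sc _ gU).
- by move=> x nU; rewrite [LHS]/= /GRing.add /= /GRing.scale /= (struct_out fU) // (struct_out gU) //= lamZ0 addr0.
Qed.

Lemma struct_mul U f g : proj_open U -> struct_sheaf U f -> struct_sheaf U g ->
  struct_sheaf U (mul_section f g).
Proof.
move=> pU fU gU; apply: structI; first exact: pinv.
- by apply: regL_wedge; [exact: zproj|exact: struct_reg|exact: struct_reg].
- by move=> l x l0 Ux; rewrite sc_wedge !(struct_sc _ fU, struct_sc _ gU).
- by move=> x nU; rewrite /mul_section (struct_out fU) // wedge0l.
Qed.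

Lemma struct_res U W f : proj_open W -> W `<=` U -> struct_sheaf U f ->
  struct_sheaf W (res_struct W f).
Proof.
move=> pW WU fU.
have E x : W x -> res_struct W f x = f x by move=> Wx; rewrite /res_struct patchT // inE.
apply: structI; first exact: pinv.
- apply: (regL_eq (f := f)) => [x /E -> //|].
  by apply: regL_sub (struct_reg fU) => //; exact: zproj.
- by move=> l x l0 Wx; rewrite !E ?(struct_sc _ fU) //; exact: (pinv pW).
- by move=> x nW; rewrite /res_struct patchC // inE.
Qed.

(** The derivation of functions of degree 0 given by a vector field; the test
    makes it vanish wherever a derivation over U is not meaningful. *)
Definition Dop U Th : sheaf_op R n m := fun V f x =>
  if `[< [/\ proj_open V, V `<=` U, struct_sheaf V f & V x] >] then app (Th^~ x) f x else 0.

Lemma DopE U Th V f x : proj_open V -> V `<=` U -> struct_sheaf V f -> V x ->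
  Dop U Th V f x = app (Th^~ x) f x.
Proof. by move=> pV VU fV Vx; rewrite /Dop asboolT. Qed.

Lemma Dop0 U Th V f x : ~ [/\ proj_open V, V `<=` U, struct_sheaf V f & V x] ->
  Dop U Th V f x = 0.
Proof. by move=> H; rewrite /Dop asboolF. Qed.

Lemma Dop_out U Th V f x : ~ V x -> Dop U Th V f x = 0.
Proof. by move=> H; apply: Dop0; case. Qed.

Lemma Dop_tangent a U Th : vf_on a U Th -> tangent_sheaf a U (Dop U Th).
Proof.
move=> TU; split; last first.
  move=> V f H; apply/funext => x; apply: Dop0 => -[pV VU fV _]; exact: H.
move=> V pV VU; have zV := zproj pV.
have TV v : regL V (Th v) by case: (TU v) => TUv _ _; apply: regL_sub TUv.
have Tp x v : V x -> par (a (+) odd_var v) (Th v x).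
  by move=> /VU; case: (TU v) => _ _; apply.
split.
- move=> f fV; apply: structI; first exact: pinv.
  + apply: (regL_eq (f := fun x => app (Th^~ x) f x)) => [x Vx|].
      by rewrite DopE.
    by apply: regL_app => //; apply: struct_reg.
  + move=> l x l0 Vx; rewrite !DopE //; last exact: (pinv pV).
    apply: (sc_app (pinv pV) (struct_reg fV)) => // [y Vy|v].
      exact: (struct_sc _ fV l0).
    by case: (TU v) => _ H _; apply: H => //; apply: VU.
  + by move=> x; apply: Dop_out.
- move=> c f g fV gV; apply/funext => x.
  have E : (c *: Dop U Th V f + Dop U Th V g) x = c *: Dop U Th V f x + Dop U Th V g x by [].
  rewrite E; have [Vx|nVx] := EM (V x); last by rewrite !(Dop_out _ _ _ nVx) lamZ0 addr0.
  rewrite (DopE _ pV VU (struct_P c pV fV gV) Vx) (DopE _ pV VU fV Vx) (DopE _ pV VU gV Vx).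
  exact: (app_P _ _ zV (struct_reg fV) (struct_reg gV) Vx).
- move=> b f fV bf x; have [Vx|nVx] := EM (V x); last by rewrite Dop_out //; exact: par0.
  by rewrite DopE //; apply: par_app => // v; apply: Tp.
- move=> b f g fV gV bf; apply/funext => x.
  have E : (mul_section (Dop U Th V f) g + (-1) ^+ (a && b) *: mul_section f (Dop U Th V g)) x =
    wedge (Dop U Th V f x) (g x) + (-1) ^+ (a && b) *: wedge (f x) (Dop U Th V g x) by [].
  rewrite E; have [Vx|nVx] := EM (V x); last first.
    by rewrite !(Dop_out _ _ _ nVx) wedge0l wedge0r lamZ0 addr0.
  rewrite (DopE _ pV VU (struct_mul pV fV gV) Vx) (DopE _ pV VU fV Vx) (DopE _ pV VU gV Vx).
  by apply: (app_leibniz zV (struct_reg fV) (struct_reg gV) Vx) (bf x) => v; exact: Tp.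
- move=> W f pW WV fV; apply/funext => x.
  have [Wx|nWx] := EM (W x); last by rewrite Dop_out // /res_struct patchC // inE.
  have -> : res_struct W (Dop U Th V f) x = Dop U Th V f x.
    by rewrite /res_struct patchT ?inE.
  rewrite (DopE _ pW (subset_trans WV VU) (struct_res pW WV fV) Wx).
  rewrite (DopE _ pV VU fV (WV _ Wx)).
  apply: (app_local _ (struct_reg (struct_res pW WV fV)) Wx (zproj pW) Wx) => y Wy.
  by rewrite /res_struct patchT // inE.
Qed.

End Derivations.

(** * The coefficients of a derivation over a chart *)

Section Coordinates.
Import mpoly.
Variables (R : realType) (n m : nat).
Local Notation K := R[i].
Local Notation pt := 'rV[K]_n.+1.
Local Notation poly := {mpoly K[n.+1]}.
Local Notation Lam := (grassmann K m).
Local Notation var := ('I_n.+1 + 'I_m)%type.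
Local Notation vf := (var -> pt -> Lam).
Implicit Types (x y : pt) (U V W : set pt) (f g : pt -> Lam) (T : var -> Lam) (a b : bool).
Implicit Types (Th : vf) (D : sheaf_op R n m).
Local Notation one := (mono R (@finset.set0 'I_m)).
Local Notation theta k := (mono R (@finset.set1 'I_m k)).
Local Notation ffE := (lamZE, ffunE).
Hint Resolve zproj pinv : core.

Lemma res_structT U f x : U x -> res_struct U f x = f x.
Proof. by move=> Ux; rewrite /res_struct patchT // inE. Qed.
Lemma res_structN U f x : ~ U x -> res_struct U f x = 0.
Proof. by move=> Ux; rewrite /res_struct patchC // inE. Qed.

Lemma res_structI U f : proj_open U -> regL U f ->
  (forall (l : K) x, l != 0 -> U x -> sc l (f (l *: x)) = f x) ->
  struct_sheaf U (res_struct U f).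
Proof.
move=> pU fU fh; apply: structI; first exact: pinv.
- by apply: (regL_eq (f := f)) => // x Ux; rewrite res_structT.
- by move=> l x l0 Ux; rewrite !res_structT //; [exact: fh|exact: (pinv pU)].
- by move=> x; exact: res_structN.
Qed.

Lemma sc_eul (l : K) x (v : var) : sc l (eul (l *: x) v) = l *: eul x v.
Proof.
case: v => [j|k] /=; last by rewrite sc_mono cards1 expr1.
by rewrite scZ sc_mono cards0 scale1r mxE scalerA.
Qed.

Lemma par_eul x (v : var) : par (odd_var v) (eul x v : Lam).
Proof.
case: v => [j|k] /=; first by apply: parZ; have := @par_mono R m finset.set0; rewrite cards0.
by have := @par_mono R m (finset.set1 k); rewrite cards1.
Qed.

Lemma regL_eul U (v : var) : zariski_open U -> regL U (fun x => eul x v : Lam).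
Proof.
move=> zU J; case: v => [j|k] /=; last exact: reg_cst.
apply: (@reg_eq _ _ _ (fun x => one J * x 0 j)).
  by move=> x _; rewrite !ffE mulrC.
by apply: regZ => //; apply: reg_coord.
Qed.

Lemma reg_coordV U i : zariski_open U -> U `<=` chart i ->
  regular_on U (fun x => (x 0 i)^-1).
Proof.
move=> zU Ui; apply: (@reg_eq _ _ _ (fun x => (evalp 'X_i x)^-1)).
  by move=> x _; rewrite evalpXU.
by apply: reg_inv => // x /Ui; rewrite evalpXU.
Qed.

Lemma regL_scale U (c : pt -> K) f : regular_on U c -> regL U f ->
  regL U (fun x => c x *: f x).
Proof.
move=> cU fU J; apply: (@reg_eq _ _ _ (fun x => c x * f x J)).
  by move=> x _; rewrite lamZE.
exact: regM.
Qed.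

(** The sections x_l / x_i and theta_k / x_i. *)
Definition coord i U (v : var) := res_struct U (fun x => (x 0 i)^-1 *: (eul x v : Lam)).

Lemma struct_coord i U v : proj_open U -> U `<=` chart i -> struct_sheaf U (coord i U v).
Proof.
move=> pU Ui; apply: res_structI => //.
  by apply: regL_scale; [apply: reg_coordV => //; exact: zproj|apply: regL_eul; exact: zproj].
move=> l x l0 Ux; rewrite scZ sc_eul scalerA mxE; congr (_ *: _).
by have := Ui _ Ux; rewrite /chart /= => xi; field; rewrite xi l0.
Qed.

Lemma par_coord i U v : has_parity (odd_var v) (coord i U v).
Proof.
move=> x; have [Ux|nUx] := EM (U x); last by rewrite /coord res_structN //; exact: par0.
by rewrite /coord res_structT //; apply: parZ; exact: par_eul.
Qed.

Lemma coord_res i U W v : W `<=` U -> coord i W v = res_struct W (coord i U v).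
Proof.
move=> WU; apply/funext => x; have [Wx|nWx] := EM (W x); last by rewrite /coord !res_structN.
by rewrite /coord !res_structT //; exact: WU.
Qed.

Lemma pd_coordV i l x : chart i x -> pd l (fun y => (y 0 i)^-1) x = - (i == l)%:R / x 0 i ^+ 2.
Proof.
move=> ix; have F : frac_at (fun y => (y 0 i)^-1) x (chart i) 1 'X_i.
  split => //; first exact: zopen_chart.
  by move=> y iy; rewrite evalpXU evalp1 div1r.
rewrite (pdE l F) /pd_frac mderivXU -mpolyC1 mderivC evalp0 !evalpC evalpXU.
by rewrite mul0r sub0r mul1r.
Qed.

Definition deul l (v : var) : Lam := if v is inl j then (j == l)%:R *: one else 0.

Lemma pdL_coord i l v x : chart i x ->
  pdL l (fun y => (y 0 i)^-1 *: (eul y v : Lam)) x =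
  (- (i == l)%:R / x 0 i ^+ 2) *: eul x v + (x 0 i)^-1 *: deul l v.
Proof.
move=> ix; have zi := zopen_chart R i; apply/ffunP => J; rewrite !ffE.
have -> : (fun y => ((y 0 i)^-1 *: (eul y v : Lam)) J) =
    (fun y => (y 0 i)^-1 * (eul y v : Lam) J).
  by apply/funext => y; rewrite lamZE.
rewrite (pdM l (reg_coordV zi (fun _ h => h)) (regL_eul v zi J) ix) pd_coordV //.
congr (_ + _ * _); case: v => [j|k] /=; last by rewrite pd_cst !ffunE.
have -> : (fun y => (y 0 j *: one) J) = (fun y => one J * y 0 j).
  by apply/funext => y; rewrite lamZE mulrC.
by rewrite (pdZ l _ zi (reg_coord zi j) ix) pd_coord lamZE mulrC.
Qed.

Lemma dth_eul k (v : var) x :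
  dth k (eul x v : Lam) = if v is inr k' then (k' == k)%:R *: one else 0.
Proof.
case: v => [j|k'] /=; first by rewrite dthZ dth_mono finset.in_set0 lamZ0.
rewrite dth_mono finset.in_set1 [k == k']eq_sym; case: eqP => [->|_]; last by rewrite scale0r.
have -> : ([set k] :\ k = finset.set0)%SET.
  by apply/finset.setP => j; rewrite !inE andNb.
by rewrite sgn0r.
Qed.

Lemma app_coord i U T v x : proj_open U -> U `<=` chart i -> U x ->
  app T (coord i U v) x =
    (x 0 i)^-1 *: T v - (x 0 i ^+ 2)^-1 *: wedge (T (inl i)) (eul x v).
Proof.
move=> pU Ui Ux; have zU := zproj pU; have ix := Ui _ Ux.
have xi : x 0 i != 0 := ix.
have E : app T (coord i U v) x = app T (fun y => (y 0 i)^-1 *: (eul y v : Lam)) x.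
  apply: (app_local _ (struct_reg (struct_coord v pU Ui)) Ux zU Ux) => y Uy.
  by rewrite /coord res_structT.
rewrite {}E /app.
have -> : \sum_l wedge (T (inl l)) (pdL l (fun y => (y 0 i)^-1 *: (eul y v : Lam)) x) =
  - ((x 0 i ^+ 2)^-1 *: wedge (T (inl i)) (eul x v)) +
  (x 0 i)^-1 *: (\sum_l wedge (T (inl l)) (deul l v)).
  under eq_bigr => l _ do rewrite pdL_coord // wedgeDr !wedgeZr.
  rewrite big_split -scaler_sumr; congr (_ + _).
  rewrite (bigD1 i) //= big1 => [|l li].
    by rewrite eqxx mulN1r scaleNr addr0.
  by rewrite eq_sym (negPf li) oppr0 mul0r scale0r.
under [X in _ + X]eq_bigr => k _ do rewrite dthZ wedgeZr dth_eul.
rewrite -scaler_sumr -addrA -scalerDr addrC; congr (_ *: _ - _).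
case: v => [j|k].
  rewrite [X in _ + X]big1 ?addr0 => [|k _]; last by rewrite wedge0r.
  rewrite (bigD1 j) //= big1 => [|l lj]; first by rewrite eqxx scale1r wedge1r addr0.
  by rewrite /deul eq_sym (negPf lj) scale0r wedge0r.
rewrite big1 ?add0r => [|l _]; last by rewrite wedge0r.
rewrite (bigD1 k) //= big1 => [|l lk]; first by rewrite eqxx scale1r wedge1r addr0.
by rewrite eq_sym (negPf lk) scale0r wedge0r.
Qed.

(** The representative modulo Euler's field whose i-th component is 0. *)
Definition nrm i x T : var -> Lam := fun v => T v - (x 0 i)^-1 *: wedge (T (inl i)) (eul x v).

(** The coefficients of a derivation over U, a subset of the i-th chart, read
    off its values on x_l / x_i and theta_k / x_i; the one along x_i is 0. *)
Definition cval i U D : vf := fun v x => x 0 i *: D U (coord i U v) x.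

Lemma cval_Dop i U Th v x : proj_open U -> U `<=` chart i -> U x ->
  cval i U (Dop U Th) v x = nrm i x (Th^~ x) v.
Proof.
move=> pU Ui Ux; have xi : x 0 i != 0 := Ui _ Ux.
rewrite /cval (DopE _ pU (fun _ h => h) (struct_coord v pU Ui) Ux) (app_coord _ _ pU Ui Ux).
rewrite scalerBr !scalerA (divff xi) scale1r /nrm; congr (_ - _ *: _).
by field.
Qed.

Lemma cval_vf a i U D : tangent_sheaf a U D -> proj_open U -> U `<=` chart i ->
  vf_on a U (cval i U D).
Proof.
move=> [DT _] pU Ui v; have [D1 _ D3 _ _] := DT U pU (fun _ h => h).
have sD := D1 _ (struct_coord v pU Ui); split.
- by apply: regL_scale (struct_reg sD); apply: reg_coord; exact: zproj.
- move=> l x l0 Ux; by rewrite /cval scZ (struct_sc _ sD l0) mxE scalerA.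
- move=> x Ux; apply: parZ; exact: (D3 _ _ (struct_coord v pU Ui) (@par_coord i U v)).
Qed.

Lemma res_tangentT W D V : V `<=` W -> res_tangent W D V = D V.
Proof. by move=> VW; rewrite /res_tangent patchT // inE. Qed.

Lemma res_tangentN W D V : ~ (V `<=` W) -> res_tangent W D V = 0.
Proof. by move=> VW; rewrite /res_tangent patchC // inE. Qed.

Lemma cval_res a i U W D v x : tangent_sheaf a U D -> proj_open U -> U `<=` chart i ->
  proj_open W -> W `<=` U -> W x ->
  cval i W (res_tangent W D) v x = cval i U D v x.
Proof.
move=> [DT _] pU Ui pW WU Wx; have [_ _ _ _ D5] := DT U pU (fun _ h => h).
rewrite /cval (res_tangentT _ (fun _ h => h)) (coord_res _ _ WU).
by rewrite (D5 _ _ pW WU (struct_coord v pU Ui)) res_structT.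
Qed.

End Coordinates.

(** * A derivation over a chart is a vector field *)

Section Representation.
Import mpoly.
Variables (R : realType) (n m : nat).
Local Notation K := R[i].
Local Notation pt := 'rV[K]_n.+1.
Local Notation poly := {mpoly K[n.+1]}.
Local Notation Lam := (grassmann K m).
Local Notation var := ('I_n.+1 + 'I_m)%type.
Local Notation vf := (var -> pt -> Lam).
Implicit Types (x y : pt) (U V W : set pt) (f g : pt -> Lam) (T : var -> Lam) (a b : bool).
Implicit Types (Th : vf) (D : sheaf_op R n m).
Local Notation one := (mono R (@finset.set0 'I_m)).
Local Notation theta k := (mono R (@finset.set1 'I_m k)).
Local Notation ffE := (lamZE, ffunE).
Hint Resolve zproj pinv : core.

Lemma tangentP a U c D D' : tangent_sheaf a U D -> tangent_sheaf a U D' ->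
  tangent_sheaf a U (c *: D + D').
Proof.
move=> [DT D0] [DT' D0']; split; last first.
  move=> V f H; apply/funext => x.
  have -> : (c *: D + D') V f x = c *: D V f x + D' V f x by [].
  by rewrite (D0 _ _ H) (D0' _ _ H) lamZ0 addr0.
move=> V pV VU; have [E1 E2 E3 E4 E5] := DT V pV VU.
have [F1 F2 F3 F4 F5] := DT' V pV VU.
have E V' f : (c *: D + D') V' f = c *: D V' f + D' V' f by [].
split.
- by move=> f fV; rewrite E; apply: struct_P; [|apply: E1|apply: F1].
- move=> d f g fV gV; apply/funext => x; rewrite !E E2 // F2 //.
  have -> : (c *: (d *: D V f + D V g) + (d *: D' V f + D' V g)) x =
    c *: (d *: D V f x + D V g x) + (d *: D' V f x + D' V g x) by [].
  have -> : (d *: (c *: D V f + D' V f) + (c *: D V g + D' V g)) x =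
    d *: (c *: D V f x + D' V f x) + (c *: D V g x + D' V g x) by [].
  by rewrite !scalerDr !scalerA [d * c]mulrC addrACA.
- move=> b f fV bf x; rewrite E; have -> : (c *: D V f + D' V f) x = c *: D V f x + D' V f x by [].
  by apply: parP; [apply: (E3 b)|apply: (F3 b)].
- move=> b f g fV gV bf; apply/funext => x; rewrite !E (E4 b) // (F4 b) //.
  have -> : (c *: (mul_section (D V f) g + (-1) ^+ (a && b) *: mul_section f (D V g)) +
     (mul_section (D' V f) g + (-1) ^+ (a && b) *: mul_section f (D' V g))) x =
     c *: (wedge (D V f x) (g x) + (-1) ^+ (a && b) *: wedge (f x) (D V g x)) +
     (wedge (D' V f x) (g x) + (-1) ^+ (a && b) *: wedge (f x) (D' V g x)) by [].
  have -> : (mul_section (c *: D V f + D' V f) g +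
      (-1) ^+ (a && b) *: mul_section f (c *: D V g + D' V g)) x =
      wedge (c *: D V f x + D' V f x) (g x) +
      (-1) ^+ (a && b) *: wedge (f x) (c *: D V g x + D' V g x) by [].
  by rewrite wedgeP wedgePr !scalerDr !scalerA [_ * c]mulrC addrACA.
- move=> W f pW WV fV; rewrite !E E5 // F5 //; apply/funext => x.
  have [Wx|nWx] := EM (W x); last first.
    have -> : (c *: res_struct W (D V f) + res_struct W (D' V f)) x =
       c *: res_struct W (D V f) x + res_struct W (D' V f) x by [].
    by rewrite !(res_structN _ nWx) lamZ0 addr0.
  have -> : (c *: res_struct W (D V f) + res_struct W (D' V f)) x =
       c *: res_struct W (D V f) x + res_struct W (D' V f) x by [].
  by rewrite !(res_structT _ Wx).
Qed.

(** The multiple of x whose i-th coordinate is 1. *)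
Definition toslice i x : pt := (x 0 i)^-1 *: x.

Lemma homogenize i (p : poly) : exists N q, forall y, chart i y ->
  evalp q y = y 0 i ^+ N * evalp p (toslice i y).
Proof.
elim/mpoly_alg_ind: p => [c|l|p q [N [s Hs]] [M [t Ht]]|p q [N [s Hs]] [M [t Ht]]].
- by exists 0%N, c%:MP => y _; rewrite !evalpC expr0 mul1r.
- exists 1%N, 'X_l => y yi; rewrite !evalpXU mxE expr1 mulrA divff ?mul1r //.
- exists (N + M)%N, (s * 'X_i ^+ M + t * 'X_i ^+ N) => y yi.
  by rewrite !evalpD !evalpM !evalpXn !evalpXU Hs // Ht // exprD; ring.
- exists (N + M)%N, (s * t) => y yi.
  by rewrite !evalpM Hs // Ht // exprD; ring.
Qed.

Section Killed.
Variables (a : bool) (i : 'I_n.+1) (U : set pt) (D : sheaf_op R n m).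
Hypotheses (DT : tangent_sheaf a U D) (pU : proj_open U) (Ui : U `<=` chart i).
Hypothesis D0 : forall v, D U (coord i U v) = 0.

Section Open.
Variable W : set pt.
Hypotheses (pW : proj_open W) (WU : W `<=` U).

Implicit Types (s t : pt -> Lam).

(** The hypothesis D0 makes these functions a subring that contains the
    coordinates x_l / x_i and theta_k / x_i. *)
Definition killed s :=
  struct_sheaf W (res_struct W s) /\ D W (res_struct W s) = 0.

Lemma killed_coord v : killed (fun x => (x 0 i)^-1 *: (eul x v : Lam)).
Proof.
split; first exact: (struct_coord v pW (subset_trans WU Ui)).
have [_ _ _ _ D5] := DT.1 U pU (fun _ h => h).
by rewrite -[res_struct _ _]/(coord i W v) (coord_res _ _ WU) (D5 _ _ pW WU (struct_coord v pU Ui)) D0;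
  apply/funext => x; rewrite /res_struct /patch if_same.
Qed.

Lemma res_ext s t : (forall x, W x -> s x = t x) -> res_struct W s = res_struct W t.
Proof.
move=> st; apply/funext => x; have [Wx|nWx] := EM (W x); last by rewrite !(res_structN _ nWx).
by rewrite !(res_structT _ Wx) st.
Qed.

Lemma killed_ext s t : (forall x, W x -> s x = t x) -> killed s -> killed t.
Proof. by move=> st; rewrite /killed (res_ext st). Qed.

Lemma killed_P c s t : killed s -> killed t -> killed (fun x => c *: s x + t x).
Proof.
move=> [sW Ds] [tW Dt]; have [_ D2 _ _ _] := DT.1 W pW WU.
have E : res_struct W (fun x => c *: s x + t x) = c *: res_struct W s + res_struct W t.
  apply/funext => x.
  have -> : (c *: res_struct W s + res_struct W t) x = c *: res_struct W s x + res_struct W t x by [].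
  have [Wx|nWx] := EM (W x); first by rewrite !(res_structT _ Wx).
  by rewrite !(res_structN _ nWx) lamZ0 addr0.
split; rewrite E; first exact: struct_P.
by rewrite (D2 _ _ _ sW tW) Ds Dt scaler0 addr0.
Qed.

Lemma res_mul s t : res_struct W (fun x => wedge (s x) (t x)) =
  mul_section (res_struct W s) (res_struct W t).
Proof.
apply/funext => x; rewrite /mul_section.
have [Wx|nWx] := EM (W x); first by rewrite !(res_structT _ Wx).
by rewrite !(res_structN _ nWx) wedge0l.
Qed.

Lemma par_res b s : (forall x, W x -> par b (s x)) -> has_parity b (res_struct W s).
Proof.
move=> bs x; have [Wx|nWx] := EM (W x); first by rewrite (res_structT _ Wx); apply: bs.
by rewrite (res_structN _ nWx); exact: par0.
Qed.

Lemma killed_mul b s t : (forall x, W x -> par b (s x)) -> killed s -> killed t ->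
  killed (fun x => wedge (s x) (t x)).
Proof.
move=> bs [sW Ds] [tW Dt]; have [_ _ _ D4 _] := DT.1 W pW WU.
split; rewrite res_mul; first exact: struct_mul.
rewrite (D4 _ _ _ sW tW (par_res bs)) Ds Dt; apply/funext => x.
transitivity (wedge 0 (res_struct W t x) + (-1) ^+ (a && b) *: wedge (res_struct W s x) 0 : Lam).
  by [].
by rewrite wedge0l wedge0r lamZ0 addr0.
Qed.

Lemma killed_one : killed (fun=> one).
Proof.
case: (killed_coord (inl i)) => sW Ds.
apply: (@killed_ext (fun x => (x 0 i)^-1 *: (eul x (inl i) : Lam))) => [x Wx|].
  by rewrite /= scalerA mulVf ?scale1r //; exact: (Ui (WU Wx)).
by [].
Qed.

Lemma par_one c : par false (c *: one).
Proof. by apply: parZ; have := @par_mono R m finset.set0; rewrite cards0. Qed.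

Lemma killed_cst c : killed (fun=> c *: one).
Proof.
have Kz : killed (fun=> 0).
  apply: killed_ext (killed_P (-1) killed_one killed_one) => x _.
  by rewrite scaleN1r addNr.
by apply: killed_ext (killed_P c killed_one Kz) => x _; rewrite addr0.
Qed.

Lemma killed_poly p : killed (fun x => evalp p (toslice i x) *: one).
Proof.
elim/mpoly_alg_ind: p => [c|l|p q Kp Kq|p q Kp Kq].
- by apply: killed_ext (killed_cst c) => x _; rewrite evalpC.
- apply: killed_ext (killed_coord (inl l)) => x _.
  by rewrite evalpXU mxE /= scalerA.
- apply: killed_ext (killed_P 1 Kp Kq) => x _.
  by rewrite evalpD scale1r scalerDl.
- apply: killed_ext (@killed_mul false _ _ _ Kp Kq) => x _; last exact: par_one.
  by rewrite evalpM wedgeZl wedge1l scalerA.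
Qed.

Lemma killed_mono (J : {set 'I_m}) : killed (fun x => (x 0 i)^-1 ^+ #|J| *: mono R J).
Proof.
move: {2}#|J| (erefl #|J|) => d; elim: d J => [|d IH] J Jd.
  move/eqP: Jd; rewrite cards_eq0 => /eqP ->.
  by apply: killed_ext killed_one => x _; rewrite cards0 expr0 scale1r.
have [k kJ] : exists k, k \in J.
  by apply/set0Pn; rewrite -cards_eq0 Jd.
have Jk : #|(J :\ k)%SET| = d by have := cardsD1 k J; rewrite kJ Jd => -[].
have [KS0 KS] := killed_cst (wedge_sign K [set k]%SET (J :\ k)%SET).
have H : killed (fun x => wedge ((x 0 i)^-1 *: (eul x (inr k) : Lam))
    ((x 0 i)^-1 ^+ #|(J :\ k)%SET| *: mono R (J :\ k)%SET)).
  apply: (@killed_mul true _ _ _ (killed_coord (inr k)) (IH _ Jk)) => x _.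
  by apply: parZ; exact: (@par_eul R n m x (inr k)).
have H0 := killed_cst 0.
apply: killed_ext (killed_P (wedge_sign K [set k]%SET (J :\ k)%SET) H H0) => x _.
have dk : k \notin (J :\ k)%SET by rewrite finset.setD11.
rewrite scale0r addr0 wedgeZl wedgeZr [eul x _]/= (wedge_theta_mono _ dk) (finset.setD1K kJ).
by rewrite !scalerA Jk Jd exprS mulrAC sgnK mul1r.
Qed.

(** The Leibniz rule for phi q = p gives D(phi) q = 0, and q has no zero. *)
Lemma killed_quotient (phi : pt -> K) (p q : poly) :
  struct_sheaf W (res_struct W (fun x => phi x *: one)) ->
  (forall x, W x -> evalp q (toslice i x) != 0) ->
  (forall x, W x -> phi x * evalp q (toslice i x) = evalp p (toslice i x)) ->
  killed (fun x => phi x *: one).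
Proof.
move=> sW q0 pq; split => //; set s := res_struct W _ in sW *.
have [D1 _ _ D4 _] := DT.1 W pW WU.
have [tW Dt] := killed_poly q; set t := res_struct W _ in tW Dt.
have s0 : has_parity false s by apply: par_res => x _; exact: par_one.
have E : mul_section s t = res_struct W (fun x => evalp p (toslice i x) *: one).
  by rewrite -res_mul; apply: res_ext => x Wx; rewrite wedgeZl wedge1l scalerA pq.
apply/funext => x; have [Wx|nWx] := EM (W x); last exact: (struct_out (D1 _ sW)).
have := D4 _ _ _ sW tW s0; rewrite E (killed_poly p).2 Dt => /(congr1 (fun h => h x)) H.
have {}H : 0 = wedge (D W s x) (evalp q (toslice i x) *: one) +
    (-1) ^+ (a && false) *: wedge (s x) 0 by rewrite -(res_structT (fun x => _ *: one) Wx).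
move: H; rewrite wedge0r lamZ0 addr0 wedgeZr wedge1r => /esym/eqP.
by rewrite scaler_eq0 (negPf (q0 _ Wx)) => /eqP.
Qed.

End Open.

Lemma toslice_scale (l : K) x : l != 0 -> toslice i (l *: x) = toslice i x.
Proof. by move=> l0; rewrite /toslice mxE invfM scalerA mulrAC mulVf // mul1r. Qed.

(** f_J theta_J is the product of x_i^|J| f_J, which has degree 0 and so is a
    local quotient of polynomials in the x_l / x_i, and of the theta_k / x_i
    with k in J. *)
Lemma killed_component V f (J : {set 'I_m}) : proj_open V -> V `<=` U ->
  struct_sheaf V f -> killed V (fun x => f x J *: mono R J).
Proof.
move=> pV VU fV; have Vi := subset_trans VU Ui; have zV := zproj pV.
have fh (l : K) x : l != 0 -> l ^+ #|J| * f (l *: x) J = f x J.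
  by move=> l0; rewrite -[in RHS](struct_sc x fV l0) ffunE.
have sV : struct_sheaf V (res_struct V (fun x => f x J *: mono R J)).
  apply: res_structI => //.
    by apply: regL_scale; [exact: struct_reg|move=> L; exact: reg_cst].
  by move=> l x l0 _; rewrite scZ sc_mono scalerA mulrC fh.
split => //; have [D1 _ _ _ D5] := DT.1 V pV VU.
apply/funext => x; have [Vx|nVx] := EM (V x); last exact: (struct_out (D1 _ sV)).
pose phi y := y 0 i ^+ #|J| * f y J.
have phireg : regular_on V phi.
  apply: regM; last exact: struct_reg.
  apply: (reg_eq _ (reg_poly zV ('X_i ^+ #|J|))) => y _.
  by rewrite evalpXn evalpXU.
have phih (l : K) y : l != 0 -> phi (l *: y) = phi y.
  by move=> l0; rewrite /phi mxE exprMn -(fh l y l0) mulrAC mulrC mulrA [_ * f _ _]mulrC mulrA.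
have sli y : V y -> V (toslice i y) /\ phi (toslice i y) = phi y.
  move=> Vy; have yi := invr_neq0 (Vi _ Vy); split; first exact: (pinv pV).
  exact: phih.
have [V' [p [q [[zV' V'u E] V'V]]]] := reg_frac phireg (sli _ Vx).1.
have [k [ku kV']] := zopen_basis zV' V'u.
have [N [k' Hk]] := homogenize i k.
pose W := V `&` basic k'.
have pW : proj_open W.
  split; [apply: zopenI => //; exact: zopen_basic|by case: pV => _ Vc _ y [/Vc]|].
  move=> l y l0 [Vy ky]; have Vly := pinv pV l0 Vy; split => //.
  move: ky; rewrite /basic /= (Hk _ (Vi _ Vy)) (Hk _ (Vi _ Vly)) toslice_scale //.
  rewrite !mulf_eq0 !negb_or !expf_eq0 => /andP[_ ->]; rewrite andbT.
  by rewrite negb_and (Vi _ Vly) orbT.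
have WV : W `<=` V by move=> y [].
have Wx : W x.
  split => //; rewrite /basic /= (Hk _ (Vi _ Vx)) mulf_neq0 //.
  by rewrite expf_neq0 //; exact: (Vi _ Vx).
have Wu y : W y -> V' (toslice i y).
  move=> [Vy]; rewrite /basic /= (Hk _ (Vi _ Vy)) mulf_eq0 negb_or => /andP[_ ?].
  exact: kV'.
have WU := subset_trans WV VU; have zW := zproj pW.
have K1 : killed W (fun y => phi y *: one).
  apply: (@killed_quotient _ pW WU phi p q).
  - apply: res_structI => //.
      apply: regL_scale; first exact: reg_sub phireg.
      by move=> L; exact: reg_cst.
    by move=> l y l0 _; rewrite scZ sc_mono cards0 scale1r phih.
  - by move=> y /Wu /E[].
  - move=> y Wy; have [q0 fE] := E _ (Wu y Wy).
    by rewrite -(sli _ (WV _ Wy)).2 fE divfK.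
have K2 : killed W (fun y => f y J *: mono R J).
  apply: killed_ext (killed_mul pW WU (b := false) _ K1 (killed_mono pW WU J)) => y Wy.
    rewrite wedgeZl wedge1l scalerA /phi exprVn mulrAC divff ?mul1r // expf_neq0 //.
    exact: (Vi _ (WV _ Wy)).
  exact: par_one.
have := D5 _ _ pW WV sV => /(congr1 (fun h => h x)).
rewrite (res_structT _ Wx) => <-.
rewrite (_ : res_struct W _ = res_struct W (fun y => f y J *: mono R J)) ?K2.2 //.
by apply: res_ext => y Wy; rewrite (res_structT _ (WV _ Wy)).
Qed.

(** On a chart a derivation is determined by its values on the coordinates:
    a section is locally a polynomial in the theta_k / x_i whose coefficients
    are quotients of polynomials in the x_l / x_i. *)
Lemma killed_all V f : D V f = 0.
Proof.
have [[pV VU fV]|] := EM [/\ proj_open V, V `<=` U & struct_sheaf V f]; last exact: DT.2.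
have E : res_struct V f = f.
  apply/funext => x; have [Vx|nVx] := EM (V x); first by rewrite (res_structT _ Vx).
  by rewrite (res_structN _ nVx) (struct_out fV nVx).
suff [_] : killed V f by rewrite E.
have H (r : seq {set 'I_m}) : killed V (fun x => \sum_(J <- r) f x J *: mono R J).
  elim: r => [|J r IH].
    by apply: killed_ext (killed_cst pV VU 0) => x _; rewrite big_nil scale0r.
  apply: killed_ext (killed_P pV VU 1 (killed_component J pV VU fV) IH) => x _.
  by rewrite big_cons scale1r.
by apply: killed_ext (H (index_enum _)) => x _; rewrite -lam_sum.
Qed.
End Killed.

(** The difference of the two sides is a derivation that annihilates the
    coordinates. *)
Lemma tangent_repr a i U D : tangent_sheaf a U D -> proj_open U -> U `<=` chart i ->
  D = Dop U (cval i U D).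
Proof.
move=> DT pU Ui; set Th := cval i U D.
have ThU : vf_on a U Th by exact: (cval_vf DT pU Ui).
have DT' := tangentP (-1) (Dop_tangent ThU) DT.
have Thi x : U x -> Th (inl i) x = 0.
  move=> Ux; have [D1 _ _ D4 _] := DT.1 U pU (fun _ h => h).
  pose s := res_struct U (fun=> one).
  have sE : coord i U (inl i) = s.
    by apply: res_ext => y Uy /=; rewrite scalerA mulVf ?scale1r //; exact: Ui.
  have sU : struct_sheaf U s by rewrite -sE; exact: struct_coord.
  have ss : mul_section s s = s.
    by rewrite -res_mul; apply: res_ext => y _; rewrite wedge1l.
  have s0 : has_parity false s by rewrite -sE; exact: par_coord.
  have := D4 _ _ _ sU sU s0; rewrite ss andbF => /(congr1 (fun h => h x)) H.
  have {}H : D U s x = wedge (D U s x) one + 1 *: wedge one (D U s x).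
    by rewrite -(res_structT (fun=> one) Ux).
  move: H; rewrite scale1r wedge1l wedge1r => /eqP.
  by rewrite -subr_eq0 opprD addNKr oppr_eq0 => /eqP E; rewrite /Th /cval sE E lamZ0.
have Dc v : (-1 *: Dop U Th + D) U (coord i U v) = 0.
  have [D1 _ _ _ _] := DT'.1 U pU (fun _ h => h).
  apply/funext => x; have [Ux|nUx] := EM (U x); last first.
    exact: (struct_out (D1 _ (struct_coord v pU Ui)) nUx).
  transitivity (- Dop U Th U (coord i U v) x + D U (coord i U v) x).
    by rewrite -[- Dop _ _ _ _ _]scaleN1r.
  have := cval_Dop Th v pU Ui Ux; rewrite /nrm Thi // wedge0l lamZ0 subr0 /Th /cval => E.
  have xi : x 0 i != 0 := Ui _ Ux.
  by rewrite (scalerI xi E) addNr.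
apply/funext => V; apply/funext => f.
have := killed_all DT' pU Ui Dc V f => H.
have {H} : - Dop U Th V f + D V f = 0 by rewrite -[RHS]H -[- Dop _ _ _ _]scaleN1r.
by move/eqP; rewrite addrC subr_eq0 => /eqP.
Qed.
End Representation.

(** * The Cech complex of the standard cover, monomial by monomial *)

Section MonomialCech.
Import mpoly.
Variables (R : realType) (n : nat).
Local Notation K := R[i].
Local Notation poly := {mpoly K[n.+1]}.
Local Notation ind := 'I_n.+1.
Variable N : nat.
Implicit Types (p q : poly) (M : 'X_{1..n.+1}) (i j k l r : ind) (I : seq ind) (d : nat).

(** p / (x_0 ... x_n)^N is homogeneous, of degree d - (n + 1) N, with poles only
    along the coordinates in I. *)
Definition poles I d p := forall M, p@_M != 0 ->
  mdeg M = d /\ forall r, r \notin I -> (N <= M r)%N.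

Lemma poles0 I d : poles I d 0.
Proof. by move=> M; rewrite mcoeff0 eqxx. Qed.

Lemma polesP I d c p q : poles I d p -> poles I d q -> poles I d (c *: p + q).
Proof.
move=> sp sq M; rewrite mcoeffD mcoeffZ; have [->|/sp //] := eqVneq p@_M 0.
by rewrite mulr0 add0r; exact: sq.
Qed.

Lemma polesZ I d c p : poles I d p -> poles I d (c *: p).
Proof. by move=> sp; rewrite -[_ *: _]addr0; apply: polesP (poles0 _ _). Qed.

Lemma polesB I d p q : poles I d p -> poles I d q -> poles I d (p - q).
Proof. by move=> sp sq; rewrite addrC -scaleN1r; apply: polesP. Qed.

Lemma mcoeffXlM l p M : ('X_l * p)@_M = if M l == 0%N then 0 else p@_(M - U_(l)).
Proof.
case: eqP => [Ml|/eqP Ml]; last first.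
  have {1}-> : M = (U_(l) + (M - U_(l)))%MM.
    by rewrite addmC submK // lep1mP.
  by rewrite mulrC mcoeffMX.
apply: memN_msupp_eq0; apply/negP; rewrite mulrC (perm_mem (msuppMX _ _)).
by case/mapP => M' _ E; move: Ml; rewrite E mnmDE mnm1E eqxx.
Qed.

Lemma poles_mulX I d l p : poles I d p -> poles I d.+1 ('X_l * p).
Proof.
move=> sp M; rewrite mcoeffXlM; case: (M l =P 0%N) => [_|/eqP Ml]; first by rewrite eqxx.
case/sp => Md MN; split.
  have <- : (M - U_(l) + U_(l))%MM = M by rewrite submK // lep1mP.
  by rewrite mdegD Md mdeg1 addn1.
by move=> r /MN /leq_trans; apply; rewrite mnmBE leq_subr.
Qed.

Definition filt (P : pred 'X_{1..n.+1}) p : poly :=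
  \sum_(M <- msupp p | P M) p@_M *: 'X_[M].

Lemma mcoeff_filt P p M : (filt P p)@_M = if P M then p@_M else 0.
Proof.
rewrite /filt raddf_sum /=.
have [Mp|Mp] := boolP (M \in msupp p); last first.
  rewrite (memN_msupp_eq0 Mp) if_same big_seq_cond big1 // => M' /andP[M'p _].
  rewrite mcoeffZ mcoeffX; case: eqP => [E|_]; last by rewrite mulr0.
  by rewrite -E M'p in Mp.
rewrite big_mkcond (bigD1_seq M) ?msupp_uniq //= big1 => [|M' M'M].
  by rewrite addr0; case: (P M) => //; rewrite mcoeffZ mcoeffX eqxx mulr1.
by case: (P M') => //; rewrite mcoeffZ mcoeffX (negPf M'M) mulr0.
Qed.

(** A coordinate along which the Laurent monomial M has no pole. *)
Definition nopole M : option ind := [pick r | (N <= M r)%N].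

Lemma nopoleP M k : nopole M = Some k -> (N <= M k)%N.
Proof. by rewrite /nopole; case: pickP => // r rN [<-]. Qed.

Lemma nopoleN M r : nopole M = None -> (M r < N)%N.
Proof. by rewrite /nopole; case: pickP => // H _; rewrite ltnNge H. Qed.

(** The contracting homotopy of the Cech complex, defined monomial by monomial:
    it takes the monomial M from F k, for the chosen index k along which M has
    no pole. *)
Definition pick_part (F : ind -> poly) : poly :=
  \sum_k filt (fun M => nopole M == Some k) (F k).

Lemma mcoeff_pick F M : (pick_part F)@_M = if nopole M is Some k then (F k)@_M else 0.
Proof.
rewrite /pick_part raddf_sum /=.
under eq_bigr => k _ do rewrite mcoeff_filt.
case: (nopole M) => [k|]; last by rewrite big1.
rewrite (bigD1 k) //= eqxx big1 ?addr0 // => j jk.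
by case: eqP => // -[E]; rewrite E eqxx in jk.
Qed.

Lemma poles_pick I d (F : ind -> poly) : (forall k, poles (k :: I) d (F k)) ->
  poles I d (pick_part F).
Proof.
move=> sF M; rewrite mcoeff_pick; case E : (nopole M) => [k|]; last by rewrite eqxx.
case/sF => Md MN; split => // r rI; have [->|rk] := eqVneq r k; first exact: nopoleP.
by apply: MN; rewrite inE negb_or rk.
Qed.

Lemma third_index i j : (2 <= n)%N -> exists r, r \notin [:: i; j].
Proof.
move=> n2; apply/existsP; rewrite -[X in is_true X]negbK negb_exists.
apply/negP => /forallP H.
have : (#|{: ind}| <= size [:: i; j])%N.
  apply: leq_trans (card_size _); apply: subset_leq_card; apply/fintype.subsetP => r _.
  by have := H r; rewrite negbK.
by rewrite card_ord /= ltnS leqNgt n2.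
Qed.

(** H^1 of the standard cover vanishes, monomial by monomial: the part of w_ij
    without pole along x_k is the coboundary of j |-> w_kj. *)
Lemma cech_H1 d (w : ind -> ind -> poly) : (2 <= n)%N ->
  (forall i j, poles [:: i; j] d (w i j)) ->
  (forall i j k, w i j + w j k = w i k) ->
  exists s : ind -> poly, (forall j, poles [:: j] d (s j)) /\ forall i j, w i j = s j - s i.
Proof.
move=> n2 sw cw; exists (fun j => pick_part (fun k => w k j)); split.
  by move=> j; apply: poles_pick.
move=> i j; apply/mpolyP => M; rewrite mcoeffB !mcoeff_pick.
case E : (nopole M) => [k|]; first by rewrite -(cw k i j) mcoeffD addrC addKr.
rewrite subrr; apply/eqP/negPn/negP => /sw[_ MN].
have [r rij] := third_index i j n2.
by have := MN r rij; rewrite leqNgt (nopoleN r E).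
Qed.

(** The same homotopy in degree 2, where monomials with a pole along every
    coordinate are possible and have to be excluded. *)
Lemma cech_H2 d (G : ind -> ind -> ind -> poly) :
  (forall i j k, poles [:: i; j; k] d (G i j k)) ->
  (forall i j k l, G j k l - G i k l + G i j l - G i j k = 0) ->
  (forall i j k M, (forall r, M r < N)%N -> (G i j k)@_M = 0) ->
  exists H : ind -> ind -> poly, (forall i j, poles [:: i; j] d (H i j)) /\
    forall i j k, G i j k = H i j + H j k - H i k.
Proof.
move=> sG cG G0; exists (fun i j => pick_part (fun k => G k i j)); split.
  by move=> i j; apply: poles_pick.
move=> i j k; apply/mpolyP => M; rewrite mcoeffB mcoeffD !mcoeff_pick.
case E : (nopole M) => [l|]; last by rewrite G0 ?addr0 ?subrr // => r; exact: nopoleN.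
have := congr1 (mcoeff M) (cG l i j k); rewrite /= !(mcoeffB, mcoeffD) mcoeff0.
by move/eqP; rewrite subr_eq0 => /eqP <-; ring.
Qed.

Variable m : nat.
Local Notation var := (ind + 'I_m)%type.
Local Notation sgn := (@wedge_sign K m).
Variable D : nat.
Hypothesis mD : (m <= D)%N.
Implicit Types (g : {set 'I_m} -> poly) (v : var) (J : {set 'I_m}).

(** The v-component of g times Euler's field. *)
Definition emul v g J : poly := match v with
  | inl l => 'X_l * g J
  | inr k => if k \in J then sgn (J :\ k)%SET [set k]%SET *: g (J :\ k)%SET else 0
  end.

Lemma emulP v g g' c J : emul v (fun L => c *: g L + g' L) J = c *: emul v g J + emul v g' J.
Proof.
case: v => [l|k] /=; first by rewrite mulrDr scalerAr.
case: ifP => _; last by rewrite scaler0 addr0.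
by rewrite scalerDr !scalerA mulrC.
Qed.

Lemma cardJ J : (#|J| <= D)%N.
Proof. by rewrite (leq_trans (max_card _)) // card_ord. Qed.

Lemma poles_emul I v g J : (forall L : {set 'I_m}, poles I (D - #|L|) (g L)) -> poles I (D.+1 - #|J|) (emul v g J).
Proof.
move=> sg; case: v => [l|k] /=; first by rewrite subSn ?cardJ //; exact: poles_mulX.
case: ifP => kJ; last exact: poles0.
apply: polesZ; have := cardsD1 k J; rewrite kJ add1n => E.
by rewrite E subSS; exact: sg.
Qed.

Variables (y : ind -> ind -> var -> {set 'I_m} -> poly).
Variables (G : ind -> ind -> ind -> {set 'I_m} -> poly).
Hypothesis n2 : (2 <= n)%N.
Hypothesis sy : forall i j v J, poles [:: i; j] (D.+1 - #|J|) (y i j v J).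
Hypothesis sG : forall i j k J, poles [:: i; j; k] (D - #|J|) (G i j k J).
Hypothesis yG : forall i j k v J, y i j v J + y j k v J - y i k v J = emul v (G i j k) J.

Lemma G_cocycle i j k l J : G j k l J - G i k l J + G i j l J - G i j k J = 0.
Proof.
have X0 : ('X_ord0 : poly) != 0 by rewrite -msize_poly_eq0 msizeX.
apply: (mulfI X0); rewrite mulr0 !(mulrBr, mulrDr).
have e a b c := yG a b c (inl ord0) J; rewrite /= in e.
by rewrite -!e; ring.
Qed.

(** G = H_ij + H_jk - H_ik by the vanishing of the obstruction, and then y - H E
    is a cocycle, to which cech_H1 applies. *)
Theorem unobstructed : (forall i j k J M, (forall r, M r < N)%N -> (G i j k J)@_M = 0) ->
  exists s H, [/\ forall j v J, poles [:: j] (D.+1 - #|J|) (s j v J),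
    forall i j J, poles [:: i; j] (D - #|J|) (H i j J) &
    forall i j v J, y i j v J = s j v J - s i v J + emul v (H i j) J].
Proof.
move=> G0.
have /choice[H HP] : forall J, exists H : ind -> ind -> poly,
    (forall i j, poles [:: i; j] (D - #|J|) (H i j)) /\
    forall i j k, G i j k J = H i j + H j k - H i k.
  move=> J; apply: (@cech_H2 _ (fun i j k => G i j k J)) => //.
    by move=> i j k l; exact: G_cocycle.
  by move=> i j k M; exact: G0.
have sH i j J : poles [:: i; j] (D - #|J|) (H J i j) by case: (HP J).
have GH i j k J : G i j k J = H J i j + H J j k - H J i k by case: (HP J).
have eH v i j k J : emul v (G i j k) J =
    emul v (fun L => H L i j) J + emul v (fun L => H L j k) J - emul v (fun L => H L i k) J.
  case: v => [l|t] /=; first by rewrite GH; ring.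
  by case: ifP => _; rewrite ?subr0 ?addr0 // GH scalerBr scalerDr.
have /choice[s sP] : forall vJ : var * {set 'I_m}, exists s : ind -> poly,
    (forall j, poles [:: j] (D.+1 - #|vJ.2|) (s j)) /\
    forall i j, y i j vJ.1 vJ.2 - emul vJ.1 (fun L => H L i j) vJ.2 = s j - s i.
  move=> [v J] /=; apply: (@cech_H1 _ (fun i j => y i j v J - emul v (fun L => H L i j) J)) => //.
    by move=> i j; apply: polesB => //; apply: poles_emul.
  move=> i j k; have := yG i j k v J; rewrite eH => E.
  apply/eqP; rewrite -subr_eq0; apply/eqP.
  transitivity (y i j v J + y j k v J - y i k v J - (emul v (fun L => H L i j) J +
    emul v (fun L => H L j k) J - emul v (fun L => H L i k) J)); first by ring.
  by rewrite E subrr.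
exists (fun j v J => s (v, J) j), (fun i j J => H J i j); split.
- by move=> j v J; case: (sP (v, J)).
- by [].
- by move=> i j v J; case: (sP (v, J)) => _ /(_ i j) /= <-; rewrite subrK.
Qed.

(** Every product x_l M occurs in some y_ab, which has no pole outside of x_a and
    x_b: so l is the only index other than a and b, and M has a simple pole
    along x_l. For k outside of J the product theta_k M would occur in y as well,
    with all its poles; so J is full, and m = 3 by homogeneity. *)
Theorem obstruction i j k J M : D = (n.+1 * N)%N ->
  (forall r, M r < N)%N -> (G i j k J)@_M != 0 ->
  [/\ n = 2%N, m = 3%N, J = finset.setT & forall r, M r = N.-1].
Proof.
move=> DN MN GM.
have nz v L M' : (emul v (G i j k) L)@_M' != 0 -> exists a b : ind, (y a b v L)@_M' != 0.
  rewrite -yG mcoeffB mcoeffD => ynz; apply: contrapT => H.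
  have z a b : (y a b v L)@_M' = 0 by apply/eqP/negPn/negP => h; apply: H; exists a, b.
  by move: ynz; rewrite !z addr0 subr0 eqxx.
have row l : exists a b : ind, forall r, r \notin [:: a; b] -> r = l /\ M r = N.-1.
  have [|a [b ypq]] := nz (inl l) J (M + U_(l))%MM.
    by rewrite /= mulrC addmC mcoeffMX.
  exists a, b => r rpq; have [_ /(_ r rpq)] := sy ypq.
  rewrite mnmDE mnm1E; have := MN r; case: (l =P r) => [->|_] /= A.
    by move=> B; split => //; lia.
  by rewrite addn0 leqNgt A.
have MN1 l : M l = N.-1.
  have [a [b H]] := row l; have [r rpq] := third_index a b n2.
  by have [<-] := H r rpq.
have n2' : n = 2%N.
  have [a [b H]] := row ord0; have [r rpq] := third_index a b n2.
  have [r0 _] := H r rpq.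
  have : (#|{: ind}| <= size [:: a; b; ord0])%N.
    apply: leq_trans (card_size _); apply: subset_leq_card.
    apply/fintype.subsetP => t _; rewrite !inE.
    have [|] := boolP (t \in [:: a; b]); first by rewrite !inE => /orP[->|->]; rewrite ?orbT.
    by move=> /H[-> _]; rewrite eqxx !orbT.
  by rewrite card_ord /=; move: n2; lia.
have JT : J = finset.setT.
  apply/finset.setP => t; rewrite finset.in_setT; apply/negPn/negP => tJ.
  have [|a [b ypq]] := nz (inr t) (t |: J)%SET M.
    rewrite /= finset.setU11 finset.setU1K // mcoeffZ mulf_neq0 //.
    by rewrite sgnE expf_neq0 // oppr_eq0 oner_neq0.
  have [r rpq] := third_index a b n2; have [_ /(_ r rpq)] := sy ypq.
  by rewrite leqNgt MN.
split => //; have [Md _] := sG GM.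
move: Md; rewrite mdegE (eq_bigr (fun=> N.-1)) => [|r _]; last exact: MN1.
rewrite sum_nat_const card_ord JT finset.cardsT card_ord.
have N0 : (0 < N)%N by apply: leq_trans (MN ord0).
by move: mD; rewrite DN n2'; lia.
Qed.

End MonomialCech.

(** * Regular functions on intersections of charts as Laurent polynomials *)

Section Laurent.
Import mpoly.
Variables (R : realType) (n : nat).
Local Notation K := R[i].
Local Notation pt := 'rV[K]_n.+1.
Local Notation poly := {mpoly K[n.+1]}.
Local Notation ind := 'I_n.+1.
Implicit Types (p q : poly) (M : 'X_{1..n.+1}) (i j k l r : ind) (I : seq ind) (x : pt).

Definition charts I : set pt := [set x | forall r, r \in I -> x 0 r != 0].
Definition torus : set pt := [set x | forall r, x 0 r != 0].

(** The monomial \prod_(r | P r) x_r^N. *)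
Definition mon (P : pred ind) N : 'X_{1..n.+1} := [multinom (if P r then N else 0%N) | r < n.+1].
Local Notation mall := (mon xpredT).

Lemma monE P N r : mon P N r = if P r then N else 0%N.
Proof. by rewrite mnmE. Qed.

Lemma evalp_mon P N x : evalp ('X_[mon P N] : poly) x = \prod_(r | P r) x 0 r ^+ N.
Proof.
rewrite evalpX [RHS]big_mkcond; apply: eq_bigr => r _.
by rewrite monE; case: (P r).
Qed.

Lemma evalp_mon_neq0 (P : pred ind) N x : (forall r, P r -> x 0 r != 0) ->
  evalp ('X_[mon P N] : poly) x != 0.
Proof. by move=> H; rewrite evalp_mon prodf_seq_neq0; apply/allP => r _; apply/implyP => /H; exact: expf_neq0. Qed.

Lemma chartsE I : charts I = basic ('X_[mon (mem I) 1] : poly).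
Proof.
apply/seteqP; split => x; first by move=> H; exact: evalp_mon_neq0.
rewrite /basic /= evalp_mon prodf_seq_neq0 => /allP H r rI.
by have /implyP/(_ rI) := H r (mem_index_enum r); rewrite expr1.
Qed.

Lemma torusE : torus = basic ('X_[mall 1] : poly).
Proof.
apply/seteqP; split => x; first by move=> H; exact: evalp_mon_neq0.
rewrite /basic /= evalp_mon prodf_seq_neq0 => /allP H r.
by have := H r (mem_index_enum r); rewrite /= expr1.
Qed.

Lemma torus_charts I x : torus x -> charts I x.
Proof. by move=> Tx r _; exact: Tx. Qed.

Lemma zopen_charts I : zariski_open (charts I).
Proof. by rewrite chartsE; exact: zopen_basic. Qed.

Lemma monX_neq0 M : ('X_[M] : poly) != 0.
Proof. by rewrite -msize_poly_eq0 msizeX. Qed.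

Lemma poly_torus p q : (forall x, torus x -> evalp p x = evalp q x) -> p = q.
Proof. by rewrite torusE; apply: mpoly_eq_on; exact: monX_neq0. Qed.

Lemma regular_torus I f g : regular_on (charts I) f -> regular_on (charts I) g ->
  (forall x, torus x -> f x = g x) -> forall x, charts I x -> f x = g x.
Proof.
move=> fI gI fg; apply: (regular_dense (monX_neq0 (mall 1)) fI gI) => x _.
by rewrite -torusE; exact: fg.
Qed.

Lemma mdeg_mon P N : (mdeg (mon P N) = #|P| * N)%N.
Proof.
rewrite mdegE (eq_bigr (fun r => if P r then N else 0%N)) => [|r _]; last exact: monE.
by rewrite -big_mkcond sum_nat_const.
Qed.

Lemma evalpX_scale M (l : K) x : evalp ('X_[M] : poly) (l *: x) = l ^+ mdeg M * evalp 'X_[M] x.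
Proof.
rewrite !evalpX mdegE -prodrXr -big_split; apply: eq_bigr => r _.
by rewrite mxE exprMn.
Qed.

(** The denominator of f is a power of the product of the coordinates in I; the
    remaining factors of (x_0 ... x_n)^N are put into the numerator, whose
    components of degrees other than the expected one contribute nothing. *)
Lemma fun_to_poly I (f : pt -> K) (a e : nat) : regular_on (charts I) f ->
  (forall (l : K) x, l != 0 -> charts I x -> l ^+ a * f (l *: x) = l ^+ e * f x) ->
  exists N0, forall N, (N0 <= N)%N -> exists p, poles N I (n.+1 * N + e - a) p /\
    forall x, torus x -> evalp p x = evalp 'X_[mall N] x * f x.
Proof.
rewrite chartsE => /regular_basic[N1 [p1 Hp1]]; rewrite -chartsE => fh.
exists (maxn N1 a) => N; rewrite geq_max => /andP[N1N aN].
set d := (n.+1 * N + e - a)%N.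
pose p0 := p1 * 'X_[mon (mem I) (N - N1)] * 'X_[mon (predC (mem I)) N].
have p0E x : torus x -> evalp p0 x = evalp 'X_[mall N] x * f x.
  move=> Tx; rewrite /p0 !evalpM -Hp1; last first.
    by have := torus_charts (I := I) Tx; rewrite chartsE.
  have <- : ('X_[mon (mem I) 1] ^+ N1 * 'X_[mon (mem I) (N - N1)] * 'X_[mon (predC (mem I)) N] =
      'X_[mall N] :> poly).
    rewrite mpolyXn -!mpolyXD; congr ('X_[_]); apply/mnmP => r.
    by rewrite !mnmDE mulmnE !monE /=; case: (r \in I) => /=; lia.
  by rewrite !evalpM evalpXn; ring.
exists (pihomog mdeg d p0); split.
  move=> M; rewrite -[pihomog _ _ _]/(filt (fun M => mdeg M == d) p0) mcoeff_filt.
  case: (mdeg M =P d) => [Md pM|_]; last by rewrite eqxx.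
  split => // r rI; move: pM; rewrite -mcoeff_msupp (perm_mem (msuppMX _ _)).
  by case/mapP => M' _ ->; rewrite mnmDE monE /= rI leq_addr.
move=> x Tx; rewrite -p0E // -rayE.
have -> : ray p0 x = evalp p0 x *: 'X^d.
  apply: subr0_eq; apply: (@poly_cofinite_eq0 _ _ 'X); first by rewrite polyX_eq0.
  move=> l; rewrite hornerX => l0.
  rewrite hornerD hornerN hornerZ hornerXn ray_horner.
  have Tlx : torus (l *: x) by move=> r; rewrite mxE mulf_neq0.
  apply/eqP; rewrite subr_eq0; apply/eqP; rewrite !p0E // evalpX_scale mdeg_mon.
  apply: (mulfI (expf_neq0 a l0)).
  rewrite mulrCA fh //.
  have -> : #|xpredT : pred ind| = n.+1 by rewrite card_ord.
  have -> : l ^+ (n.+1 * N) * evalp 'X_[mall N] x * (l ^+ e * f x) =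
    l ^+ (n.+1 * N + e) * (evalp 'X_[mall N] x * f x) by rewrite exprD; ring.
  have -> : (n.+1 * N + e = a + d)%N by rewrite /d; nia.
  by rewrite exprD; ring.
by rewrite coefZ coefXn eqxx mulr1.
Qed.

(** The factors x_r^N with r outside of I cancel. *)
Lemma poly_to_fun I N d p (a e : nat) : poles N I d p -> (d + a = n.+1 * N + e)%N ->
  exists f : pt -> K, [/\ regular_on (charts I) f,
    forall (l : K) x, l != 0 -> charts I x -> l ^+ a * f (l *: x) = l ^+ e * f x &
    forall x, torus x -> evalp p x = evalp 'X_[mall N] x * f x].
Proof.
move=> sp da; have [p0|p0] := eqVneq p 0.
  exists (fun=> 0); split => [|l x _ _|x _]; first exact: reg_cst (zopen_charts I) 0.
    by rewrite !mulr0.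
  by rewrite p0 evalp0 mulr0.
pose mC := mon (predC (mem I)) N; pose mI := mon (mem I) N.
pose q := \sum_(M <- msupp p) p@_M *: ('X_[M - mC] : poly).
have pq : p = q * 'X_[mC].
  rewrite {1}[p]mpolyE mulr_suml [LHS]big_seq [RHS]big_seq; apply: eq_bigr => M Mp.
  rewrite -scalerAl -mpolyXD submK //; apply/mnm_lepP => r; rewrite monE /=.
  by case: ifP => // rI; have [|_] := sp M; [rewrite -mcoeff_msupp|apply; rewrite rI].
have card : (#|predC (mem I)| + #|mem I| = n.+1)%N by rewrite addnC cardC card_ord.
have dC : (#|predC (mem I)| * N <= d)%N.
  have [M Mp] : exists M, M \in msupp p.
    by exists (mlead p); exact: mlead_supp.
  have [|<- MN] := sp M; first by rewrite -mcoeff_msupp.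
  rewrite -mdeg_mon !mdegE; apply: leq_sum => r _; rewrite monE /=.
  by case: ifP => // rI; apply: MN; rewrite rI.
have qh (l : K) x : evalp q (l *: x) = l ^+ (d - #|predC (mem I)| * N) * evalp q x.
  rewrite !evalp_sum mulr_sumr [LHS]big_seq [RHS]big_seq; apply: eq_bigr => M Mp.
  have [|Md MN] := sp M; first by rewrite -mcoeff_msupp.
  rewrite !evalpZ evalpX_scale mulrCA; congr (_ ^+ _ * _).
  have : (mC <= M)%MM.
    apply/mnm_lepP => r; rewrite monE /=.
    by case: ifP => // rI; apply: MN; rewrite rI.
  by move/submK/(congr1 (@mdeg _)); rewrite mdegD mdeg_mon Md => <-; rewrite addnK.
have zI := zopen_charts I.
have mI0 x : charts I x -> evalp ('X_[mI] : poly) x != 0 by move=> Ix; exact: evalp_mon_neq0.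
exists (fun x => evalp q x * (evalp 'X_[mI] x)^-1); split.
- by apply: regM; [exact: reg_poly|exact: reg_inv].
- move=> l x l0 Ix; rewrite qh evalpX_scale mdeg_mon.
  have E : (a + (d - #|predC (mem I)| * N) = #|mem I| * N + e)%N by move: card dC da; nia.
  have : l ^+ a * l ^+ (d - #|predC (mem I)| * N) = l ^+ (#|mem I| * N) * l ^+ e.
    by rewrite -!exprD E.
  move: (mI0 x Ix) (expf_neq0 (#|mem I| * N) l0).
  move: (l ^+ _) (l ^+ (d - _)) (l ^+ (_ * _)) (l ^+ e) (evalp _ x) (evalp _ x) => A B Cc D E' F F0 C0 H.
  by rewrite mulrA mulrA H; field; rewrite F0 C0.
- move=> x Tx; rewrite {1}pq evalpM mulrCA; congr (_ * _).
  have mm : mall N = (mC + mI)%MM.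
    by apply/mnmP => r; rewrite mnmDE !monE /=; case: (r \in I); rewrite ?addn0.
  by rewrite mm mpolyXD evalpM mulfK // mI0 //; exact: (torus_charts Tx).
Qed.

End Laurent.

(** * Cocycles of vector fields on the standard cover *)

Lemma fin_eventually (T : finType) (X : Type) (P : T -> nat -> X -> Prop) :
  (forall t, exists N0, forall N, (N0 <= N)%N -> exists p, P t N p) ->
  exists N0, forall N, (N0 <= N)%N -> exists p : T -> X, forall t, P t N (p t).
Proof.
move=> /choice[N0 H]; exists (\max_t N0 t)%N => N NN.
have /choice[p Hp] : forall t, exists p, P t N p; last by exists p.
by move=> t; apply: H; apply: leq_trans NN; exact: (@leq_bigmax _ N0).
Qed.

Section StandardCover.
Import mpoly.
Variables (R : realType) (n m : nat).
Local Notation K := R[i].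
Local Notation pt := 'rV[K]_n.+1.
Local Notation poly := {mpoly K[n.+1]}.
Local Notation ind := 'I_n.+1.
Local Notation Lam := (grassmann K m).
Local Notation var := (ind + 'I_m)%type.
Local Notation vf := (var -> pt -> Lam).
Local Notation mall := (mon xpredT).
Local Notation one := (mono R (@finset.set0 'I_m)).
Local Notation top := (mono R [set: 'I_m]%SET).
Implicit Types (i j k l r : ind) (x : pt) (v : var) (J : {set 'I_m}) (a : bool).

Lemma wedge_eul_inl (g : Lam) x l : wedge g (eul x (inl l)) = x 0 l *: g.
Proof. by rewrite [eul _ _]/= wedgeZr wedge1r. Qed.

Lemma evalp_emul v (g : {set 'I_m} -> poly) J x :
  evalp (emul v g J) x = wedge [ffun L : {set 'I_m} => evalp (g L) x] (eul x v) J.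
Proof.
case: v => [l|k]; first by rewrite wedge_eul_inl lamZE ffunE /= evalpM evalpXU.
rewrite [eul _ _]/= wedge_thetaE /=; case: ifP => _; last exact: evalp0.
by rewrite evalpZ ffunE.
Qed.

(** The polynomials y and G are the numerators of Y and of the coefficient of
    Euler's field in the Cech coboundary of Y, over the denominator
    (x_0 ... x_n)^N. *)
Definition numerators N (Y : ind -> ind -> vf)
    (y : ind -> ind -> var -> {set 'I_m} -> poly)
    (G : ind -> ind -> ind -> {set 'I_m} -> poly) : Prop :=
  [/\ forall i j v J, poles N [:: i; j] ((n.+1 * N).+1 - #|J|) (y i j v J),
    forall i j k J, poles N [:: i; j; k] (n.+1 * N - #|J|) (G i j k J),
    forall i j k v J, y i j v J + y j k v J - y i k v J = emul v (G i j k) J &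
    forall i j v J x, torus x ->
      evalp (y i j v J) x = evalp 'X_[mall N] x * Y i j v x J].

Definition euler_cocycle (Y : ind -> ind -> vf) := forall i j k x,
  charts [:: i; j; k] x ->
  exists g, forall v, Y i j v x + Y j k v x - Y i k v x = wedge g (eul x v).

Lemma numeratorsP a Y : (forall i j, vf_on a (charts [:: i; j]) (Y i j)) ->
  euler_cocycle Y ->
  exists N0, forall N, (N0 <= N)%N -> exists y G, numerators N Y y G.
Proof.
move=> Yvf Yc.
have [|N1 H1] := @fin_eventually (ind * ind * var * {set 'I_m})%type poly (fun t N p =>
      poles N [:: t.1.1.1; t.1.1.2] ((n.+1 * N).+1 - #|t.2|) p /\
      forall x, torus x -> evalp p x =
        evalp 'X_[mall N] x * Y t.1.1.1 t.1.1.2 t.1.2 x t.2).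
  move=> [[[i j] v] J] /=; have [Yr Yh _] := Yvf i j v.
  have [|N0 HN] := fun_to_poly (a := #|J|) (e := 1) (Yr J); last first.
    by exists N0 => N /HN; rewrite addn1.
  by move=> l x l0 Ix; have := congr1 (fun h : Lam => h J) (Yh l x l0 Ix); rewrite ffunE lamZE expr1.
pose g i j k x := (x 0 i)^-1 *: (Y i j (inl i) x + Y j k (inl i) x - Y i k (inl i) x).
have sub2 i j k x : charts [:: i; j; k] x -> [/\ charts [:: i; j] x, charts [:: j; k] x & charts [:: i; k] x].
  by move=> H; split => r; rewrite !inE => /orP[] /eqP ->; apply: H; rewrite !inE eqxx ?orbT.
have gE i j k x v : charts [:: i; j; k] x ->
    Y i j v x + Y j k v x - Y i k v x = wedge (g i j k x) (eul x v).
  move=> Ix; have [g0 Hg] := Yc i j k x Ix.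
  have xi : x 0 i != 0 by apply: Ix; rewrite inE eqxx.
  by rewrite /g !Hg wedge_eul_inl scalerA mulVf // scale1r.
have [|N2 H2] := @fin_eventually (ind * ind * ind * {set 'I_m})%type poly (fun t N p =>
      poles N [:: t.1.1.1; t.1.1.2; t.1.2] (n.+1 * N - #|t.2|) p /\
      forall x, torus x -> evalp p x =
        evalp 'X_[mall N] x * g t.1.1.1 t.1.1.2 t.1.2 x t.2).
  move=> [[[i j] k] J] /=.
  have z := zopen_charts R [:: i; j; k].
  have inC l r s t x : charts [:: r; s; t] x -> l \in [:: r; s; t] -> x 0 l != 0 by move=> H; apply: H.
  have gr : regL (charts [:: i; j; k]) (g i j k).
    apply: regL_scale.
      by apply: reg_coordV => // x H; apply: H; rewrite inE eqxx.
    apply: (@regL_eq _ _ _ _ (fun x => (-1) *: Y i k (inl i) x + (Y i j (inl i) x + Y j k (inl i) x))).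
      by move=> x _; rewrite scaleN1r addrC.
    apply: regL_P => //; last apply: regL_D.
    + by case: (Yvf i k (inl i)) => Yr _ _; apply: regL_sub Yr => // x /sub2[].
    + by case: (Yvf i j (inl i)) => Yr _ _; apply: regL_sub Yr => // x /sub2[].
    + by case: (Yvf j k (inl i)) => Yr _ _; apply: regL_sub Yr => // x /sub2[].
  have [|N0 HN] := fun_to_poly (a := #|J|) (e := 0) (gr J); last first.
    by exists N0 => N /HN; rewrite addn0.
  move=> l x l0 Ix; rewrite expr0 mul1r.
  have [Iij Ijk Iik] := sub2 _ _ _ _ Ix.
  have E : sc l (g i j k (l *: x)) = g i j k x.
    have Yh p q : charts [:: p; q] x -> sc l (Y p q (inl i) (l *: x)) = l *: Y p q (inl i) x.
      by move=> Ipq; case: (Yvf p q (inl i)) => _ H _; apply: H.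
    have xi : x 0 i != 0 by apply: Ix; rewrite inE eqxx.
    rewrite /g scZ scD -[- _]scaleN1r scZ scD !Yh // scaleN1r -scalerDr -scalerBr scalerA mxE.
    by rewrite invfM mulrAC mulVf // mul1r.
  have := congr1 (fun h : Lam => h J) E; rewrite [sc _ _ _]ffunE; exact.
exists (maxn N1 N2) => N; rewrite geq_max => /andP[/H1[y Hy] /H2[G HG]].
exists (fun i j v J => y (i, j, v, J)), (fun i j k J => G (i, j, k, J)); split.
- by move=> i j v J; case: (Hy (i, j, v, J)).
- by move=> i j k J; case: (HG (i, j, k, J)).
- move=> i j k v J; apply: poly_torus => x Tx.
  rewrite evalpB evalpD.
  have yE p q : evalp (y (p, q, v, J)) x = evalp 'X_[mall N] x * Y p q v x J.
    by case: (Hy (p, q, v, J)) => _; apply.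
  rewrite !yE -mulrDr -mulrBr evalp_emul.
  have -> : [ffun L : {set 'I_m} => evalp (G (i, j, k, L)) x] = evalp 'X_[mall N] x *: g i j k x.
    by apply/ffunP => L; rewrite lamZE ffunE; case: (HG (i, j, k, L)) => _; apply.
  rewrite wedgeZl lamZE -gE; last exact: (torus_charts Tx).
  by rewrite !ffunE.
- by move=> i j v J x Tx; case: (Hy (i, j, v, J)) => _; apply.
Qed.

(** * The exceptional class *)

(** For n = 2, the sign of (i, j, l) as a permutation of (0, 1, 2), and 0 if it
    is not one. *)
Definition eps i j l : K :=
  if uniq [:: i; j; l] then (-1) ^+ ((j < i) + (l < i) + (l < j))%N else 0.

(** theta_1 ... theta_m / (x_i x_j) d_l, up to sign, where l is the third index. *)
Definition exc i j : vf := fun v x =>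
  if v is inl l then (eps i j l / (x 0 i * x 0 j)) *: top else 0.

Lemma eps_swap12 i j l : eps j i l = - eps i j l.
Proof.
rewrite /eps /= !inE !andbT [j == i]eq_sym.
have -> : ~~ ((i == j) || (j == l)) && ~~ (i == l) = ~~ ((i == j) || (i == l)) && ~~ (j == l).
  by case: (i == j); case: (i == l); case: (j == l).
have [->|ij] := eqVneq i j; first by rewrite /= oppr0.
case: ifP => _; last by rewrite oppr0.
have sgE (b c : nat) : (b = c.+1)%N -> (-1) ^+ b = - (-1) ^+ c :> K by move=> ->; rewrite exprS mulN1r.
move: ij; rewrite -val_eqE /= neq_ltn => /orP[] ij; last first.
  by rewrite -[LHS]opprK; congr (- _); symmetry; apply: sgE; lia.
by apply: sgE; lia.
Qed.

Lemma eps_swap23 i j l : eps i l j = - eps i j l.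
Proof.
rewrite /eps /= !inE !andbT [l == j]eq_sym.
have -> : ~~ ((i == l) || (i == j)) && ~~ (j == l) = ~~ ((i == j) || (i == l)) && ~~ (j == l).
  by case: (i == j); case: (i == l).
have [->|jl] := eqVneq j l; first by rewrite andbF oppr0.
case: ifP => _; last by rewrite oppr0.
rewrite [X in _ ^+ (X + _)]addnC.
have sgE (b c : nat) : (b = c.+1)%N -> (-1) ^+ b = - (-1) ^+ c :> K by move=> ->; rewrite exprS mulN1r.
move: jl; rewrite -val_eqE /= neq_ltn => /orP[] jl; last first.
  by rewrite -[LHS]opprK; congr (- _); symmetry; apply: sgE; lia.
by apply: sgE; lia.
Qed.

Lemma eps_rep12 i l : eps i i l = 0.
Proof. by rewrite /eps /= inE eqxx. Qed.
Lemma eps_rep13 i j : eps i j i = 0.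
Proof. by rewrite /eps /= !inE eqxx orbT. Qed.
Lemma eps_rep23 i j : eps i j j = 0.
Proof. by rewrite /eps /= !inE eqxx !andbF. Qed.

Lemma eps_sqr i j l : uniq [:: i; j; l] -> eps i j l * eps i j l = 1.
Proof. by rewrite /eps => ->; rewrite -expr2 sqrr_sign. Qed.

Lemma par_top b : odd m = b -> par b (top : Lam).
Proof. by move=> <-; have := @par_mono R m [set: 'I_m]%SET; rewrite finset.cardsT card_ord. Qed.

Lemma exc_vf i j : m = 3%N -> vf_on true (charts [:: i; j]) (exc i j).
Proof.
move=> m3 v; have z := zopen_charts R [:: i; j]; case: v => [l|k] /=; last first.
  split; [by move=> J; exact: reg_cst| |by move=> x _; exact: par0].
  by move=> c x _ _; rewrite sc0 lamZ0.
split.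
- apply: regL_scale; last by move=> J; exact: reg_cst.
  apply: (@reg_eq _ _ _ (fun x => eps i j l * ((x 0 i)^-1 * (x 0 j)^-1))).
    by move=> x _; rewrite invfM.
  apply: regZ => //; apply: regM; apply: reg_coordV => // x H; apply: H.
    by rewrite !inE eqxx.
  by rewrite !inE eqxx orbT.
- move=> c x c0 H; rewrite scZ sc_mono !scalerA finset.cardsT card_ord m3 !mxE.
  have xi : x 0 i != 0 by apply: H; rewrite inE eqxx.
  have xj : x 0 j != 0 by apply: H; rewrite !inE eqxx orbT.
  suff -> : eps i j l / (c * x 0 i * (c * x 0 j)) * c ^+ 3 = c * (eps i j l / (x 0 i * x 0 j)) by [].
  by field; rewrite xi xj c0.
- by move=> x _; apply: parZ; apply: par_top; rewrite m3.
Qed.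

Lemma uniq3_all i j k : n = 2%N -> uniq [:: i; j; k] -> forall r, r \in [:: i; j; k].
Proof.
move=> n2 u; have E : #|[:: i; j; k]| = #|{: ind}|.
  by rewrite (card_uniqP u) card_ord [size _]/= n2.
move=> r; have /fintype.subset_cardP H := E.
by have -> := H (fintype.subset_predT _) r.
Qed.

Lemma prod3 i j k x : n = 2%N -> uniq [:: i; j; k] ->
  \prod_r x 0 r = x 0 i * x 0 j * x 0 k.
Proof.
move=> n2 u; have all_in := uniq3_all n2 u.
have -> : \prod_r x 0 r = \prod_(r <- [:: i; j; k]) x 0 r.
  apply: perm_big; apply: uniq_perm => // [|r]; first exact: index_enum_uniq.
  by rewrite mem_index_enum all_in.
by rewrite !big_cons big_nil mulr1 mulrA.
Qed.

Lemma wedge_top_theta (t : 'I_m) : wedge top (mono R [set t]%SET) = 0.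
Proof.
rewrite wedge_mono; case d : [disjoint [set: 'I_m]%SET & [set t]%SET]%B; last by [].
by have /pred0P/(_ t) := d; rewrite /= !inE eqxx.
Qed.

(** The coefficient theta_1 ... theta_m / (x_0 x_1 x_2) on the right has a pole
    along every coordinate. *)
Lemma exc_cocycle i j k v x : n = 2%N -> charts [:: i; j; k] x ->
  exc i j v x + exc j k v x - exc i k v x =
  wedge ((eps i j k / \prod_r x 0 r) *: top) (eul x v).
Proof.
move=> n2 H.
have xi : x 0 i != 0 by apply: H; rewrite inE eqxx.
have xj : x 0 j != 0 by apply: H; rewrite !inE eqxx orbT.
have xk : x 0 k != 0 by apply: H; rewrite !inE eqxx !orbT.
case: v => [l|t]; last first.
  by rewrite [eul _ _]/= wedgeZl wedge_top_theta lamZ0 /= subr0 addr0.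
rewrite wedge_eul_inl scalerA /exc -scalerDl -scalerBl.
suff -> : eps i j l / (x 0 i * x 0 j) + eps j k l / (x 0 j * x 0 k) - eps i k l / (x 0 i * x 0 k) =
  x 0 l * (eps i j k / \prod_r x 0 r) by [].
have [u|nu] := boolP (uniq [:: i; j; k]).
  have := uniq3_all n2 u l; rewrite (prod3 x n2 u) !inE.
  case/or3P => /eqP ->.
  - rewrite !eps_rep13 eps_swap23 eps_swap12 opprK.
    by field; rewrite xi xj xk.
  - rewrite eps_rep23 eps_rep13 eps_swap23.
    by field; rewrite xi xj xk.
  - rewrite !eps_rep23.
    by field; rewrite xi xj xk.
have -> : eps i j k = 0 by rewrite /eps (negPf nu).
rewrite mul0r mulr0.
move: nu; rewrite /= !inE !andbT negb_and !negbK => /orP[/orP[]|] /eqP E.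
- by rewrite -E eps_rep12 mul0r add0r subrr.
- by rewrite -E eps_rep12 mul0r subr0 (eps_swap12 i j) mulNr [x 0 j * _]mulrC subrr.
- by rewrite -E eps_rep12 mul0r addr0 subrr.
Qed.

Lemma exc_cocycle_top i j k l x : n = 2%N -> charts [:: i; j; k] x ->
  exc i j (inl l) x [set: 'I_m]%SET + exc j k (inl l) x [set: 'I_m]%SET -
  exc i k (inl l) x [set: 'I_m]%SET = x 0 l * (eps i j k / \prod_r x 0 r).
Proof.
move=> n2 Ix; have addE (f g h : Lam) J : (f + g - h) J = f J + g J - h J by rewrite !ffunE.
have topE (b d : K) : (b *: (d *: top)) [set: 'I_m]%SET = b * d.
  by rewrite !lamZE ffunE eqxx mulr1.
by rewrite -addE (exc_cocycle (inl l) n2 Ix) wedge_eul_inl topE.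
Qed.

(** An alternating function of three indices among 0, 1, 2 is a multiple of the
    sign. *)
Lemma antisym3 (n2 : n = 2%N) (u : ind -> ind -> ind -> K) :
  (forall i j k, ~~ uniq [:: i; j; k] -> u i j k = 0) ->
  (forall i j k, u j i k = - u i j k) -> (forall i j k, u i k j = - u i j k) ->
  forall i0 j0 k0, uniq [:: i0; j0; k0] -> forall i j k,
  u i j k = eps i j k * (eps i0 j0 k0 * u i0 j0 k0).
Proof.
move=> u0 s12 s23 i0 j0 k0 U i j k.
have [nu|un] := boolP (~~ uniq [:: i; j; k]); first by rewrite u0 // /eps (negPf nu) mul0r.
have perms (w : ind -> ind -> ind -> K) :
    (forall i j k, w j i k = - w i j k) -> (forall i j k, w i k j = - w i j k) ->
    [/\ w j0 i0 k0 = - w i0 j0 k0, w i0 k0 j0 = - w i0 j0 k0, w j0 k0 i0 = w i0 j0 k0,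
        w k0 i0 j0 = w i0 j0 k0 & w k0 j0 i0 = - w i0 j0 k0].
  move=> w12 w23; have H1 := w12 i0 j0 k0; have H2 := w23 i0 j0 k0.
  have H3 : w j0 k0 i0 = w i0 j0 k0 by rewrite w23 H1 opprK.
  by split=> //; rewrite w12 ?H2 ?H3 ?opprK.
have [e1 e2 e3 e4 e5] := perms _ eps_swap12 eps_swap23.
have [u1 u2 u3 u4 u5] := perms _ s12 s23.
have E : u i0 j0 k0 = eps i0 j0 k0 * (eps i0 j0 k0 * u i0 j0 k0).
  by rewrite mulrA (eps_sqr U) mul1r.
have rep12 (p q : ind) : u p p q = 0 by rewrite u0 //= inE eqxx.
have rep13 (p q : ind) : u p q p = 0 by rewrite u0 //= !inE eqxx orbT.
have rep23 (p q : ind) : u p q q = 0 by rewrite u0 //= !inE eqxx !andbF.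
have all_in := uniq3_all n2 U.
have := all_in i; have := all_in j; have := all_in k.
rewrite !inE => /or3P[] /eqP -> /or3P[] /eqP -> /or3P[] /eqP ->;
  rewrite ?(rep12, rep13, rep23, eps_rep12, eps_rep13, eps_rep23) ?mul0r //;
  rewrite ?(u1, u2, u3, u4, u5) ?(e1, e2, e3, e4, e5) ?mulNr -?E //.
Qed.

(** The component of parity b. *)
Definition prj (b : bool) (f : Lam) : Lam := [ffun J : {set 'I_m} => if odd #|J| == b then f J else 0].

Lemma prj_id b f : par b f -> prj b f = f.
Proof.
move=> bf; apply/ffunP => J; rewrite ffunE; case: (odd _ =P b) => // Jb.
by apply/esym/eqP/negPn/negP => /bf.
Qed.

Lemma prj_0 b f : par (~~ b) f -> prj b f = 0.
Proof.
move=> bf; apply/ffunP => J; rewrite !ffunE; case: (odd _ =P b) => // Jb.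
by apply/eqP/negPn/negP => /bf; rewrite Jb; case: (b).
Qed.

Lemma prjP b c f g : prj b (c *: f + g) = c *: prj b f + prj b g.
Proof.
apply/ffunP => J; rewrite !(lamDE, lamZE, ffunE) /=.
by case: ifP => _; rewrite ?mulr0 ?addr0.
Qed.

Lemma prjD b f g : prj b (f + g) = prj b f + prj b g.
Proof. by have := prjP b 1 f g; rewrite !scale1r. Qed.
Lemma prjB b f g : prj b (f - g) = prj b f - prj b g.
Proof. by rewrite addrC -scaleN1r prjP scaleN1r addrC. Qed.

Lemma par_prj b f : par b (prj b f).
Proof. by move=> J; rewrite ffunE; case: (odd _ =P b) => // _; rewrite eqxx. Qed.

Lemma prj_split b f : f = prj b f + prj (~~ b) f.
Proof.
apply/ffunP => J; rewrite !ffunE; case: (b); case: (odd _); rewrite /= ?addr0 ?add0r //.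
Qed.

Lemma prj_wedge a b f g : par b g -> prj (a (+) b) (wedge f g) = wedge (prj a f) g.
Proof.
move=> bg; rewrite {1}(prj_split a f) wedgeDl prjD prj_id; last first.
  by apply: par_wedge bg; exact: par_prj.
have := par_wedge (@par_prj (~~ a) f) bg; rewrite addNb => H.
by rewrite (prj_0 H) addr0.
Qed.

Lemma sc_prj b (l : K) f : sc l (prj b f) = prj b (sc l f).
Proof. by apply/ffunP => J; rewrite !ffunE; case: ifP => _; rewrite ?mulr0. Qed.

Lemma regL_prj b U (f : pt -> Lam) : zariski_open U -> regL U f -> regL U (fun x => prj b (f x)).
Proof.
move=> zU fU J; apply: (@reg_eq _ _ _ (fun x => (if odd #|J| == b then 1 else 0) * f x J)).
  by move=> x _; rewrite ffunE; case: ifP => _; rewrite ?mul1r ?mul0r.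
exact: regZ.
Qed.

(** The polynomials s and H divided by (x_0 ... x_n)^N satisfy the equation on
    the torus, hence by density wherever both sides are regular. *)
Lemma solution_of_numerators N Y y G c (yt : ind -> ind -> var -> {set 'I_m} -> poly)
    (s : ind -> var -> {set 'I_m} -> poly) (H : ind -> ind -> {set 'I_m} -> poly) a b :
  (forall i j, vf_on a (charts [:: i; j]) (Y i j)) ->
  (forall i j, vf_on b (charts [:: i; j]) (exc i j)) \/ c = 0 ->
  (m <= n.+1 * N)%N -> numerators N Y y G ->
  (forall i j v J x, torus x -> evalp (c *: yt i j v J) x = evalp 'X_[mall N] x * (c * exc i j v x J)) ->
  (forall j v J, poles N [:: j] ((n.+1 * N).+1 - #|J|) (s j v J)) ->
  (forall i j J, poles N [:: i; j] (n.+1 * N - #|J|) (H i j J)) ->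
  (forall i j v J, y i j v J - c *: yt i j v J = s j v J - s i v J + emul v (H i j) J) ->
  exists S : ind -> vf, [/\ forall i v, regL (charts [:: i]) (S i v),
    forall i v (l : K) x, l != 0 -> charts [:: i] x -> sc l (S i v (l *: x)) = l *: S i v x &
    forall i j x, charts [:: i; j] x -> exists h, forall v,
      Y i j v x = S j v x - S i v x + wedge h (eul x v) + c *: exc i j v x].
Proof.
move=> Yvf evf mN [_ _ _ yE] ytE ss sH E.
have cJ (J : {set 'I_m}) : (#|J| <= n.+1 * N)%N.
  by apply: leq_trans mN; rewrite (leq_trans (max_card _)) // card_ord.
have /choice[S SP] : forall t : ind * var * {set 'I_m}, exists f : pt -> K,
    [/\ regular_on (charts [:: t.1.1]) f,
    forall (l : K) x, l != 0 -> charts [:: t.1.1] x -> l ^+ #|t.2| * f (l *: x) = l ^+ 1 * f x &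
    forall x, torus x -> evalp (s t.1.1 t.1.2 t.2) x = evalp 'X_[mall N] x * f x].
  move=> [[i v] J] /=; apply: poly_to_fun (ss i v J) _.
  by rewrite subnK ?addn1 //; apply: leqW.
have /choice[h hP] : forall t : ind * ind * {set 'I_m}, exists f : pt -> K,
    [/\ regular_on (charts [:: t.1.1; t.1.2]) f,
    forall (l : K) x, l != 0 -> charts [:: t.1.1; t.1.2] x -> l ^+ #|t.2| * f (l *: x) = l ^+ 0 * f x &
    forall x, torus x -> evalp (H t.1.1 t.1.2 t.2) x = evalp 'X_[mall N] x * f x].
  move=> [[i j] J] /=; apply: poly_to_fun (sH i j J) _.
  by rewrite subnK ?addn0.
exists (fun i v x => [ffun J : {set 'I_m} => S (i, v, J) x]); split.
- move=> i v J; case: (SP (i, v, J)) => Sr _ _.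
  by apply: reg_eq Sr => x _; rewrite ffunE.
- move=> i v l x l0 Ix; apply/ffunP => J; rewrite lamZE !ffunE.
  by case: (SP (i, v, J)) => _ -> //; rewrite expr1.
move=> i j x Ix; exists [ffun J : {set 'I_m} => h (i, j, J) x] => v.
have z := zopen_charts R [:: i; j].
pose hh y : Lam := [ffun J : {set 'I_m} => h (i, j, J) y].
have hr : regL (charts [:: i; j]) hh.
  move=> J; case: (hP (i, j, J)) => hr _ _.
  by apply: reg_eq hr => y' _; rewrite ffunE.
apply/ffunP => J.
pose F y := S (j, v, J) y - S (i, v, J) y + wedge (hh y) (eul y v) J + c * exc i j v y J.
have FE : (([ffun J : {set 'I_m} => S (j, v, J) x] - [ffun J : {set 'I_m} => S (i, v, J) x] +
   wedge [ffun J : {set 'I_m} => h (i, j, J) x] (eul x v) + c *: exc i j v x) : Lam) J = F x.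
  by rewrite 2!lamDE lamZE; congr (_ + _ + _); rewrite !ffunE.
rewrite FE.
have Yr : regular_on (charts [:: i; j]) (fun y => Y i j v y J).
  by case: (Yvf i j v) => Yr _ _; exact: Yr.
have Fr : regular_on (charts [:: i; j]) F.
  apply: regD; first apply: regD.
  - apply: regB => //.
      case: (SP (j, v, J)) => Sr _ _; apply: reg_sub Sr => // y' Iy r; rewrite inE => /eqP ->.
      by apply: Iy; rewrite !inE eqxx orbT.
    case: (SP (i, v, J)) => Sr _ _; apply: reg_sub Sr => // y' Iy r; rewrite inE => /eqP ->.
    by apply: Iy; rewrite !inE eqxx.
  - exact: (regL_wedge z hr (regL_eul v z)).
  - case: evf => [evf|->]; last first.
      by apply: reg_eq (reg_cst z 0) => y' _; rewrite mul0r.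
    by apply: regZ => //; case: (evf i j v) => er _ _; exact: er.
apply: (regular_torus Yr Fr) Ix => y' Ty.
have X0 : evalp ('X_[mall N] : poly) y' != 0 by apply: evalp_mon_neq0 => r _; exact: Ty.
apply: (mulfI X0); rewrite -yE //.
have := congr1 (fun q => evalp q y') (E i j v J).
rewrite /= evalpB evalpD evalpB evalp_emul ytE //.
case: (SP (j, v, J)) => _ _ /(_ y' Ty) /= ->; case: (SP (i, v, J)) => _ _ /(_ y' Ty) /= ->.
have -> : [ffun L : {set 'I_m} => evalp (H i j L) y'] = evalp 'X_[mall N] y' *: hh y'.
  by apply/ffunP => L; rewrite lamZE !ffunE; case: (hP (i, j, L)) => _ _ /(_ y' Ty).
rewrite wedgeZl lamZE /F => /eqP; rewrite subr_eq => /eqP ->.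
by rewrite !mulrDr mulrN.
Qed.

Lemma prj_exc b i j v x : odd m -> prj (b (+) odd_var v) (exc i j v x) = if b then exc i j v x else 0.
Proof.
move=> om; have T : par true (top : Lam) by exact: par_top.
case: v => [l|k] /=; last by rewrite prj_0 ?if_same //; exact: par0.
rewrite addbF; have P : par true ((eps i j l / (x 0 i * x 0 j)) *: top : Lam) by exact: parZ.
by case: b; [rewrite prj_id|rewrite prj_0].
Qed.

Lemma unsolved_zero N (G : ind -> ind -> ind -> {set 'I_m} -> poly) i j k : n = 2%N -> (0 < N)%N ->
  (forall i j k J, poles N [:: i; j; k] (n.+1 * N - #|J|) (G i j k J)) ->
  ~~ uniq [:: i; j; k] -> forall J, (G i j k J)@_(mall N.-1) = 0.
Proof.
move=> n2 N0 sG nu J; apply/eqP/negPn/negP => /sG[_ MN].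
have [r rI] : exists r, r \notin [:: i; j; k].
  apply: contrapT => H; case/negP: nu; apply/card_uniqP.
  have E : [:: i; j; k] =i predT.
    by move=> r; apply/idP; apply: contrapT => /negP rI; apply: H; exists r.
  by rewrite (eq_card E) card_ord [size _]/= n2.
by have := MN r rI; rewrite monE; lia.
Qed.

Lemma exc_numerator N yt Gt i j k : n = 2%N -> (0 < N)%N -> numerators N exc yt Gt ->
  Gt i j k [set: 'I_m]%SET = eps i j k *: 'X_[mall N.-1].
Proof.
move=> n2 N0 [_ _ yG yE]; apply: poly_torus => x Tx.
have := congr1 (fun q => evalp q x) (yG i j k (inl ord0) [set: 'I_m]%SET).
rewrite /= evalpB evalpD evalpM evalpXU !yE // -mulrDr -mulrBr.
rewrite (exc_cocycle_top ord0 n2 (torus_charts (I := [:: i; j; k]) Tx)).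
have X0 : x 0 ord0 != 0 by exact: Tx.
rewrite mulrCA => /(mulfI X0) <-; rewrite evalpZ !evalp_mon !prodrXl -[in LHS](prednK N0) exprS /=.
have P0 : \prod_r x 0 r != 0 by apply/prodf_neq0 => r _; exact: Tx.
by field.
Qed.

(** The only Laurent monomial on which a cocycle can be obstructed is
    (x_0 x_1 x_2)^(-1) theta_1 theta_2 theta_3; the coefficient there gives c. *)
Theorem std_cover a (Y : ind -> ind -> vf) : (2 <= n)%N ->
  (forall i j, vf_on a (charts [:: i; j]) (Y i j)) -> euler_cocycle Y ->
  exists S c, [/\ c != 0 -> [/\ n = 2%N, m = 3%N & a],
    forall i, vf_on a (charts [:: i]) (S i) &
    forall i j x, charts [:: i; j] x -> exists h, forall v,
      Y i j v x = S j v x - S i v x + wedge h (eul x v) + c *: exc i j v x].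
Proof.
move=> n2 Yvf Yc.
suff [S [c [c0 Sr Sh YS]]] : exists (S : ind -> vf) c,
  [/\ c != 0 -> n = 2%N /\ m = 3%N,
    forall i v, regL (charts [:: i]) (S i v),
    forall i v (l : K) x, l != 0 -> charts [:: i] x -> sc l (S i v (l *: x)) = l *: S i v x &
    forall i j x, charts [:: i; j] x -> exists h, forall v,
      Y i j v x = S j v x - S i v x + wedge h (eul x v) + c *: exc i j v x].
  exists (fun i v x => prj (a (+) odd_var v) (S i v x)), (if a then c else 0); split.
  - case: a {Yvf} => c_neq0; last by rewrite eqxx in c_neq0.
    by have [] := c0 c_neq0.
  - move=> i v; have z := zopen_charts R [:: i]; split.
    + exact: regL_prj.
    + move=> l x l0 Ix; rewrite sc_prj Sh //.
      by apply/ffunP => J; rewrite !(lamZE, ffunE); case: ifP; rewrite ?mulr0.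
    + by move=> x _; exact: par_prj.
  - move=> i j x Ix; have [h E] := YS i j x Ix; exists (prj a h) => v.
    have := congr1 (prj (a (+) odd_var v)) (E v).
    rewrite prj_id; last by case: (Yvf i j v) => _ _; apply.
    move=> ->; rewrite 2!prjD prjB (prj_wedge a h (@par_eul R n m x v)); congr (_ + _).
    have [->|/c0[_ m3]] := eqVneq c 0.
      by rewrite !scale0r if_same scale0r prj_0 //; exact: par0.
    rewrite -[_ *: _]addr0 prjP prj_exc ?m3 // [prj _ 0]prj_0 ?addr0; last exact: par0.
    by case: (a); rewrite ?scale0r ?lamZ0.
have [N0 HN0] := numeratorsP Yvf Yc.
have [[n2e m3]|nm] := EM (n = 2%N /\ m = 3%N); last first.
  pose N := maxn N0 m; have [y [G num]] := HN0 N (leq_maxl _ _).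
  have mN : (m <= n.+1 * N)%N by rewrite (leq_trans (leq_maxr N0 m)) // leq_pmull.
  case: (num) => sy sG yG yE.
  have [i j k J M MN|s [H [ss sH E]]] := unobstructed mN n2 sy sG yG.
    apply/eqP/negPn/negP => GM; apply: nm.
    by have [] := obstruction mN n2 sy sG yG erefl MN GM.
  have [|||S [S1 S2 S3]] := @solution_of_numerators N Y y G 0 (fun _ _ _ _ => 0) s H a a Yvf _ mN num _ ss sH.
  - by right.
  - by move=> i j v J x _; rewrite scale0r evalp0 mul0r mulr0.
  - by move=> i j v J; rewrite scale0r subr0; exact: E.
  by exists S, 0; split => //; rewrite eqxx.
have ec : euler_cocycle exc.
  move=> i j k x Ix; exists ((eps i j k / \prod_r x 0 r) *: top) => v.
  exact: exc_cocycle.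
have [N1 HN1] := numeratorsP (fun i j => exc_vf i j m3) ec.
pose N := (maxn (maxn N0 N1) m).+1.
have [|y [G num]] := HN0 N; first by rewrite /N; lia.
have [|yt [Gt numt]] := HN1 N; first by rewrite /N; lia.
have mN : (m <= n.+1 * N)%N by rewrite /N; nia.
have Npos : (0 < N)%N by [].
case: (num) (numt) => sy sG yG yE [syt sGt yGt yEt].
pose u i j k := (G i j k [set: 'I_m]%SET)@_(mall N.-1).
have u0 i j k : ~~ uniq [:: i; j; k] -> u i j k = 0.
  by move=> nu; exact: (unsolved_zero n2e Npos sG nu).
have uc i j k l : u j k l - u i k l + u i j l - u i j k = 0.
  by rewrite /u -!(mcoeffB, mcoeffD) (G_cocycle yG) mcoeff0.
have rep12 i j : u i i j = 0 by rewrite u0 //= inE eqxx.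
have rep13 i j : u i j i = 0 by rewrite u0 //= !inE eqxx orbT.
have rep23 i j : u i j j = 0 by rewrite u0 //= !inE eqxx !andbF.
have s12 i j k : u j i k = - u i j k.
  by have := uc i j i k; rewrite rep12 rep13 !subr0 => /eqP; rewrite addr_eq0 => /eqP.
have s23 i j k : u i k j = - u i j k.
  have := uc i j k j; rewrite rep13 rep23 add0r addr0 => /eqP.
  by rewrite subr_eq0 => /eqP <-; rewrite opprK.
have U : uniq [:: inord 0; inord 1; inord 2 : ind].
  by rewrite /= !inE -!val_eqE /= !inordK ?n2e.
pose c := eps (inord 0) (inord 1) (inord 2) * u (inord 0) (inord 1) (inord 2).
have uE i j k : u i j k = eps i j k * c := antisym3 n2e u0 s12 s23 U i j k.
pose y' i j v J := y i j v J - c *: yt i j v J.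
pose G' i j k J := G i j k J - c *: Gt i j k J.
have sy' i j v J : poles N [:: i; j] ((n.+1 * N).+1 - #|J|) (y' i j v J).
  by apply: polesB => //; apply: polesZ.
have sG' i j k J : poles N [:: i; j; k] (n.+1 * N - #|J|) (G' i j k J).
  by apply: polesB => //; apply: polesZ.
have yG' i j k v J : y' i j v J + y' j k v J - y' i k v J = emul v (G' i j k) J.
  have -> : emul v (G' i j k) J = - c *: emul v (Gt i j k) J + emul v (G i j k) J.
    rewrite -(emulP v (Gt i j k) (G i j k) (- c) J); rewrite /G'; case: v => [l|t] /=.
      by rewrite scaleNr addrC.
    by case tJ : (t \in J) => //; rewrite scaleNr addrC.
  by rewrite -yG -yGt /y' scaleNr !scalerBr !scalerDr; ring.
have [i j k J M MN|s [H [ss sH E]]] := unobstructed mN n2 sy' sG' yG'.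
  apply/eqP/negPn/negP => GM.
  have [_ _ JT MN1] := obstruction mN n2 sy' sG' yG' erefl MN GM.
  move/eqP: GM; apply; have -> : M = mall N.-1.
    by apply/mnmP => r; rewrite MN1 monE.
  rewrite JT /G' mcoeffB mcoeffZ (exc_numerator i j k n2e Npos numt) mcoeffZ mcoeffX eqxx mulr1.
  by rewrite -/(u i j k) uE mulrC subrr.
have [||S [S1 S2 S3]] := @solution_of_numerators N Y y G c yt s H a true Yvf _ mN num _ ss sH E.
- by left => i j; exact: exc_vf.
- by move=> i j v J x Tx; rewrite evalpZ yEt // mulrCA.
by exists S, c; split.
Qed.

Lemma telescope (c s t0 t1 t2 e1 e2 e3 h1 h2 h3 : K) :
  c * e1 = t1 - t0 + s * h1 -> c * e2 = t2 - t1 + s * h2 ->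
  c * e3 = t2 - t0 + s * h3 -> s * (h1 + h2 - h3) = c * (e1 + e2 - e3).
Proof. by move=> H1 H2 H3; rewrite [RHS]mulrBr [in RHS]mulrDr H1 H2 H3; ring. Qed.

Lemma lamBE (f g : Lam) J : (f - g) J = f J - g J.
Proof. by rewrite !ffunE. Qed.

Lemma sc_lincomb (l c : K) (f f' g g' k k' : Lam) :
  sc l f' = l *: f -> sc l g' = l *: g -> sc l k' = l *: k ->
  sc l (c *: f' - (g' - k')) = l *: (c *: f - (g - k)).
Proof.
move=> Hf Hg Hk; apply/ffunP => J; rewrite ffunE !(lamBE, lamZE).
have E (p p' : Lam) : sc l p' = l *: p -> l ^+ #|J| * p' J = l * p J.
  by move/(congr1 (fun f : Lam => f J)); rewrite ffunE lamZE.
by rewrite !mulrBr mulrCA (E _ _ Hf) (E _ _ Hg) (E _ _ Hk) mulrCA.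
Qed.

(** A trivialisation would express the coefficient of the cocycle at
    (x_0 x_1 x_2)^(-1) as a sum of coefficients of functions with poles along
    only two of the three coordinates. *)
Theorem exc_nontrivial (T : ind -> vf) (c : K) : n = 2%N -> m = 3%N ->
  (forall i, vf_on true (charts [:: i]) (T i)) ->
  (forall i j x, charts [:: i; j] x -> exists h, forall v,
     c *: exc i j v x = T j v x - T i v x + wedge h (eul x v)) -> c = 0.
Proof.
move=> n2 m3 Tvf HT.
pose h i j x : Lam := (x 0 i)^-1 *: (c *: exc i j (inl i) x - (T j (inl i) x - T i (inl i) x)).
have hE i j x v : charts [:: i; j] x ->
    c *: exc i j v x = T j v x - T i v x + wedge (h i j x) (eul x v).
  move=> Ix; have [g Hg] := HT i j x Ix.
  have xi : x 0 i != 0 by apply: Ix; rewrite inE eqxx.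
  have -> : h i j x = g; last exact: Hg.
  by rewrite /h Hg [_ + wedge _ _]addrC addrK wedge_eul_inl scalerA mulVf // scale1r.
have hr i j J : regular_on (charts [:: i; j]) (fun x => h i j x J).
  have z := zopen_charts R [:: i; j].
  have Tr k : k \in [:: i; j] -> regL (charts [:: i; j]) (T k (inl i)).
    move=> kI; case: (Tvf k (inl i)) => Tr _ _; apply: regL_sub Tr => // x Ix r.
    by rewrite inE => /eqP ->; exact: Ix.
  have er : regL (charts [:: i; j]) (exc i j (inl i)) by case: (exc_vf i j m3 (inl i)).
  apply: (regL_scale _ _ J); first by apply: reg_coordV => // x Ix; apply: Ix; rewrite inE eqxx.
  apply: (@regL_eq _ _ _ _ (fun x => (-1) *: T j (inl i) x + (c *: exc i j (inl i) x + T i (inl i) x))).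
    by move=> x _; rewrite scaleN1r opprB addrCA [- _ + _]addrC.
  apply: regL_P => //; first by apply: Tr; rewrite !inE eqxx orbT.
  by apply: regL_P => //; apply: Tr; rewrite !inE eqxx.
have hh i j J (l : K) x : l != 0 -> charts [:: i; j] x ->
    l ^+ #|J : {set 'I_m}| * h i j (l *: x) J = l ^+ 0 * h i j x J.
  move=> l0 Ix; rewrite expr0 mul1r.
  suff E : sc l (h i j (l *: x)) = h i j x by rewrite -[in RHS]E [RHS]ffunE.
  have Th k : k \in [:: i; j] -> sc l (T k (inl i) (l *: x)) = l *: T k (inl i) x.
    move=> kI; case: (Tvf k (inl i)) => _ H _; apply: H => // r.
    by rewrite inE => /eqP ->; exact: Ix.
  have eh : sc l (exc i j (inl i) (l *: x)) = l *: exc i j (inl i) x.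
    by case: (exc_vf i j m3 (inl i)) => _ H _; exact: H.
  have xi : x 0 i != 0 by apply: Ix; rewrite inE eqxx.
  have Tj := Th j _; have Ti := Th i _; rewrite !inE !eqxx ?orbT in Tj Ti.
  have e : (l * x 0 i)^-1 * l = (x 0 i)^-1 by rewrite invfM mulrAC (mulVf l0) mul1r.
  by rewrite /h scZ (sc_lincomb c eh (Tj isT) (Ti isT)) scalerA mxE e.
have /choice[N0 HN0] (t : ind * ind) := fun_to_poly (hr t.1 t.2 [set: 'I_m]%SET) (hh t.1 t.2 [set: 'I_m]%SET).
pose N := (\max_t N0 t).+1.
have /choice[p Hp] : forall t : ind * ind, exists p : poly, poles N [:: t.1; t.2] (n.+1 * N + 0 - #|[set: 'I_m]%SET|) p /\
    forall x, torus x -> evalp p x = evalp 'X_[mall N] x * h t.1 t.2 x [set: 'I_m]%SET.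
  by move=> t; apply: HN0; apply: leqW; exact: (@leq_bigmax _ N0).
pose o (t : nat) : ind := inord t.
have ov (t : nat) : (t < 3)%N -> o t = t :> nat by move=> t3; rewrite inordK ?n2.
have U : uniq [:: o 0%N; o 1%N; o 2%N] by rewrite /= !inE -!val_eqE /= !ov.
have key : (c * eps (o 0%N) (o 1%N) (o 2%N)) *: 'X_[mall N.-1] =
    p (o 0%N, o 1%N) + p (o 1%N, o 2%N) - p (o 0%N, o 2%N).
  apply: poly_torus => x Tx.
  have pE i j : evalp (p (i, j)) x = evalp 'X_[mall N] x * h i j x [set: 'I_m]%SET.
    exact: (Hp (i, j)).2.
  rewrite evalpB evalpD !pE -mulrDr -mulrBr.
  have X0 : x 0 ord0 != 0 by exact: Tx.
  have P0 : \prod_r x 0 r != 0 by apply/prodf_neq0 => r _; exact: Tx.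
  have E i j : c * exc i j (inl ord0) x [set: 'I_m]%SET =
      T j (inl ord0) x [set: 'I_m]%SET - T i (inl ord0) x [set: 'I_m]%SET +
      x 0 ord0 * h i j x [set: 'I_m]%SET.
    rewrite -lamZE (hE i j x (inl ord0) (torus_charts Tx)) wedge_eul_inl.
    by rewrite lamDE lamBE lamZE.
  have H : h (o 0%N) (o 1%N) x [set: 'I_m]%SET + h (o 1%N) (o 2%N) x [set: 'I_m]%SET -
      h (o 0%N) (o 2%N) x [set: 'I_m]%SET = c * (eps (o 0%N) (o 1%N) (o 2%N) / \prod_r x 0 r).
    apply: (mulfI X0); rewrite [RHS]mulrCA.
    rewrite -(exc_cocycle_top ord0 n2 (torus_charts (I := [:: o 0%N; o 1%N; o 2%N]) Tx)).
    exact: telescope (E _ _) (E _ _) (E _ _).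
  rewrite H evalpZ !evalp_mon !prodrXl exprS /=.
  by field.
have pz i j : (p (i, j))@_(mall N.-1) = 0.
  apply/eqP/negPn/negP => /(Hp (i, j)).1[_ MN].
  have [r rI] := third_index i j (eq_leq (esym n2)).
  by have := MN r rI; rewrite monE /= ltnn.
have := congr1 (mcoeff (mall N.-1)) key.
rewrite mcoeffZ mcoeffX eqxx mulr1 mcoeffB mcoeffD !pz addr0 subr0.
move/eqP; rewrite mulf_eq0 => /orP[/eqP //|/eqP e0].
by have := eps_sqr U; rewrite e0 mul0r => /esym/eqP; rewrite oner_eq0.
Qed.
End StandardCover.

(** * Vector fields modulo Euler's *)

Section CoefficientsOfDerivations.
Variables (R : realType) (n m : nat).
Local Notation K := R[i].
Local Notation pt := 'rV[K]_n.+1.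
Local Notation ind := 'I_n.+1.
Local Notation Lam := (grassmann K m).
Local Notation var := (ind + 'I_m)%type.
Local Notation vf := (var -> pt -> Lam).
Implicit Types (i j k l : ind) (x : pt) (v : var) (J : {set 'I_m}) (a : bool).
Implicit Types (U V W : set pt) (Th : vf) (T : var -> Lam) (D : sheaf_op R n m).
Hint Resolve zproj pinv : core.

(** Equality of tangent vectors modulo Euler's. *)
Definition eqeul x T T' := exists g : Lam, forall v, T v = T' v + wedge g (eul x v).

Lemma eqeul_eq x T T' : (forall v, T v = T' v) -> eqeul x T T'.
Proof. by move=> E; exists 0 => v; rewrite wedge0l addr0. Qed.

Lemma eqeul_D x T T' S S' : eqeul x T T' -> eqeul x S S' ->
  eqeul x (fun v => T v + S v) (fun v => T' v + S' v).
Proof.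
by move=> [g Hg] [h Hh]; exists (g + h) => v; rewrite Hg Hh wedgeDl addrACA.
Qed.

Lemma eqeul_B x T T' S S' : eqeul x T T' -> eqeul x S S' ->
  eqeul x (fun v => T v - S v) (fun v => T' v - S' v).
Proof.
by move=> [g Hg] [h Hh]; exists (g - h) => v; rewrite Hg Hh wedgeBl opprD addrACA.
Qed.

Lemma eqeul_Z x c T T' : eqeul x T T' -> eqeul x (fun v => c *: T v) (fun v => c *: T' v).
Proof.
by move=> [g Hg]; exists (c *: g) => v; rewrite Hg wedgeZl scalerDr.
Qed.

Lemma eqeul_sym x T T' : eqeul x T T' -> eqeul x T' T.
Proof.
by move=> [g Hg]; exists (- g) => v; rewrite Hg wedgeNl addrK.
Qed.

Lemma eqeul_trans x T T' T'' : eqeul x T T' -> eqeul x T' T'' -> eqeul x T T''.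
Proof.
move=> [g Hg] [h Hh]; exists (g + h) => v.
by rewrite Hg Hh wedgeDl [wedge g _ + _]addrC addrA.
Qed.

Lemma nrm_eqeul i x T : eqeul x (nrm i x T) T.
Proof. by exists (- ((x 0 i)^-1 *: T (inl i))) => v; rewrite wedgeNl wedgeZl. Qed.

Lemma nrm_B i x T S v : nrm i x (fun v => T v - S v) v = nrm i x T v - nrm i x S v.
Proof. by rewrite /nrm wedgeBl scalerBr !opprD opprK addrACA. Qed.

(** Euler's field annihilates the functions of degree 0. *)
Lemma Dop_ext U Th Th' : (forall x, U x -> eqeul x (Th^~ x) (Th'^~ x)) -> Dop U Th = Dop U Th'.
Proof.
move=> E; apply/funext => V; apply/funext => f; apply/funext => x.
have [[pV VU fV Vx]|H] := EM [/\ proj_open V, V `<=` U, struct_sheaf V f & V x]; last first.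
  by rewrite !Dop0.
rewrite (DopE _ pV VU fV Vx) (DopE _ pV VU fV Vx).
have [g Hg] := E x (VU _ Vx).
have -> : app (Th^~ x) f x = app (fun v => 1 *: wedge g (eul x v) + Th' v x) f x.
  by congr (app _ f x); apply/funext => v; rewrite Hg scale1r addrC.
rewrite appP app_wedge (app_eul (pinv pV) (struct_reg fV)) ?wedge0r ?lamZ0 ?add0r //.
by move=> l y l0 _; exact: (struct_sc _ fV l0).
Qed.

Lemma Dop_P U c Th Th' : Dop U (fun v x => c *: Th v x + Th' v x) = c *: Dop U Th + Dop U Th'.
Proof.
apply/funext => V; apply/funext => f; apply/funext => x.
transitivity (c *: Dop U Th V f x + Dop U Th' V f x); last by [].
have [[pV VU fV Vx]|H] := EM [/\ proj_open V, V `<=` U, struct_sheaf V f & V x]; last first.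
  by rewrite !(Dop0 _ H) lamZ0 addr0.
by rewrite !(DopE _ pV VU fV Vx) appP.
Qed.

Lemma Dop_B U Th Th' : Dop U (fun v x => Th v x - Th' v x) = Dop U Th - Dop U Th'.
Proof.
rewrite [RHS]addrC -scaleN1r -Dop_P; apply: Dop_ext => x _; apply: eqeul_eq => v.
by rewrite scaleN1r addrC.
Qed.

Lemma res_res W V D : W `<=` V -> res_tangent W (res_tangent V D) = res_tangent W D.
Proof.
move=> WV; apply/funext => A; have [AW|nAW] := EM (A `<=` W).
  by rewrite !(res_tangentT _ AW) (res_tangentT _ (subset_trans AW WV)).
by rewrite !(res_tangentN _ nAW).
Qed.

Lemma res_P W c D D' : res_tangent W (c *: D + D') = c *: res_tangent W D + res_tangent W D'.
Proof.
apply/funext => A.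
transitivity (c *: res_tangent W D A + res_tangent W D' A); last by [].
have [AW|nAW] := EM (A `<=` W); first by rewrite !(res_tangentT _ AW).
by rewrite !(res_tangentN _ nAW) scaler0 addr0.
Qed.

Lemma res_in a U W D : tangent_sheaf a U D -> W `<=` U -> tangent_sheaf a W (res_tangent W D).
Proof.
move=> [DT D0] WU; split => [V pV VW|V f H].
  have [E1 E2 E3 E4 E5] := DT V pV (subset_trans VW WU).
  rewrite (res_tangentT _ VW); split => // V' f pV' V'V fV.
  by rewrite (res_tangentT _ (subset_trans V'V VW)); exact: E5.
have [VW|nVW] := EM (V `<=` W); last by rewrite (res_tangentN _ nVW).
rewrite (res_tangentT _ VW); apply: D0 => -[pV _ fV]; exact: H.
Qed.

Lemma Dop_res U W Th : W `<=` U -> res_tangent W (Dop U Th) = Dop W Th.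
Proof.
move=> WU; apply/funext => V; apply/funext => f; apply/funext => x.
have [VW|nVW] := EM (V `<=` W); last first.
  by rewrite (res_tangentN _ nVW) Dop0 // => -[_ ].
rewrite (res_tangentT _ VW).
have [[pV _ fV Vx]|H] := EM [/\ proj_open V, V `<=` W, struct_sheaf V f & V x].
  by rewrite (DopE _ pV VW fV Vx) (DopE _ pV (subset_trans VW WU) fV Vx).
by rewrite (Dop0 _ H) Dop0 // => -[pV _ fV Vx]; exact: H.
Qed.

(** The coefficients of D at the points of the i-th chart. *)
Definition coef i U D : vf := cval i (U `&` chart i) (res_tangent (U `&` chart i) D).

Lemma cval_coef a i U W D v x : tangent_sheaf a U D -> proj_open U -> proj_open W ->
  W `<=` U -> W `<=` chart i -> W x ->
  cval i W (res_tangent W D) v x = coef i U D v x.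
Proof.
move=> DT pU pW WU Wi Wx; pose U' := U `&` chart i.
have pU' : proj_open U' by apply: proj_openI => //; exact: proj_open_chart.
have WU' : W `<=` U' by move=> y Wy; split; [exact: WU|exact: Wi].
have U'U : U' `<=` U by move=> y [].
have U'i : U' `<=` chart i by move=> y [].
rewrite -(res_res D WU') /coef -/U'.
exact: (cval_res v (res_in DT U'U) pU' U'i pW WU' Wx).
Qed.

Lemma coef_res a i U W D v x : tangent_sheaf a U D -> proj_open U -> proj_open W ->
  W `<=` U -> W x -> chart i x -> coef i W (res_tangent W D) v x = coef i U D v x.
Proof.
move=> DT pU pW WU Wx ix; have pWi := proj_openI pW (proj_open_chart R i).
rewrite /coef res_res; last by move=> y [].
by apply: (cval_coef v DT pU pWi) => // y [] // /WU.
Qed.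

Lemma coef_P i U c D D' v x :
  coef i U (c *: D + D') v x = c *: coef i U D v x + coef i U D' v x.
Proof.
rewrite /coef res_P /cval.
set A := res_tangent _ D; set B := res_tangent _ D'; set f := coord _ _ _.
transitivity (x 0 i *: (c *: A (U `&` chart i) f x + B (U `&` chart i) f x)); first by [].
by rewrite scalerDr !scalerA [_ * c]mulrC.
Qed.

Lemma coef_D i U D D' v x : coef i U (D + D') v x = coef i U D v x + coef i U D' v x.
Proof. by rewrite -[D]scale1r coef_P !scale1r. Qed.

Lemma coef_B i U D D' v x : coef i U (D - D') v x = coef i U D v x - coef i U D' v x.
Proof. by rewrite addrC -scaleN1r coef_P scaleN1r addrC. Qed.

Lemma coef_Z i U c D v x : coef i U (c *: D) v x = c *: coef i U D v x.
Proof.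
have -> : c *: D = (c - 1) *: D + D by rewrite scalerBl scale1r subrK.
by rewrite coef_P scalerBl scale1r subrK.
Qed.

Lemma coef_Dop i U Th v x : proj_open U -> U x -> chart i x ->
  coef i U (Dop U Th) v x = nrm i x (Th^~ x) v.
Proof.
move=> pU Ux ix; rewrite /coef Dop_res; last by move=> y [].
apply: cval_Dop => //; last by apply: proj_openI => //; exact: proj_open_chart.
Qed.

Lemma coef_vf a i U D : tangent_sheaf a U D -> proj_open U -> vf_on a (U `&` chart i) (coef i U D).
Proof.
move=> DT pU; have sub : U `&` chart i `<=` U by move=> y [].
apply: (cval_vf (res_in DT sub)); first by apply: proj_openI => //; exact: proj_open_chart.
by move=> y [].
Qed.

Lemma res_coef a i U W D : tangent_sheaf a U D -> proj_open U -> proj_open W ->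
  W `<=` U -> W `<=` chart i -> res_tangent W D = Dop W (coef i U D).
Proof.
move=> DT pU pW WU Wi; rewrite {1}(tangent_repr (res_in DT WU) pW Wi).
apply: Dop_ext => x Wx; apply: eqeul_eq => v.
exact: (cval_coef v DT pU pW WU Wi Wx).
Qed.

Lemma coef_nrm a i j U D x : tangent_sheaf a U D -> proj_open U -> U x -> chart i x -> chart j x ->
  nrm i x ((coef j U D)^~ x) =1 (coef i U D)^~ x.
Proof.
move=> DT pU Ux ix jx v; pose W := U `&` (chart i `&` chart j).
have pW : proj_open W by apply: proj_openI => //; apply: proj_openI; exact: proj_open_chart.
have Wx : W x by [].
have WU : W `<=` U by move=> y [].
have Wi : W `<=` chart i by move=> y [_ []].
have Wj : W `<=` chart j by move=> y [_ []].
rewrite -(cval_coef v DT pU pW WU Wi Wx) (res_coef DT pU pW WU Wj).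
by rewrite (cval_Dop _ _ pW Wi Wx).
Qed.

Lemma vf_sub a U W Th : zariski_open W -> W `<=` U -> vf_on a U Th -> vf_on a W Th.
Proof.
move=> zW WU TU v; have [T1 T2 T3] := TU v; split.
- exact: regL_sub T1.
- by move=> l x l0 /WU; exact: T2.
- by move=> x /WU; exact: T3.
Qed.

Lemma vf_P a U c Th Th' : zariski_open U -> vf_on a U Th -> vf_on a U Th' ->
  vf_on a U (fun v x => c *: Th v x + Th' v x).
Proof.
move=> zU TU TU' v; have [T1 T2 T3] := TU v; have [S1 S2 S3] := TU' v; split.
- exact: regL_P.
- by move=> l x l0 Ux; rewrite scP T2 // S2 // scalerDr !scalerA mulrC.
- by move=> x Ux; apply: parP; [exact: T3|exact: S3].
Qed.

Lemma vf_B a U Th Th' : zariski_open U -> vf_on a U Th -> vf_on a U Th' ->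
  vf_on a U (fun v x => Th v x - Th' v x).
Proof.
move=> zU TU TU'; have := vf_P (-1) zU TU' TU.
congr (vf_on a U _); apply/funext => v; apply/funext => x.
by rewrite scaleN1r addrC.
Qed.

Lemma vf_local a U Th : (forall x, U x -> exists V Th',
    [/\ proj_open V, V x, V `<=` U, vf_on a V Th' & forall v y, V y -> Th v y = Th' v y]) ->
  vf_on a U Th.
Proof.
move=> H v; split.
- move=> J; apply: reg_local => x /H[V [Th' [pV Vx VU TV E]]].
  exists V, (fun y => Th' v y J); split => //; first exact: zproj.
    by case: (TV v) => Tr _ _; exact: Tr.
  by move=> y Vy; rewrite (E v y Vy).
- move=> l x l0 /H[V [Th' [pV Vx VU TV E]]].
  rewrite (E _ _ Vx) (E _ _ (pinv pV l0 Vx)).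
  by case: (TV v) => _ T2 _; exact: T2.
- move=> x /H[V [Th' [pV Vx VU TV E]]]; rewrite (E _ _ Vx).
  by case: (TV v) => _ _; exact.
Qed.

Lemma vf_nrm a i U Th : zariski_open U -> U `<=` chart i -> vf_on a U Th ->
  vf_on a U (fun v x => nrm i x (Th^~ x) v).
Proof.
move=> zU Ui TU; apply: vf_B => // v; have [T1 T2 T3] := TU (inl i); split.
- apply: regL_scale; first exact: reg_coordV.
  by apply: regL_wedge => //; exact: regL_eul.
- move=> l x l0 Ux; rewrite scZ sc_wedge T2 // sc_eul wedgeZl wedgeZr !scalerA mxE.
  have e : (l * x 0 i)^-1 * l = (x 0 i)^-1 by rewrite invfM mulrAC (mulVf l0) mul1r.
  by rewrite e mulrC.
- move=> x Ux; apply: parZ; apply: par_wedge; last exact: par_eul.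
  by have := T3 x Ux; rewrite addbF.
Qed.

End CoefficientsOfDerivations.

(** * The normal form of a cocycle *)

Lemma zmod_shift (V : zmodType) (p q r s t e g : V) :
  e + (s - t) = q - r + g -> p - q = p - s - (r - t) - e + g.
Proof.
move=> H; have -> : g = e + (s - t) - (q - r) by rewrite H [_ + g]addrC addrK.
rewrite -[e + (s - t) - _]addrA [RHS]addrA subrK !opprB addrACA !subrKA //.
Qed.

Lemma zmod_exchange (V : zmodType) (p q r s : V) : p - q = r - s -> q - s = p - r.
Proof.
by move=> /(canRL (subrK _)) ->; rewrite -[r - s + q]addrA [RHS]addrAC subrr add0r addrC.
Qed.

Section TangentCohomology.
Variables (R : realType) (n m : nat).
Local Notation K := R[i].
Local Notation pt := 'rV[K]_n.+1.
Local Notation ind := 'I_n.+1.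
Local Notation Lam := (grassmann K m).
Local Notation var := (ind + 'I_m)%type.
Local Notation vf := (var -> pt -> Lam).
Implicit Types (i j k l : ind) (x : pt) (v : var) (J : {set 'I_m}) (a : bool).
Local Notation cover := (@open_cover pt (@proj_open R n) (@cone R n)).
Local Notation T := (@tangent_sheaf R n m).
Local Notation res := (@res_tangent R n m).
Hint Resolve zproj pinv : core.

Lemma sc_entry (l : K) (f g : Lam) J : sc l f = l *: g -> l ^+ #|J| * f J = l * g J.
Proof. by move/(congr1 (fun h : Lam => h J)); rewrite ffunE lamZE. Qed.

Lemma cover_pt (U : cover) x : cone x -> exists al, U al x.
Proof.
move=> cx; have : (\bigcup_al U al) x by rewrite piece_cover.
by case=> al _ Ux; exists al.
Qed.

Lemma cover_choice (U : cover) : exists f : pt -> idx U, forall x, cone x -> U (f x) x.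
Proof.
have c1 : cone (const_mx 1 : pt).
  by apply/cone_chart; exists ord0; rewrite /chart /= mxE oner_neq0.
have [al0 _] := cover_pt U c1.
have /choice[f Hf] : forall x, exists al, cone x -> U al x.
  move=> x; have [/(cover_pt U)[al Ux]|nx] := EM (cone x); first by exists al.
  by exists al0.
by exists f.
Qed.

Lemma chart_cone i x : chart i x -> cone x.
Proof. by move=> ix; apply/cone_chart; exists i. Qed.

Lemma chartsE1 i : @charts R n [:: i] = chart i.
Proof.
apply/seteqP; split => x; first by apply; rewrite inE.
by move=> ix r; rewrite inE => /eqP ->.
Qed.

Lemma chartsE2 i j : @charts R n [:: i; j] = chart i `&` chart j.
Proof.
apply/seteqP; split => x; first by move=> H; split; apply: H; rewrite !inE eqxx ?orbT.
by move=> [ix jx] r; rewrite !inE => /orP[] /eqP ->.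
Qed.

Definition std_cov : cover.
Proof.
apply: (@OpenCover _ _ _ ind (@chart R n)) => [i|]; first exact: proj_open_chart.
apply/seteqP; split => x; first by move=> [i _ ix]; exact: chart_cone ix.
by move/cone_chart => [i ix]; exists i.
Defined.

Definition chart_refinement (U : cover) : cover.
Proof.
apply: (@OpenCover _ _ _ (idx U * ind)%type (fun t => U t.1 `&` chart t.2)) => [t|].
  by apply: proj_openI; [exact: piece_open|exact: proj_open_chart].
apply/seteqP; split => x; first by move=> [t _ [_ ix]]; exact: chart_cone ix.
move=> cx; have [al Ux] := cover_pt U cx; have /cone_chart[i ix] := cx.
by exists (al, i).
Defined.

Section Cocycle.
Variables (a : bool) (U : cover) (z : idx U -> idx U -> sheaf_op R n m).
Hypothesis zc : cocycle1 (T a) res z.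
Implicit Types (al be ga : idx U).

Let c i al be := coef i (U al `&` U be) (z al be).

Lemma pieceI al be : proj_open (U al `&` U be).
Proof. by apply: proj_openI; exact: piece_open. Qed.
Hint Resolve pieceI : core.

Lemma cocycle_in al be : T a (U al `&` U be) (z al be).
Proof. by case: zc. Qed.
Hint Resolve cocycle_in : core.

Lemma coef_cocycle i al be ga v x : U al x -> U be x -> U ga x -> chart i x ->
  c i al be v x + c i be ga v x = c i al ga v x.
Proof.
move=> Ua Ub Ug ix; set V := U al `&` U be `&` U ga.
have pV : proj_open V by apply: proj_openI => //; exact: piece_open.
have Vx : V x by [].
have := zc.2 al be ga; rewrite /= -/V => E.
have S1 : V `<=` U al `&` U be by move=> y [].
have S2 : V `<=` U be `&` U ga by move=> y [[]].
have S3 : V `<=` U al `&` U ga by move=> y [[]].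
rewrite /c -(coef_res v (cocycle_in al be) (pieceI _ _) pV S1 Vx ix).
rewrite -(coef_res v (cocycle_in be ga) (pieceI _ _) pV S2 Vx ix).
by rewrite -(coef_res v (cocycle_in al ga) (pieceI _ _) pV S3 Vx ix) -E coef_D.
Qed.

(** Each coefficient of z on the i-th chart is a cocycle of homogeneous
    functions for the traces of the U al, and the chart is acyclic; the
    projection corrects the parity of the solutions. *)
Lemma chart_trivialization : exists Psi : ind -> idx U -> vf,
  (forall i al, vf_on a (U al `&` chart i) (Psi i al)) /\
  forall i al be v x, U al x -> U be x -> chart i x ->
    c i al be v x = Psi i be v x - Psi i al v x.
Proof.
have /choice[psi Hpsi] : forall t : ind * var * {set 'I_m}, exists psi : idx U -> pt -> K,
  [/\ forall al, regular_on (U al `&` chart t.1.1) (psi al),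
    forall al (l : K) x, l != 0 -> (U al `&` chart t.1.1) x ->
      l ^+ #|t.2| * psi al (l *: x) = l ^+ 1 * psi al x &
    forall al be x, (U al `&` chart t.1.1) x -> (U be `&` chart t.1.1) x ->
      c t.1.1 al be t.1.2 x t.2 = psi be x - psi al x].
  move=> [[i v] J] /=.
  have p1 al : proj_open (U al `&` chart i).
    by apply: proj_openI; [exact: piece_open|exact: proj_open_chart].
  apply: (affine_acyclic (i := i) (phi := fun al be x => c i al be v x J) p1).
  - by move=> al x [].
  - by move=> x ix; have [al Ux] := cover_pt U (chart_cone ix); exists al.
  - move=> al be; have [cr _ _] := coef_vf i (cocycle_in al be) (pieceI al be) v.
    apply: reg_sub (cr J); last by move=> x [[Ua ix] [Ub _]].
    by apply: zproj; apply: proj_openI.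
  - move=> al be l x l0 [Ua ix] [Ub _].
    have [_ ch _] := coef_vf i (cocycle_in al be) (pieceI al be) v.
    rewrite expr1; exact: (sc_entry J (ch l x l0 (conj (conj Ua Ub) ix))).
  - by move=> al be ga x [Ua ix] [Ub _] [Ug _]; rewrite -(coef_cocycle v Ua Ub Ug ix) (lamDE (c i al be v x) (c i be ga v x)).
exists (fun i al v x => prj (a (+) odd_var v) [ffun J : {set 'I_m} => psi (i, v, J) al x]).
split=> [i al v|i al be v x Ua Ub ix].
  have z' : zariski_open (U al `&` chart i).
    by apply: zproj; apply: proj_openI; [exact: piece_open|exact: proj_open_chart].
  split.
  - apply: regL_prj => // J; case: (Hpsi (i, v, J)) => pr _ _.
    by apply: reg_eq (pr al) => x _; rewrite ffunE.
  - move=> l x l0 Ux; rewrite sc_prj; apply/ffunP => J; rewrite lamZE !ffunE.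
    case: ifP => _; last by rewrite mulr0.
    by case: (Hpsi (i, v, J)) => _ ph _; rewrite ph ?expr1.
  - by move=> x _; exact: par_prj.
rewrite -prjB -[LHS](@prj_id _ _ (a (+) odd_var v)); last first.
  by have [_ _] := coef_vf i (cocycle_in al be) (pieceI al be) v; apply.
congr (prj _ _); apply/ffunP => J; case: (Hpsi (i, v, J)) => _ _ pc.
by rewrite (pc al be x) // lamBE !ffunE.
Qed.

(** Comparing the trivialisations of z on the charts gives a cocycle of vector
    fields on the standard cover, modulo Euler's. *)
Theorem cocycle_normal_form : (2 <= n)%N -> exists (Phi : idx U -> ind -> vf) (b : K),
  [/\ b != 0 -> [/\ n = 2%N, m = 3%N & a],
    forall al i, vf_on a (U al `&` chart i) (Phi al i) &
    forall al be i j x, U al x -> U be x -> chart i x -> chart j x ->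
      eqeul x ((c j al be)^~ x) (fun v => Phi be j v x - Phi al i v x - b *: exc i j v x)].
Proof.
move=> n2; have [Psi [Pvf Pc]] := chart_trivialization.
have [p Hp] := cover_choice U.
pose Y i j : vf := fun v x => nrm i x (fun w => Psi j (p x) w x - Psi i (p x) w x) v.
have YE i j v x al : U al x -> chart i x -> chart j x ->
    Y i j v x = nrm i x (fun w => Psi j al w x - Psi i al w x) v.
  move=> Ux ix jx; have Upx := Hp x (chart_cone ix).
  rewrite /Y !nrm_B.
  have Hk k : chart k x -> nrm i x ((Psi k al)^~ x) v - nrm i x ((Psi k (p x))^~ x) v = c i (p x) al v x.
    move=> kx; rewrite -nrm_B.
    transitivity (nrm i x ((c k (p x) al)^~ x) v); last first.
      exact: (coef_nrm (cocycle_in (p x) al) (pieceI _ _) (conj Upx Ux) ix kx v).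
    congr (nrm i x _ v); apply/funext => w.
    by rewrite -(Pc k (p x) al w x Upx Ux kx).
  exact: zmod_exchange (etrans (Hk j jx) (esym (Hk i ix))).
have Yvf i j : vf_on a (charts [:: i; j]) (Y i j).
  apply: vf_local => x; rewrite chartsE2 => -[ix jx].
  have Ux := Hp x (chart_cone ix); set al := p x in Ux.
  have pV : proj_open (U al `&` (chart i `&` chart j)).
    apply: proj_openI; first exact: piece_open.
    by apply: proj_openI; exact: proj_open_chart.
  exists (U al `&` (chart i `&` chart j)), (fun v y => nrm i y (fun w => Psi j al w y - Psi i al w y) v).
  split; [exact: pV|by []|by move=> y []| |].
    apply: (vf_nrm (Th := fun w y => Psi j al w y - Psi i al w y)); [exact: zproj|by move=> y [_ []]|].
    apply: vf_B; [exact: zproj|apply: vf_sub (Pvf j al)|apply: vf_sub (Pvf i al)];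
      by [exact: zproj|move=> y [? []]].
  by move=> v y [Uy [iy jy]]; exact: YE.
have Yeq i j x al : U al x -> chart i x -> chart j x ->
    eqeul x ((Y i j)^~ x) (fun w => Psi j al w x - Psi i al w x).
  move=> Ux ix jx; apply: eqeul_trans (nrm_eqeul i x _).
  by apply: eqeul_eq => v; exact: YE.
have Yc : euler_cocycle Y.
  move=> i j k x Ix.
  have ix : chart i x by apply: Ix; rewrite !inE eqxx.
  have jx : chart j x by apply: Ix; rewrite !inE eqxx orbT.
  have kx : chart k x by apply: Ix; rewrite !inE eqxx !orbT.
  have [al Ux] := cover_pt U (chart_cone ix).
  have [g Hg] := eqeul_B (eqeul_D (Yeq i j x al Ux ix jx) (Yeq j k x al Ux jx kx)) (Yeq i k x al Ux ix kx).
  exists g => v; rewrite Hg [Psi j al v x - _ + _]addrC subrKA subrr add0r //.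
have [S [b [b0 Svf SY]]] := std_cover n2 Yvf Yc.
exists (fun al i v x => Psi i al v x - S i v x), b; split => //.
  move=> al i; have pV : proj_open (U al `&` chart i).
    by apply: proj_openI; [exact: piece_open|exact: proj_open_chart].
  apply: vf_B; [exact: zproj|exact: Pvf|apply: vf_sub (Svf i); first exact: zproj].
  by rewrite chartsE1 => y [].
move=> al be i j x Ua Ub ix jx.
have Sx : eqeul x ((Y i j)^~ x) (fun v => b *: exc i j v x + (S j v x - S i v x)).
  have [|h Hh] := SY i j x; first by rewrite chartsE2.
  by exists h => v; rewrite Hh addrAC [_ + b *: _]addrC.
have E := eqeul_trans (eqeul_sym Sx) (Yeq i j x al Ua ix jx).
have [g Hg] := E.
exists g => v; rewrite (Pc j al be v x Ua Ub jx).
exact: (zmod_shift _ (Hg v)).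
Qed.

End Cocycle.
End TangentCohomology.

(** * The dimension of the first cohomology *)

(** The difference of two normal forms of one cocycle, whose values are p, q,
    c0 and, by the cocycle condition, c0 + p - q. *)
Lemma lam_compare (K : comNzRingType) (m : nat)
    (p q u u' w w' e e' c0 ci g h : grassmann K m) :
  u - u' + e - (w - w' + e') + g = p - q -> ci = c0 + h ->
  e' - e = u - w - (c0 + p - q) - (u' - w' - ci) + (g - h).
Proof.
move=> H ->; apply/ffunP => J; have := congr1 (fun f : grassmann K m => f J) H.
rewrite !ffunE => HJ.
by rewrite -[c0 J + p J - q J]addrA -HJ; ring.
Qed.

Lemma zmod_regroup (V : zmodType) (p q s u w : V) :
  u - w + (p + q - s) = u + q - (w + s) + p.
Proof. by rewrite opprD [in RHS]addrACA -[RHS]addrA [p + q]addrC [q + p - s]addrAC. Qed.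

Lemma zmod_solve (V : zmodType) (p q s t u : V) : p + q = t -> s + u = t -> u = p + q - s.
Proof. by move=> -> <-; rewrite addrC addKr. Qed.

Section Dimension.
Variables (R : realType) (n m : nat).
Local Notation K := R[i].
Local Notation pt := 'rV[K]_n.+1.
Local Notation ind := 'I_n.+1.
Local Notation Lam := (grassmann K m).
Local Notation var := (ind + 'I_m)%type.
Local Notation vf := (var -> pt -> Lam).
Implicit Types (i j k l : ind) (x : pt) (v : var) (J : {set 'I_m}) (a : bool).
Local Notation cover := (@open_cover pt (@proj_open R n) (@cone R n)).
Local Notation T := (@tangent_sheaf R n m).
Local Notation res := (@res_tangent R n m).
Hint Resolve zproj pinv : core.

Lemma coef_change a i j U D x : T a U D -> proj_open U -> U x -> chart i x -> chart j x ->
  eqeul x ((coef i U D)^~ x) ((coef j U D)^~ x).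
Proof.
move=> DT pU Ux ix jx; apply: eqeul_trans (nrm_eqeul i x _); apply: eqeul_eq => v.
exact: (esym (coef_nrm DT pU Ux ix jx v)).
Qed.

Lemma nrm_ext i x (S S' : var -> Lam) : chart i x -> eqeul x S S' -> nrm i x S =1 nrm i x S'.
Proof.
move=> ix [g Hg] v; rewrite /nrm !Hg wedge_eul_inl wedgeDl scalerDr wedgeZl scalerA (mulVf ix).
by rewrite scale1r opprD addrACA subrr addr0.
Qed.

Lemma exc_diag i v x : exc i i v x = 0 :> Lam.
Proof. by case: v => [l|t] //; rewrite /exc eps_rep12 mul0r scale0r. Qed.

(** The pull-back of z along tau is, modulo Euler's field, r times the cocycle
    exc plus the coboundary of Phi on the common refinement of W and of the
    standard cover. *)
Definition normal_form a (U W : cover) (z : idx U -> idx U -> sheaf_op R n m)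
    (tau : idx W -> idx U) (Phi : idx W -> ind -> vf) (r : K) : Prop :=
  [/\ forall al, W al `<=` U (tau al),
    forall al i, vf_on a (W al `&` chart i) (Phi al i) &
    forall al be i j x, W al x -> W be x -> chart i x -> chart j x ->
      eqeul x ((coef j (U (tau al) `&` U (tau be)) (z (tau al) (tau be)))^~ x)
        (fun v => Phi be j v x - Phi al i v x + r *: exc i j v x)].

(** The primitive on the intersection of U al and the chart i is the derivation
    given by Phi al i. *)
Lemma normal_form_coboundary a (U : cover) (z : idx U -> idx U -> sheaf_op R n m) Phi r :
  cocycle1 (T a) res z -> @normal_form a U U z id Phi r ->
  let W := chart_refinement U in
  coboundary1 (T a) res (fun t u : idx W => res (W t `&` W u) (z t.1 u.1) -
    r *: Dop (W t `&` W u) (exc t.2 u.2)).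
Proof.
move=> zc [_ Pvf Pz] W; exists (fun t : idx W => Dop (W t) (Phi t.1 t.2)).
split=> [t|t u]; first exact: (Dop_tangent (Pvf t.1 t.2)).
have pV : proj_open (W t `&` W u) by apply: proj_openI; exact: piece_open.
have VU : W t `&` W u `<=` U t.1 `&` U u.1 by move=> x [[? _] [? _]].
have Vu : W t `&` W u `<=` chart u.2 by move=> x [_ []].
rewrite (res_coef (cocycle_in zc t.1 u.1) (pieceI _ _) pV VU Vu).
rewrite (Dop_res (Phi u.1 u.2) (_ : _ `<=` W u)); last by move=> x [].
rewrite (Dop_res (Phi t.1 t.2) (_ : _ `<=` W t)); last by move=> x [].
rewrite -Dop_B addrC -scaleNr -Dop_P; apply: Dop_ext => x [[Ut it] [Uu iu]].
have [g Hg] := Pz t.1 u.1 t.2 u.2 x Ut Uu it iu.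
exists g => v; have := Hg v => /= ->.
by rewrite scaleNr addrC [_ + _ + wedge _ _]addrAC addrK.
Qed.

Lemma trivial_H1 a : (2 <= n)%N -> ~ [/\ n = 2%N, m = 3%N & a] ->
  H1_dim (@proj_open R n) (@cone R n) (T a) res 0.
Proof.
move=> n2 nob; have no (k : 'I_0) : False by case: k.
exists (fun k : 'I_0 => False_rect _ (no k)) => z; exists 0; split; last first.
  by move=> c _; rewrite thinmx0.
have [Phi [b [b0 Pvf Pz]]] := cocycle_normal_form (cls_cocycle z) n2.
have bE : b = 0 by apply/eqP/negPn/negP => /b0.
have N : @normal_form a _ _ (@cls_cochain _ _ _ _ _ _ _ z) id Phi 0.
  split=> [al x|al i|al be i j x Ua Ub ix jx]; [by []|exact: Pvf|].
  apply: eqeul_trans (Pz al be i j x Ua Ub ix jx) _.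
  by apply: eqeul_eq => v; rewrite bE !scale0r subr0 addr0.
have := normal_form_coboundary (cls_cocycle z) N.
set W := chart_refinement _ => C.
exists W, fst, (fun k : 'I_0 => False_rect _ (no k)); split=> [t x []|k|] //.
move: C; congr coboundary1; apply/funext => t; apply/funext => u.
by rewrite big_ord0 scale0r.
Qed.

Section PlaneWithThreeOddCoordinates.
Hypotheses (n2 : n = 2%N) (m3 : m = 3%N).

Definition exc_cochain i j : sheaf_op R n m := Dop (chart i `&` chart j) (exc i j).

Lemma exc_eqeul i j k x : chart i x -> chart j x -> chart k x ->
  eqeul x (fun v => exc i j v x + exc j k v x) (exc i k ^~ x).
Proof.
move=> ix jx kx; exists ((eps R i j k / \prod_r x 0 r) *: mono R [set: 'I_m]%SET) => v.
have H : charts [:: i; j; k] x by move=> r; rewrite !inE => /or3P[] /eqP ->.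
by rewrite -(exc_cocycle v n2 H) [RHS]addrC subrK.
Qed.

Lemma exc_cochain_cocycle : @cocycle1 _ _ _ _ _ (T true) res (std_cov R n) exc_cochain.
Proof.
split=> [i j|i j k V]; first by apply: Dop_tangent; rewrite -chartsE2; exact: exc_vf.
have S1 : V `<=` chart i `&` chart j by move=> x [].
have S2 : V `<=` chart j `&` chart k by move=> x [[_ jx] kx]; split.
have S3 : V `<=` chart i `&` chart k by move=> x [[ix _] kx]; split.
transitivity (1 *: Dop V (exc i j : vf) + Dop V (exc j k : vf)).
  by rewrite scale1r; exact: congr2 (Dop_res _ S1) (Dop_res _ S2).
rewrite -Dop_P; transitivity (Dop V (exc i k : vf)); last exact: esym (Dop_res _ S3).
apply: Dop_ext => x [[ix jx] kx].
apply: eqeul_trans (exc_eqeul ix jx kx); apply: eqeul_eq => v.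
by rewrite scale1r.
Qed.

Definition exc_class : H1_class (@proj_open R n) (@cone R n) (T true) res :=
  H1Class exc_cochain_cocycle.

Section Uniqueness.
Variable z : H1_class (@proj_open R n) (@cone R n) (T true) res.
Let U := cls_cover z.
Let zz := @cls_cochain _ _ _ _ _ _ _ z.
Let c i al be := coef i (U al `&` U be) (zz al be).

(** The coefficients of exc_(sigma w) are added to those of the primitive, since
    exc_(sigma w, sigma u) = exc_ij + exc_(j, sigma u) - exc_(i, sigma w) modulo
    Euler's field. *)
Lemma lincomb_normal_form r : H1_lincomb (fun=> exc_class) r z ->
  exists (W : cover) tau Phi, @normal_form true U W zz tau Phi (r 0 (ord0 : 'I_1)).
Proof.
move=> [W [tau [sg [Wtau Wsg [s [sT sE]]]]]].
pose sig w := sg ord0 w; have Wsig w x : W w x -> chart (sig w) x by exact: (Wsg ord0).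
exists W, tau, (fun w i v x => coef i (W w) (s w) v x + r 0 ord0 *: exc i (sig w) v x).
have pW w : proj_open (W w) by exact: piece_open.
split=> [//|w i|w u i j x Ww Wu ix jx].
  have z' : zariski_open (W w `&` chart i).
    by apply: zproj; apply: proj_openI; [exact: pW|exact: proj_open_chart].
  have := vf_P (r 0 ord0) z' (vf_sub z' _ (exc_vf R i (sig w) m3)) (coef_vf i (sT w) (pW w)).
  have sub : W w `&` chart i `<=` charts [:: i; sig w].
    by rewrite chartsE2 => y [Wy iy]; split; [|exact: Wsig].
  move=> /(_ sub); congr (vf_on _ _ _); apply/funext => v; apply/funext => y.
  exact: addrC.
have pV : proj_open (W w `&` W u) by exact: pieceI.
have VU : W w `&` W u `<=` U (tau w) `&` U (tau u) by move=> y [/Wtau ? /Wtau ?].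
have Vx : (W w `&` W u) x by [].
have E v : c j (tau w) (tau u) v x =
  coef j (W u) (s u) v x - coef j (W w) (s w) v x + r 0 ord0 *: nrm j x (exc (sig w) (sig u) ^~ x) v.
  have := congr1 (fun D => coef j (W w `&` W u) D v x) (sE w u).
  rewrite big_ord1 coef_B coef_Z coef_B /pull1.
  rewrite (coef_res v (cocycle_in (cls_cocycle z) (tau w) (tau u)) (pieceI _ _) pV VU Vx jx).
  rewrite (coef_res v (sT u) (pW u) pV _ Vx jx); last by move=> y [].
  rewrite (coef_res v (sT w) (pW w) pV _ Vx jx); last by move=> y [].
  rewrite /= Dop_res; last by move=> y [/Wsig ? /Wsig ?].
  by rewrite (coef_Dop _ v pV Vx jx) => /(canRL (subrK _)).
have D1 := exc_eqeul ix (Wsig w x Ww) (Wsig u x Wu).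
have D2 := exc_eqeul ix jx (Wsig u x Wu).
have D : eqeul x (nrm j x ((exc (sig w) (sig u))^~ x))
    (fun v => exc i j v x + exc j (sig u) v x - exc i (sig w) v x).
  apply: eqeul_trans (nrm_eqeul j x _) _.
  have := eqeul_B (eqeul_trans D1 (eqeul_sym D2)) (eqeul_eq x (fun v => erefl (exc i (sig w) v x))).
  by apply: eqeul_trans; apply: eqeul_eq => v; rewrite addrC addKr.
have A := coef_change (sT w) (pW w) Ww jx ix.
have := eqeul_D (eqeul_B (eqeul_eq x (fun v => erefl (coef j (W u) (s u) v x))) A) (eqeul_Z (r 0 ord0) D).
move/(eqeul_trans (eqeul_eq x E)) => H; apply: eqeul_trans H _; apply: eqeul_eq => v.
by rewrite scalerBr scalerDr zmod_regroup.
Qed.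

(** Two normal forms of the same class have the same coefficient of exc: their
    difference trivialises a multiple of it. *)
Lemma normal_form_unique (W W' : cover) tau tau' Phi Phi' r r' :
  @normal_form true U W zz tau Phi r -> @normal_form true U W' zz tau' Phi' r' -> r = r'.
Proof.
move=> [Wt Pvf Pz] [Wt' Pvf' Pz'].
have [p Hp] := cover_choice W; have [p' Hp'] := cover_choice W'.
pose F i w w' : vf := fun v x => Phi w i v x - Phi' w' i v x - c i (tau' w') (tau w) v x.
have FE i j w w' u u' x : W w x -> W' w' x -> W u x -> W' u' x -> chart i x -> chart j x ->
    eqeul x (fun v => (r' - r) *: exc i j v x) (fun v => F j u u' v x - F i w w' v x).
  move=> Ww Ww' Wu Wu' ix jx.
  have [g Hg] := eqeul_B (Pz w u i j x Ww Wu ix jx) (Pz' w' u' i j x Ww' Wu' ix jx).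
  have pU al be : proj_open (U al `&` U be) by exact: pieceI.
  have Ut : (U (tau' w') `&` U (tau w)) x by split; [exact: Wt'|exact: Wt].
  have [h Hh] := coef_change (cocycle_in (cls_cocycle z) (tau' w') (tau w)) (pU _ _) Ut ix jx.
  exists (g - h) => v; rewrite wedgeBl scalerBl.
  have C1 : c j (tau' w') (tau w) v x + c j (tau w) (tau u) v x = c j (tau' w') (tau u) v x.
    exact: (coef_cocycle (cls_cocycle z) v (Wt' w' x Ww') (Wt w x Ww) (Wt u x Wu) jx).
  have C2 : c j (tau' w') (tau' u') v x + c j (tau' u') (tau u) v x = c j (tau' w') (tau u) v x.
    exact: (coef_cocycle (cls_cocycle z) v (Wt' w' x Ww') (Wt' u' x Wu') (Wt u x Wu) jx).
  have C : c j (tau' u') (tau u) v x =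
      c j (tau' w') (tau w) v x + c j (tau w) (tau u) v x - c j (tau' w') (tau' u') v x.
    exact: zmod_solve C1 C2.
  rewrite /F C; exact: (lam_compare (esym (Hg v)) (Hh v)).
have Fvf i w w' : vf_on true (W w `&` W' w' `&` chart i) (F i w w').
  have z' : zariski_open (W w `&` W' w' `&` chart i).
    apply: zproj; apply: proj_openI; last exact: proj_open_chart.
    by apply: proj_openI; exact: piece_open.
  have cvf := coef_vf i (cocycle_in (cls_cocycle z) (tau' w') (tau w)) (pieceI (tau' w') (tau w)).
  apply: vf_B z' (vf_B z' (vf_sub z' _ (Pvf w i)) (vf_sub z' _ (Pvf' w' i))) (vf_sub z' _ cvf).
  - by move=> x [[]].
  - by move=> x [[]].
  - by move=> x [[Ww Ww'] ix]; split=> //; split; [exact: Wt'|exact: Wt].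
pose S i : vf := fun v x => nrm i x ((F i (p x) (p' x))^~ x) v.
have SE i w w' v x : W w x -> W' w' x -> chart i x -> S i v x = nrm i x ((F i w w')^~ x) v.
  move=> Ww Ww' ix; have cx := chart_cone ix.
  have [g Hg] := FE i i w w' (p x) (p' x) x Ww Ww' (Hp x cx) (Hp' x cx) ix ix.
  apply: (nrm_ext ix); exists (- g) => v'; rewrite wedgeNl.
  have := Hg v'; rewrite exc_diag scaler0 => H.
  by apply/eqP; rewrite -subr_eq0 opprD opprK addrA -H.
have Svf i : vf_on true (charts [:: i]) (S i).
  rewrite chartsE1; apply: vf_local => x ix; have cx := chart_cone ix.
  have pV : proj_open (W (p x) `&` W' (p' x) `&` chart i).
    apply: proj_openI; last exact: proj_open_chart.
    by apply: proj_openI; exact: piece_open.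
  exists (W (p x) `&` W' (p' x) `&` chart i), (fun v y => nrm i y ((F i (p x) (p' x))^~ y) v).
  split; [exact: pV|by split; [split; [exact: Hp|exact: Hp']|]|by move=> y []| |].
    by apply: vf_nrm (zproj pV) _ (Fvf i _ _) => y [].
  by move=> v y [[Wy Wy'] iy]; exact: SE.
have H := exc_nontrivial (c := r' - r) n2 m3 Svf.
apply/eqP; rewrite eq_sym -subr_eq0; apply/eqP; apply: H => i j x.
rewrite chartsE2 => -[ix jx]; have cx := chart_cone ix.
have := FE i j _ _ _ _ x (Hp x cx) (Hp' x cx) (Hp x cx) (Hp' x cx) ix jx.
move/eqeul_trans; apply; apply: eqeul_B; exact: eqeul_sym (nrm_eqeul _ _ _).
Qed.

End Uniqueness.

Theorem odd_H1 : H1_dim (@proj_open R n) (@cone R n) (T true) res 1.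
Proof.
exists (fun=> exc_class) => z.
have [|Phi [b [_ Pvf Pz]]] := cocycle_normal_form (cls_cocycle z); first by rewrite n2.
have N : @normal_form true _ _ (@cls_cochain _ _ _ _ _ _ _ z) id Phi (- b).
  split=> [al x|al i|al be i j x Ua Ub ix jx]; [by []|exact: Pvf|].
  apply: eqeul_trans (Pz al be i j x Ua Ub ix jx) _.
  by apply: eqeul_eq => v; rewrite scaleNr.
exists (const_mx (- b)); split=> [|c' /lincomb_normal_form[W [tau [Phi' N']]]]; last first.
  by apply/rowP => k; rewrite (ord1 k) mxE; exact: normal_form_unique N N'.
have := normal_form_coboundary (cls_cocycle z) N.
set W := chart_refinement _ => C.
exists W, fst, (fun _ => snd); split=> [t x []|k t x []|] //.
move: C; congr coboundary1; apply/funext => t; apply/funext => u.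
rewrite big_ord1 mxE; congr (_ - _ *: _); symmetry; apply: Dop_res.
by move=> x [[_ ?] [_ ?]].
Qed.

End PlaneWithThreeOddCoordinates.
End Dimension.

Local Close Scope ring_scope.
Local Close Scope classical_set_scope.

Theorem mainTheorem8 (R : realType) (n m : nat) (hn : (2 <= n)%N) :
  ((n, m) <> (2, 3) -> h1_tangent R n m 0 0) /\
  ((n, m) = (2, 3) -> h1_tangent R n m 0 1).
Proof.
split=> [nm|[n2 m3]]; split; try by apply: trivial_H1 => // -[n2 m3 _]; apply: nm; rewrite n2 m3.
  by apply: trivial_H1 => // -[].
exact: odd_H1.
Qed.
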